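(* Let $V$ be either a field or a complete $p$-ring, let $d,n,m$ be natural numbers with either $n\ge 2$ and $m=2$, or $n=2$ and $m$ odd, and let $R$ be an analytic ring belonging to the family $\mathcal T_{d,n,m}(V)$. (EQUI) If $V$ is an uncountable algebraically closed field whose characteristic does not divide $m$, then $R$ admits a very small MCM. (MIX) If $V$ is a complete $p$-ring, then $R$ admits a big MCM.
   Context: Complete $p$-ring: a complete discrete valuation ring of mixed characteristic with uniformizing parameter $p$. Analytic ring: a Noetherian local ring $R$ that is complete, has an algebraically closed residue field of uncountable cardinality, and, in the mixed characteristic case, is torsion-free over some complete $p$-ring. The families $\mathcal T_{d,n,m}(V)$: let $S:=V[[y_1,\dots,y_d]]$ and let $\mathbf u=(u_1,\dots,u_n)$ be variables. Let $\mathbf y$ be the tuple $(y_1,\dots,y_d)$ if $V$ is a field, and the tuple $(p,y_1,\dots,y_d)$ if $V$ is a complete $p$-ring; $\mathbf y^\alpha$ denotes the monomial in $\mathbf y$ with exponent tuple $\alpha$ (a tuple of natural numbers of the same length as $\mathbf y$). Then $\mathcal T_{d,n,m}(V)$ consists of all rings $R:=S[[\mathbf u]]/I$ where $I$ is generated as follows. - Case $n\ge2$, $m=2$: by the binomials $u_i^2-a_i\mathbf y^{\alpha_i}$ ($1\le i\le n$) and $u_iu_j-b_{ij}\mathbf y^{\beta_{ij}}$ ($1\le i<j\le n$), with $a_i,b_{ij}$ units in $S$ such that $a_ia_j=b_{ij}^2$ and $\alpha_i+\alpha_j=2\beta_{ij}$. - Case $n=2$, $m$ odd: by the binomials $u_i^m-a_i\mathbf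 y^{\alpha_i}$ for $i=1,2$ and $u_1u_2-b\mathbf y^\beta$, with $a_1,a_2,b$ units in $S$ such that $a_1a_2=b^m$ and $\alpha_1+\alpha_2=m\beta$. A (not necessarily finitely generated, ''big'') module $Q$ over a Noetherian local ring $R$ is a maximal Cohen-Macaulay module (MCM) if its depth equals $\dim R$; it is understood to be balanced, i.e. every system of parameters of $R$ is a $Q$-regular sequence. It is small if it is finitely generated. In equal characteristic, a small MCM is very small if its multiplicity (with respect to the maximal ideal of $R$) is at most the parameter degree of $R$, which is the smallest length of $R/J$ as $J$ ranges over all ideals generated by a system of parameters of $R$. *)

(* Defs.v *)
From HB Require Import structures.
From mathcomp Require Import all_boot all_order all_algebra.
From mathcomp Require Import mpoly.
From mathcomp Require Import boolp classical_sets cardinality.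

Set Implicit Arguments.
Unset Strict Implicit.
Unset Printing Implicit Defensive.

Import Order.TTheory GRing.Theory Num.Theory.

Local Open Scope classical_set_scope.
Local Open Scope ring_scope.

(* Power series over A in the n variables indexed by 'I_n, given by their
   coefficient families indexed by the exponents 'X_{1..n}. *)
Record mpseries (n : nat) (A : Type) := MPSeries { pscoef : 'X_{1..n} -> A }.

HB.instance Definition _ (n : nat) (A : Type) := gen_eqMixin (mpseries n A).
HB.instance Definition _ (n : nat) (A : Type) := gen_choiceMixin (mpseries n A).

Lemma mpseriesP n A (f g : mpseries n A) :
  (forall a, pscoef f a = pscoef g a) -> f = g.
Proof. by case: f g => [f] [g] /= fg; congr MPSeries; apply/funext. Qed.

Section PowerSeriesZmod.
Variables (n : nat) (A : comNzRingType).
Implicit Types f g h : mpseries n A.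

Definition mps_zero : mpseries n A := MPSeries (fun=> 0).
Definition mps_add f g := MPSeries (fun a => pscoef f a + pscoef g a).
Definition mps_opp f := MPSeries (fun a => - pscoef f a).

Fact mps_addA : associative mps_add.
Proof. by move=> f g h; apply: mpseriesP => a /=; rewrite addrA. Qed.
Fact mps_addC : commutative mps_add.
Proof. by move=> f g; apply: mpseriesP => a /=; rewrite addrC. Qed.
Fact mps_add0 : left_id mps_zero mps_add.
Proof. by move=> f; apply: mpseriesP => a /=; rewrite add0r. Qed.
Fact mps_addN : left_inverse mps_zero mps_opp mps_add.
Proof. by move=> f; apply: mpseriesP => a /=; rewrite addNr. Qed.
HB.instance Definition _ := GRing.isZmodule.Build (mpseries n A)
  mps_addA mps_addC mps_add0 mps_addN.

Definition mpsC (c : A) : mpseries n A :=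
  MPSeries (fun a => if a == 0%MM then c else 0).

Definition mpsX (i : 'I_n) : mpseries n A :=
  MPSeries (fun a => if a == U_(i)%MM then 1 else 0).

(* Cauchy product; the bounds on the exponents only serve to make the index
   type of the sum finite, cf. mcoeffM. *)
Definition mps_mul f g := MPSeries (fun a =>
  \sum_(k : 'X_{1..n < (mdeg a).+1, (mdeg a).+1} | a == (k.1 + k.2)%MM)
     pscoef f k.1 * pscoef g k.2).

Definition mps_trunc (k : nat) f : {mpoly A[n]} :=
  \sum_(a : 'X_{1..n < k}) pscoef f a *: 'X_[a].

Lemma mps_truncE k f a : (mdeg a < k)%N -> (mps_trunc k f)@_a = pscoef f a.
Proof.
move=> ak; rewrite /mps_trunc raddf_sum /= (bigD1 (BMultinom ak)) //=.
rewrite mcoeffZ mcoeffX eqxx mulr1 big1 ?addr0 // => b ba.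
rewrite mcoeffZ mcoeffX; case: eqP => [e|]; last by rewrite mulr0.
by case/eqP: ba; apply: val_inj.
Qed.

Lemma mps_mulE f g (p q : {mpoly A[n]}) k a : (mdeg a < k)%N ->
  (forall b, (mdeg b < k)%N -> p@_b = pscoef f b) ->
  (forall b, (mdeg b < k)%N -> q@_b = pscoef g b) ->
  (p * q)@_a = pscoef (mps_mul f g) a.
Proof.
move=> ak pf qg; rewrite mcoeffM /=; apply: eq_bigr => b _.
by rewrite pf ?qg // (leq_trans (bmdeg _)).
Qed.

Lemma mps_trunc_mul f g k a : (mdeg a < k)%N ->
  (mps_trunc k f * mps_trunc k g)@_a = pscoef (mps_mul f g) a.
Proof. by move=> ak; apply: (mps_mulE ak) => b bk; rewrite mps_truncE. Qed.

Lemma mpsC_trunc c b : (c%:MP_[n])@_b = pscoef (mpsC c) b.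
Proof. by rewrite mcoeffC /=; case: eqP; rewrite ?(mulr1, mulr0). Qed.

Fact mps_mulA : associative mps_mul.
Proof.
move=> f g h; apply: mpseriesP => a; set k := (mdeg a).+1.
have ak : (mdeg a < k)%N by [].
rewrite -(@mps_mulE f _ (mps_trunc k f) (mps_trunc k g * mps_trunc k h) k) //.
- rewrite mulrA; apply: (@mps_mulE _ _ _ _ k) => // b bk.
  + exact: mps_trunc_mul.
  + exact: mps_truncE.
- by move=> b bk; apply: mps_truncE.
- by move=> b bk; apply: mps_trunc_mul.
Qed.
Fact mps_mulC : commutative mps_mul.
Proof.
move=> f g; apply: mpseriesP => a.
by rewrite -!(@mps_trunc_mul _ _ (mdeg a).+1) // mulrC.
Qed.
Fact mps_mul1 : left_id (mpsC 1) mps_mul.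
Proof.
move=> f; apply: mpseriesP => a; set k := (mdeg a).+1.
rewrite -(@mps_mulE _ _ 1%:MP (mps_trunc k f) k) ?mpolyC1 ?mul1r.
- by rewrite mps_truncE.
- by [].
- by move=> b _; rewrite -mpolyC1 mpsC_trunc.
- by move=> b bk; apply: mps_truncE.
Qed.
Fact mps_mulDl : left_distributive mps_mul mps_add.
Proof.
move=> f g h; apply: mpseriesP => a /=; rewrite -big_split /=.
by apply: eq_bigr => b _; rewrite mulrDl.
Qed.
Fact mps_1_neq0 : mpsC 1 != 0.
Proof.
by apply/eqP => /(congr1 (fun f => pscoef f 0%MM))/eqP; rewrite /= eqxx oner_eq0.
Qed.
HB.instance Definition _ := GRing.Zmodule_isComNzRing.Build (mpseries n A)
  mps_mulA mps_mulC mps_mul1 mps_mulDl mps_1_neq0.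

Definition mps_unit : pred (mpseries n A) := fun f => `[< exists g, g * f = 1 >].
Definition mps_inv f : mpseries n A := xget f [set g | g * f = 1].

Fact mps_mulV : {in mps_unit, left_inverse 1 mps_inv *%R}.
Proof.
move=> f; rewrite unfold_in => /asboolP uf.
by rewrite /mps_inv; case: xgetP => [g _ //|]; case: uf => g gf /(_ g).
Qed.
Fact mps_unitPl f g : g * f = 1 -> mps_unit f.
Proof. by move=> gf; apply/asboolP; exists g. Qed.
Fact mps_inv_out : {in [predC mps_unit], mps_inv =1 id}.
Proof.
move=> f; rewrite inE unfold_in => /asboolP nuf.
by rewrite /mps_inv; case: xgetP => [g _ /= gf|//]; case: nuf; exists g.
Qed.
HB.instance Definition _ := GRing.ComNzRing_hasMulInverse.Build (mpseries n A)
  mps_mulV mps_unitPl mps_inv_out.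

End PowerSeriesZmod.

Section Submodules.
Variables (R : comUnitRingType) (M : lmodType R).

Definition submodule (N : set M) : Prop :=
  N 0 /\ forall (a : R) (x y : M), N x -> N y -> N (a *: x + y).

(* submodule generated by X *)
Definition span (X : set M) : set M :=
  [set x | forall N : set M, submodule N -> X `<=` N -> N x].

Definition finitely_generated (N : set M) : Prop :=
  exists s : seq M, N = span [set` s].

(* The product I N, for I a set of scalars and N a set of vectors. *)
Definition smul (I : set R) (N : set M) : set M :=
  span [set a *: x | a in I & x in N].

(* The quotient module M / N has length l (composition series from N to M). *)
Definition quot_has_length (N : set M) (l : nat) : Prop :=
  exists c : nat -> set M,
    [/\ c 0%N = N, c l = setT,
        forall i, (i <= l)%N -> submodule (c i) &
        forall i, (i < l)%N -> c i `<` c i.+1 /\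
          forall K, submodule K -> c i `<=` K -> K `<=` c i.+1 ->
            K = c i \/ K = c i.+1].

End Submodules.

Section LocalRings.
Variable R : comUnitRingType.

Definition ideal (I : set R) : Prop := submodule (M := R^o) I.

Definition ideal_gen (X : set R) : set R := span (M := R^o) X.

Fixpoint ideal_exp (I : set R) (k : nat) : set R :=
  if k is k'.+1 then smul (M := R^o) I (ideal_exp I k') else setT.

Definition noetherian : Prop :=
  forall I : set R, ideal I -> finitely_generated (M := R^o) I.

Definition nonunits : set R := [set x | x \isn't a GRing.unit].

(* The nonunits are then the maximal ideal. *)
Definition local : Prop := ideal nonunits.

(* For local R: Hausdorff and sequentially complete for the topology given by
   the powers of the maximal ideal. *)
Definition complete : Prop :=
  (forall x : R, (forall k, ideal_exp nonunits k x) -> x = 0) /\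
  (forall x : nat -> R, (forall k, ideal_exp nonunits k (x k.+1 - x k)) ->
     exists l, forall k, ideal_exp nonunits k (l - x k)).

(* For local R: R and its residue field have different characteristics, i.e.
   some integer vanishes in the residue field but not in R. *)
Definition mixed_char : Prop :=
  exists n : nat, nonunits n%:R /\ (n%:R : R) != 0.

Definition prime_ideal (P : set R) : Prop :=
  [/\ ideal P, P != setT & forall x y, P (x * y) -> P x \/ P y].

Definition prime_chain (k : nat) : Prop :=
  exists c : nat -> set R,
    (forall i, (i <= k)%N -> prime_ideal (c i)) /\
    (forall i, (i < k)%N -> c i `<` c i.+1).

Definition krull_dim (k : nat) : Prop :=
  prime_chain k /\ forall l, prime_chain l -> (l <= k)%N.

(* For local R: dim R elements generating an ideal which is primary to the
   maximal ideal. *)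
Definition sop (x : seq R) : Prop :=
  [/\ krull_dim (size x), [set` x] `<=` nonunits &
      forall a, nonunits a -> exists k, ideal_gen [set` x] (a ^+ k)].

Definition parameter_degree (c : nat) : Prop :=
  (exists2 x, sop x & quot_has_length (M := R^o) (ideal_gen [set` x]) c) /\
  (forall x l, sop x -> quot_has_length (M := R^o) (ideal_gen [set` x]) l ->
     (c <= l)%N).

End LocalRings.

Arguments nonunits R : clear implicits.
Arguments noetherian R : clear implicits.
Arguments local R : clear implicits.
Arguments complete R : clear implicits.
Arguments mixed_char R : clear implicits.
Arguments krull_dim R k : clear implicits.
Arguments parameter_degree R c : clear implicits.

Definition uncountable (T : Type) : Prop := ~ countable [set: T].

Definition dvr (V : idomainType) : Prop :=
  [/\ local V, (exists2 x : V, x != 0 & nonunits V x) &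
      forall I : set V, ideal I -> exists a, I = ideal_gen [set a]].

Definition complete_pring (p : nat) (V : idomainType) : Prop :=
  [/\ prime p, dvr V, complete V, mixed_char V &
      nonunits V = ideal_gen [set p%:R]].

Definition torsion_free_over (W R : comUnitRingType) : Prop :=
  exists f : {rmorphism W -> R}, forall w x, f w * x = 0 -> w = 0 \/ x = 0.

(* The residue field is given as the target k of a surjective morphism from
   the local ring R. *)
Definition analytic (R : comUnitRingType) : Prop :=
  [/\ noetherian R, local R, complete R,
      (exists (k : fieldType) (pi : {rmorphism R -> k}),
         [/\ forall y, exists x, pi x = y,
             GRing.closed_field_axiom k & uncountable k]) &
      mixed_char R -> exists (p : nat) (W : idomainType),
        complete_pring p W /\ torsion_free_over W R].

Section CohenMacaulay.
Variables (R : comUnitRingType) (Q : lmodType R).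

Definition regular_seq (x : seq R) : Prop :=
  (forall i, (i < size x)%N -> forall q : Q,
     smul (ideal_gen [set` take i x]) setT (x`_i *: q) ->
     smul (ideal_gen [set` take i x]) setT q) /\
  smul (ideal_gen [set` x]) (setT : set Q) != setT.

Definition depth (k : nat) : Prop :=
  (exists x, [/\ [set` x] `<=` nonunits R, regular_seq x & size x = k]) /\
  (forall x, [set` x] `<=` nonunits R -> regular_seq x -> (size x <= k)%N).

Definition MCM : Prop :=
  (exists2 k, krull_dim R k & depth k) /\
  (forall x, sop x -> regular_seq x).

Definition small_MCM : Prop := MCM /\ finitely_generated (setT : set Q).

(* e = lim_k d! length(Q / m^k Q) / k^d, where d = dim R (equal to dim Q when
   Q is a small MCM). *)
Definition multiplicity (e : rat) : Prop :=
  exists2 d, krull_dim R d &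
  forall eps : rat, 0 < eps -> exists N, forall k, (N <= k)%N ->
    exists2 l, quot_has_length (smul (ideal_exp (nonunits R) k) (setT : set Q)) l
             & `|d`!%:R * l%:R / k%:R ^+ d - e| < eps.

Definition very_small_MCM : Prop :=
  small_MCM /\
  exists e c, [/\ multiplicity e, parameter_degree R c & e <= c%:R].

End CohenMacaulay.

(* With S = V[[y_1, .., y_d]] and ybar a tuple of k elements of S, R is
   isomorphic to S[[u_1, .., u_n]] / I, where I is generated by the binomials
     u_i^m - a_i ybar^(alpha_i)  and  u_i u_j - b_ij ybar^(beta_ij)  (i < j),
   subject to a_i a_j = b_ij^m and alpha_i + alpha_j = m beta_ij.  For m = 2
   and for n = 2 this specializes to the two cases of the definition. *)
Definition T_family_with (V : comNzRingType) (d n m k : nat)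
    (ybar : 'I_k -> mpseries d V) (R : comUnitRingType) : Prop :=
  let S : comUnitRingType := mpseries d V in
  let P : comUnitRingType := mpseries n S in
  let u (i : 'I_n) : P := mpsX S i in
  let term (c : S) (gamma : 'X_{1..k}) : P := mpsC n (c * mmap1 ybar gamma) in
  exists (a : 'I_n -> S) (b : 'I_n -> 'I_n -> S)
         (alpha : 'I_n -> 'X_{1..k}) (beta : 'I_n -> 'I_n -> 'X_{1..k}),
  [/\ forall i, a i \is a GRing.unit,
      forall i j : 'I_n, (i < j)%N ->
        [/\ b i j \is a GRing.unit, a i * a j = b i j ^+ m &
            (alpha i + alpha j)%MM = (beta i j *+ m)%MM] &
      exists phi : {rmorphism P -> R},
        (forall r, exists f, phi f = r) /\
        (forall f, phi f = 0 <->
           ideal_gen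
             ([set u i ^+ m - term (a i) (alpha i) | i in [set: 'I_n]] `|`
              [set g | exists i j : 'I_n, (i < j)%N /\
                 g = u i * u j - term (b i j) (beta i j)]) f)].

(* T_{d,n,m}(V) for a field V, where ybar = (y_1, .., y_d) ... *)
Definition T_family_field (V : fieldType) (d n m : nat) (R : comUnitRingType) :=
  @T_family_with V d n m d (fun i => mpsX V i) R.

(* ... and for a complete p-ring V, where ybar = (p, y_1, .., y_d). *)
Definition T_family_pring (p : nat) (V : idomainType) (d n m : nat)
    (R : comUnitRingType) :=
  @T_family_with V d n m d.+1
    (fun i => if unlift ord0 i is Some j then mpsX V j else p%:R) R.

(* Main.v *)
(* Let Z be a smallest set of entries of ybar modulo which the coefficients of the
   u_i that do not become nilpotent satisfy b_0i b_0j = a_0 b_ij.  Put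
   S' = W[[y_l : l not in Z]], where W = V, or W is the residue field of R if p
   lies in Z.  The big MCM is the free module Q = S'^r with r = m (r = 1 if all
   u_i become nilpotent): its basis vectors stand for the monomials
   u^j / y^floor(j alpha / m) in one surviving u = u_0, and all the u_i act on
   them by monomial matrices.  For every prime q of R the compatibility holds
   modulo the y_l in q, so at most #(complement of Z) of the y_l lie outside q,
   and by Krull's height theorem chains of primes from q are no longer than that.
   As the variables of S' form a Q-regular sequence of this length, R has
   dimension #(complement of Z), and exchanging regular elements makes every
   system of parameters regular.

   In the equicharacteristic case, m^N Q lies between submodules spanned by
   monomials whose colengths are sums over j in J of numbers of monomials of
   degree < N - rho_j, up to a bounded shift of N; hence e(Q) = #J.  For a
   parameter ideal I the length of R/I^N is at most length(R/I) times the number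
   of monomials of degree < N, while the preimages in R of the same monomial
   submodules under x |-> x e_0 bound it from below by the same counts; hence
   e(Q) <= length(R/I). *)

From HB Require Import structures.
From Pilot Require Import Defs.
From mathcomp Require Import all_boot all_order all_algebra.
From mathcomp Require Import bigenough mpoly.
From mathcomp Require Import boolp classical_sets.
From mathcomp Require Import ring zify lra.
Import Pilot.Defs.

Set Implicit Arguments.
Unset Strict Implicit.
Unset Printing Implicit Defensive.

Import Order.TTheory GRing.Theory Num.Theory.
Local Open Scope classical_set_scope.
Local Open Scope ring_scope.
Import BigEnough.

(** * Noetherian modules and Krull's height theorem *)

(** The obstacle is a sign. For m = 2 the relations give only (b_0i b_0j)^2 = (a_0 b_ij)^2, so the
    two products agree up to sign. With the wrong sign, the two evaluations of u_0 u_i u_0 u_j make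
    2 times a unit times a monomial vanish in R: a prime avoiding 2 must then contain an entry of
    ybar, and the dimension of R can drop. This is why some entries have to be killed before the u_i
    can act by commuting monomial matrices, and why they may be chosen by cardinality alone: every
    prime determines an admissible set. With n = 2 there is no third index and the sign never
    appears. The floor in the basis keeps all u_i integral. Once u_0 acts, u_i is forced to be b_0i
    y^beta_0i / u_0, and alpha_0 + alpha_i = m beta_0i makes this quotient a matrix of monomials
    again. The commutative algebra stays inside R and Q: localized statements become saturations of
    submodules, orders of growth become inequalities of natural numbers, and the independence of
    depth from the chosen sequence comes from one element, found by prime avoidance, that is regular
    on several quotients at once. *)

Section Modules.
Variables (R : comUnitRingType) (M : lmodType R).
Implicit Types (N K L : set M) (a b r s : R) (x y q : M).

Lemma submodule0 N : submodule N -> N 0.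
Proof. by case. Qed.
Lemma submD N x y : submodule N -> N x -> N y -> N (x + y).
Proof. by case=> _ h nx ny; rewrite -[x]scale1r; apply: h. Qed.
Lemma submZ N a x : submodule N -> N x -> N (a *: x).
Proof. by case=> h0 h nx; rewrite -[_ *: _]addr0; apply: h. Qed.
Lemma submN N x : submodule N -> N x -> N (- x).
Proof. by move=> sN nx; rewrite -scaleN1r; apply: submZ. Qed.
Lemma submB N x y : submodule N -> N x -> N y -> N (x - y).
Proof. by move=> sN nx ny; apply: submD => //; apply: submN. Qed.
Lemma submDr N x y : submodule N -> N x -> N (x + y) -> N y.
Proof. by move=> sN nx nxy; have := submB sN nxy nx; rewrite addrC addKr. Qed.
Lemma subm_sum N (I : Type) (s : seq I) (P : pred I) (F : I -> M) :
  submodule N -> (forall i, P i -> N (F i)) -> N (\sum_(i <- s | P i) F i).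
Proof.
move=> sN h; elim/big_ind: _ => //; first exact: submodule0.
by move=> x y; apply: submD.
Qed.

Lemma submT : submodule (setT : set M).
Proof. by []. Qed.
Lemma subm_zero : submodule ([set 0] : set M).
Proof. by split=> // a x y /= -> ->; rewrite scaler0 addr0. Qed.
Lemma submI N K : submodule N -> submodule K -> submodule (N `&` K).
Proof.
move=> sN sK; split; first by split; apply: submodule0.
by move=> a x y [? ?] [? ?]; split; apply: submD => //; apply: submZ.
Qed.

Lemma span_sub (X : set M) : submodule (span X).
Proof.
split=> [N sN _|a x y hx hy N sN XN]; first exact: submodule0.
by apply: submD => //; [apply: submZ => //; apply: hx | apply: hy].
Qed.
Lemma sub_span (X : set M) : X `<=` span X.
Proof. by move=> x Xx N _; apply. Qed.
Lemma span_min (X N : set M) : submodule N -> X `<=` N -> span X `<=` N.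
Proof. by move=> sN XN x; apply. Qed.
Lemma span_mono (X Y : set M) : X `<=` Y -> span X `<=` span Y.
Proof.
by move=> XY; apply: span_min; [exact: span_sub | move=> x /XY; apply: sub_span].
Qed.

Definition addsm N K : set M := [set x | exists2 y, N y & K (x - y)].

Lemma addsm_sub N K : submodule N -> submodule K -> submodule (addsm N K).
Proof.
move=> sN sK; split; first by exists 0; rewrite ?subrr; apply: submodule0.
move=> a x y [x' nx kx] [y' ny ky]; exists (a *: x' + y').
  by apply: submD => //; apply: submZ.
rewrite (_ : _ - _ = a *: (x - x') + (y - y')).
  by apply: submD => //; apply: submZ.
by rewrite scalerBr opprD !addrA -!addrA; congr (_ + _); rewrite addrCA.
Qed.
Lemma addsml N K : submodule K -> N `<=` addsm N K.
Proof. by move=> sK x nx; exists x => //; rewrite subrr; apply: submodule0. Qed.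
Lemma addsmr N K : submodule N -> K `<=` addsm N K.
Proof. by move=> sN x kx; exists 0; rewrite ?subr0 //; apply: submodule0. Qed.
Lemma addsm_min N K L : submodule L -> N `<=` L -> K `<=` L -> addsm N K `<=` L.
Proof.
move=> sL NL KL x [y /NL ny /KL ky].
by rewrite -(subrK y x); apply: submD.
Qed.
Lemma addsmP N K x y : N x -> K y -> addsm N K (x + y).
Proof. by move=> nx ky; exists x => //; rewrite addrC addKr. Qed.

Definition scl a : set M := [set a *: x | x in setT].
Lemma scl_sub a : submodule (scl a).
Proof.
split; first by exists 0 => //; rewrite scaler0.
move=> b _ _ [x _ <-] [y _ <-]; exists (b *: x + y) => //.
by rewrite scalerDr !scalerA mulrC.
Qed.
Definition line x : set M := [set a *: x | a in setT].
Lemma line_sub x : submodule (line x).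
Proof.
split; first by exists 0 => //; rewrite scale0r.
move=> b _ _ [a _ <-] [c _ <-]; exists (b * a + c) => //.
by rewrite scalerDl scalerA.
Qed.

Definition addx N a := addsm N (scl a).
Lemma addx_sub N a : submodule N -> submodule (addx N a).
Proof. by move=> sN; apply: addsm_sub => //; apply: scl_sub. Qed.
Lemma addx_incl N a : N `<=` addx N a.
Proof. exact/addsml/scl_sub. Qed.
Lemma addx_scal N a q : submodule N -> addx N a (a *: q).
Proof. by move=> sN; apply: addsmr => //; exists q. Qed.
Lemma addx_ex N a q : addx N a q -> exists n q', N n /\ q = n + a *: q'.
Proof.
by move=> [n nn [q' _ e]]; exists n, q'; split => //; rewrite e addrC subrK.
Qed.
Lemma addxC N a b : submodule N -> addx (addx N a) b = addx (addx N b) a.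
Proof.
have sub c d : submodule N -> addx (addx N c) d `<=` addx (addx N d) c.
  move=> sN q /addx_ex [_ [q' [/addx_ex [n [q'' [nn ->]]] ->]]].
  rewrite addrAC; apply: addsmP; last by exists q''.
  by apply: addsmP => //; exists q'.
by move=> sN; apply/seteqP; split; apply: sub.
Qed.

Definition addl N q := addsm N (line q).
Lemma addl_sub N q : submodule N -> submodule (addl N q).
Proof. by move=> sN; apply: addsm_sub => //; apply: line_sub. Qed.
Lemma addl_incl N q : N `<=` addl N q.
Proof. exact/addsml/line_sub. Qed.
Lemma addl_mem N q : submodule N -> addl N q q.
Proof. by move=> sN; apply: addsmr => //; exists 1; rewrite ?scale1r. Qed.
Lemma addl_ex N q x : addl N q x -> exists n a, N n /\ x = n + a *: q.
Proof.
by move=> [n nn [a _ e]]; exists n, a; split => //; rewrite e addrC subrK.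
Qed.
Lemma addl_min N q L : submodule L -> N `<=` L -> L q -> addl N q `<=` L.
Proof.
move=> sL NL Lq; apply: addsm_min => // _ [a _ <-]; exact: submZ.
Qed.

Lemma span_seq_cons q (s : seq M) : span [set` q :: s] = addl (span [set` s]) q.
Proof.
apply/seteqP; split.
  apply: span_min; first exact/addl_sub/span_sub.
  move=> x /=; rewrite inE => /orP[/eqP->|xs]; first exact/addl_mem/span_sub.
  by apply: addl_incl; apply: sub_span.
apply: addl_min; first exact: span_sub.
  by apply: span_mono => x /= xs; rewrite inE xs orbT.
by apply: sub_span; rewrite /= inE eqxx.
Qed.
Lemma span_seq_nil : span [set` ([::] : seq M)] = [set 0].
Proof.
apply/seteqP; split; last by move=> x ->; apply: submodule0; apply: span_sub.
by apply: span_min; [exact: subm_zero | move=> x].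
Qed.
Definition colon N q : set R := [set a | N (a *: q)].

Lemma colon_ideal N q : submodule N -> ideal (colon N q).
Proof.
move=> sN; split; first by rewrite /colon /= scale0r; apply: submodule0.
move=> a x y; rewrite /colon /= => hx hy.
by rewrite scalerDl -scalerA; apply: submD => //; apply: submZ.
Qed.

Definition noeth_mod := forall N : set M, submodule N -> finitely_generated N.

Lemma fin_in_chain (c : nat -> set M) (s : seq M) :
  (forall i, c i `<=` c i.+1) -> (forall x, x \in s -> exists i, c i x) ->
  exists i, forall x, x \in s -> c i x.
Proof.
move=> ci; have mono i j : (i <= j)%N -> c i `<=` c j.
  by move=> /subnK <-; elim: (_ - _)%N => // k IH x /IH /ci.
elim: s => [|x s IH] h; first by exists 0%N.
have [|i hi] := IH; first by move=> y ys; apply: h; rewrite inE ys orbT.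
have [j hj] := h x (mem_head _ _).
exists (maxn i j) => y; rewrite inE => /orP[/eqP->|/hi].
  exact: (mono j _ (leq_maxr _ _)).
exact: (mono i _ (leq_maxl _ _)).
Qed.

(** Without a maximal member, choice yields a strictly ascending chain in F; its union is finitely
    generated, hence reached at a finite stage. *)
Lemma max_principle (F : set (set M)) : noeth_mod ->
  F !=set0 -> (forall N, F N -> submodule N) ->
  exists2 N, F N & forall K, F K -> N `<=` K -> K `<=` N.
Proof.
move=> hn [N0 FN0] Fs; apply: contrapT => hno.
have step (N : {N | F N}) : exists K : {N | F N},
    sval N `<=` sval K /\ ~ (sval K `<=` sval N).
  case: N => N FN; apply: contrapT => h; apply: hno; exists N => // K FK NK.
  by apply: contrapT => nKN; apply: h; exists (exist _ K FK).
have [f hf] := choice step.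
pose c n := sval (iter n f (exist _ N0 FN0)).
have cs n : submodule (c n) by apply: Fs; rewrite /c; case: (iter _ _ _).
have ci n : c n `<=` c n.+1 by have [] := hf (iter n f (exist _ N0 FN0)).
have cn n : ~ (c n.+1 `<=` c n) by have [] := hf (iter n f (exist _ N0 FN0)).
have mono i j : (i <= j)%N -> c i `<=` c j.
  by move=> /subnK <-; elim: (_ - _)%N => // k IH x /IH /ci.
pose U : set M := [set x | exists n, c n x].
have sU : submodule U.
  split; first by exists 0%N; apply: submodule0.
  move=> a x y [i hi] [j hj]; exists (maxn i j); apply: submD => //.
    by apply: submZ => //; apply: (mono i _ (leq_maxl _ _)).
  exact: (mono j _ (leq_maxr _ _)).
have [s Us] := hn U sU.
have [|i hi] := @fin_in_chain c s ci.
  by move=> x xs; have : U x by rewrite Us; apply: sub_span.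
apply: (cn i) => x xi; have : U x by exists i.+1.
by rewrite Us; apply: span_min.
Qed.

End Modules.
Arguments noeth_mod {R} M.

Section NoethFg.
Variables (R : comUnitRingType) (M : lmodType R).

(** Induction on the generators of M. The coefficients of the first generator in elements of N form
    an ideal I; lifts to N of generators of I, together with generators of the intersection of N
    with the span of the other generators, generate N. *)
Lemma fg_noeth : noetherian R -> finitely_generated (setT : set M) -> noeth_mod M.
Proof.
move=> hn [s Ms] N sN.
have : N `<=` span [set` s] by rewrite -Ms.
elim: s N sN {Ms} => [|x s IH] N sN Nsub.
  exists [::]; apply/seteqP; split => // y; rewrite span_seq_nil => ->.
  exact: submodule0.
have [S0 S0E] : exists S0, S0 = span [set` s] by exists (span [set` s]).
have sS : submodule S0 by rewrite S0E; apply: span_sub.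
pose I : set R := [set a | exists2 n, N n & S0 (n - a *: x)].
have iI : ideal I.
  split; first by exists 0; [exact: submodule0 | rewrite scale0r subr0; exact: submodule0].
  move=> a b c [n nn hn'] [n' nn' hn'']; exists (a *: n + n').
    by apply: submD => //; apply: submZ.
  rewrite (_ : _ - _ = a *: (n - b *: x) + (n' - c *: x)).
    by apply: submD => //; apply: submZ.
  rewrite scalerDl scalerBr scalerA opprD !addrA -!addrA; congr (_ + _).
  by rewrite addrCA.
have [t It] := hn I iI.
have [s' Ns'] := IH (N `&` S0) (submI sN sS) ltac:(rewrite S0E; exact: subIsetr).
have ex (a : R) : exists n, I a -> N n /\ S0 (n - a *: x).
  by case: (pselect (I a)) => [[n ? ?]|?]; [exists n | exists 0].
have [g hg] := choice ex.
have tI a : a \in t -> I a by move=> at_; rewrite It; apply: sub_span.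
exists ([seq g a | a <- t] ++ s'); apply/seteqP; split; last first.
  apply: span_min => // y /=; rewrite mem_cat => /orP[/mapP[a /tI ta ->]|ys].
    by case: (hg a ta).
  by have : (N `&` S0) y by [rewrite Ns'; apply: sub_span]; case.
move=> n nn; have [T TE] : exists T, T = span [set` [seq g a | a <- t] ++ s'].
  by eexists.
rewrite -TE; have sT : submodule T by rewrite TE; apply: span_sub.
have NST : N `&` S0 `<=` T.
  rewrite TE Ns'; apply: span_mono => y /= ys.
  by rewrite mem_cat ys orbT.
pose J : set R := [set a | exists2 y, T y & (N y) /\ S0 (y - a *: x)].
have IJ : I `<=` J.
  rewrite It; apply: (@span_min R R^o _ J).
    split; first exists 0; rewrite ?scale0r ?subr0; try exact: submodule0.
      by split; apply: submodule0.
    move=> a b c [y Ty [Ny hy]] [z Tz [Nz hz]]; exists (a *: y + z).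
      by apply: submD => //; apply: submZ.
    split; first by apply: submD => //; apply: submZ.
    rewrite (_ : _ - _ = a *: (y - b *: x) + (z - c *: x)).
      by apply: submD => //; apply: submZ.
    rewrite scalerDl scalerBr scalerA opprD !addrA -!addrA; congr (_ + _).
    by rewrite addrCA.
  move=> a /= at_; have [? ?] := hg a (tI a at_); exists (g a) => //.
  by rewrite TE; apply: sub_span; rewrite /= mem_cat map_f.
have := Nsub n nn; rewrite span_seq_cons -S0E => /addl_ex[y [a [Sy ny]]].
have [z Tz [Nz hz]] : J a by apply: IJ; exists n => //; rewrite ny addrK.
rewrite -(subrK z n); apply: submD => //; apply: NST; split.
  exact: submB.
rewrite (_ : n - z = y - (z - a *: x)); first exact: submB.
by rewrite ny opprB addrA addrAC.
Qed.

End NoethFg.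

(** * Localization at a prime, expressed by saturations *)

Section Localization.
Variables (R : comUnitRingType) (M : lmodType R).
Implicit Types (N K L : set M) (P p q : set R) (x y : M).

Lemma prime_sub P : prime_ideal P -> ideal P.
Proof. by case. Qed.
Lemma prime1 P : prime_ideal P -> ~ P 1.
Proof.
move=> [sP /eqP nP _] P1; apply: nP; apply/seteqP; split => // x _.
by rewrite -[x]mulr1; apply: (submZ (M := R^o)).
Qed.
Lemma primeM P a b : prime_ideal P -> ~ P a -> ~ P b -> ~ P (a * b).
Proof. by move=> [_ _ h] na nb /h[]. Qed.
Lemma idealMl (I : set R) a b : ideal I -> I b -> I (a * b).
Proof. by move=> sI; apply: (submZ (M := R^o)). Qed.
Lemma idealMr (I : set R) a b : ideal I -> I a -> I (a * b).
Proof. by move=> sI; rewrite mulrC; apply: idealMl. Qed.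
Lemma idealD (I : set R) a b : ideal I -> I a -> I b -> I (a + b).
Proof. exact: (submD (M := R^o)). Qed.
Lemma idealB (I : set R) a b : ideal I -> I a -> I b -> I (a - b).
Proof. exact: (submB (M := R^o)). Qed.
Lemma ideal0 (I : set R) : ideal I -> I 0.
Proof. exact: (submodule0 (M := R^o)). Qed.
Lemma primeX P a n : prime_ideal P -> P (a ^+ n) -> P a.
Proof.
move=> pP; elim: n => [/(prime1 pP) //|n IH]; rewrite exprS.
by case: pP => _ _ h /h[].
Qed.

(** The preimage in M of the localization of N at q. An inclusion of localized modules becomes an
    inclusion into a saturation, and no fractions are formed. *)
Definition satm q N : set M := [set x | exists2 t, ~ q t & N (t *: x)].

Lemma satm_sub q N : prime_ideal q -> submodule N -> submodule (satm q N).
Proof.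
move=> pq sN; split; first by exists 1; [exact: prime1 | rewrite scaler0; apply: submodule0].
move=> a x y [t nt tx] [u nu uy]; exists (t * u); first exact: primeM.
rewrite scalerDr !scalerA; apply: submD => //; last first.
  by rewrite -scalerA; apply: submZ.
have -> : t * u * a = u * a * t by ring.
by rewrite -scalerA; apply: submZ.
Qed.
Lemma satm_incl q N : prime_ideal q -> N `<=` satm q N.
Proof. by move=> pq x nx; exists 1; [exact: prime1 | rewrite scale1r]. Qed.
Lemma satm_mono q N K : N `<=` K -> satm q N `<=` satm q K.
Proof. by move=> NK x [t nt /NK]; exists t. Qed.
Lemma satm_id q N : prime_ideal q -> satm q (satm q N) `<=` satm q N.
Proof.
move=> pq x [t nt [u nu h]]; exists (u * t); first exact: primeM.
by rewrite -scalerA.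
Qed.

Lemma smul_sub (I : set R) N : submodule (smul I N).
Proof. exact: span_sub. Qed.
Lemma smul_mem (I : set R) N a x : I a -> N x -> smul I N (a *: x).
Proof. by move=> Ia Nx; apply: sub_span; exists a => //; exists x. Qed.
Lemma smul_min (I : set R) N K : submodule K ->
  (forall a x, I a -> N x -> K (a *: x)) -> smul I N `<=` K.
Proof. by move=> sK h; apply: span_min => // _ [a Ia [x Nx <-]]; apply: h. Qed.
Lemma smul_mono (I J : set R) N K : I `<=` J -> N `<=` K -> smul I N `<=` smul J K.
Proof.
move=> IJ NK; apply: smul_min; first exact: smul_sub.
by move=> a x /IJ ? /NK ?; apply: smul_mem.
Qed.

Lemma smul_cons (I : set R) g (s : seq M) y : ideal I ->
  smul I (span [set` g :: s]) y ->
  exists a y', [/\ I a, smul I (span [set` s]) y' & y = a *: g + y'].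
Proof.
move=> iI; pose K : set M := [set y | exists a y',
  [/\ I a, smul I (span [set` s]) y' & y = a *: g + y']].
have sK : submodule K.
  split.
    exists 0, 0; split; [exact: ideal0 | exact: (submodule0 (smul_sub _ _)) |].
    by rewrite scale0r addr0.
  move=> a _ _ [b [x' [Ib hx ->]]] [c [y' [Ic hy ->]]].
  exists (a * b + c), (a *: x' + y'); split.
  - by apply: idealD => //; apply: idealMl.
  - by apply: (submD (smul_sub _ _)) => //; apply: (submZ _ (smul_sub _ _)).
  - by rewrite scalerDr scalerDl !scalerA addrACA.
apply: (smul_min sK) => a x Ia; rewrite span_seq_cons => /addl_ex[n [b [hn ->]]].
exists (a * b), (a *: n); split; first exact: idealMr.
  exact: smul_mem.
by rewrite scalerDr scalerA addrC.
Qed.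

(** Nakayama at q by elimination: the relation for [g] leaves the coefficient [t - a] outside q, so
    [g] can be removed from the other relations and the induction hypothesis applies to one
    generator less. *)
Lemma nakayama_seq q L (s : seq M) : prime_ideal q -> submodule L ->
  [set` s] `<=` satm q (addsm L (smul q (span [set` s]))) ->
  [set` s] `<=` satm q L.
Proof.
move=> pq sL; have iq := prime_sub pq; elim: s => [|g s IH] h; first by move=> x.
have [t nt [l Ll]] : satm q (addsm L (smul q (span [set` g :: s]))) g.
  by apply: h; rewrite /= inE eqxx.
move=> /(smul_cons iq)[a [y [qa hy e]]].
pose t0 := t - a.
have nt0 : ~ q t0.
  by move=> qt0; apply: nt; rewrite -(subrK a t); apply: idealD.
have t0g : t0 *: g = l + y.
  have tg : t *: g = l + (a *: g + y) by rewrite -e addrC subrK.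
  by rewrite scalerBl tg addrCA addrAC subrr add0r.
have hs : [set` s] `<=` satm q L.
  apply: IH => x /= xs.
  have [|t' nt' [l' Ll' /(smul_cons iq)[a' [y' [qa' hy' e']]]]] := h x.
    by rewrite /= inE xs orbT.
  exists (t0 * t'); first exact: primeM.
  have -> : (t0 * t') *: x = (t0 *: l' + a' *: l) + (a' *: y + t0 *: y').
    have -> : (t0 * t') *: x = t0 *: l' + t0 *: (a' *: g + y').
      by rewrite -e' -scalerDr addrC subrK scalerA.
    rewrite scalerDr -addrA; congr (_ + _); rewrite scalerA mulrC -scalerA t0g.
    by rewrite scalerDr addrA.
  apply: addsmP; first by apply: submD => //; apply: submZ.
  by apply: (submD (smul_sub _ _)); apply: (submZ _ (smul_sub _ _)).
have sS := satm_sub pq sL.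
move=> x /=; rewrite inE => /orP[/eqP->|]; last exact: hs.
apply: (satm_id pq); exists t0 => //; rewrite t0g; apply: (submD sS).
  exact: satm_incl.
have : span [set` s] `<=` satm q L by apply: span_min.
by move=> hss; apply: (smul_min sS _ hy) => b z _ /hss; apply: submZ.
Qed.

Lemma nakayama_loc q L N : noeth_mod M -> prime_ideal q -> submodule L ->
  submodule N -> N `<=` satm q (addsm L (smul q N)) -> N `<=` satm q L.
Proof.
move=> hn pq sL sN; have [s ->] := hn N sN => h.
apply: span_min; first exact: satm_sub.
by apply: nakayama_seq => // x /sub_span /h.
Qed.

Hypothesis hn : noetherian R.

(** A maximal annihilator is prime. Working modulo the saturation at q forces the prime into q, as
    for associated primes of the localized quotient. *)
Lemma ass_loc q N x : prime_ideal q -> submodule N -> ~ satm q N x ->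
  exists r, [/\ ~ satm q N (r *: x), prime_ideal (colon (satm q N) (r *: x)) &
             colon (satm q N) (r *: x) `<=` q].
Proof.
move=> pq sN nx; have sS := satm_sub pq sN.
pose F : set (set R^o) := [set I | exists2 r, ~ satm q N (r *: x) &
                                         I = colon (satm q N) (r *: x)].
have [||I [r nr Ir] Imax] := @max_principle R R^o F hn.
- by exists (colon (satm q N) x), 1; rewrite scale1r.
- by move=> _ [r _ ->]; apply: colon_ideal.
subst I.
exists r; split => //.
  split; first exact: colon_ideal.
    apply/eqP => e; apply: nr; rewrite -[X in satm _ _ X]scale1r.
    by have : colon (satm q N) (r *: x) 1 by rewrite e.
  move=> a b hab; case: (pselect (colon (satm q N) (r *: x) a)) => [|na]; first by left.
  right; apply: (Imax (colon (satm q N) ((a * r) *: x))).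
  - by exists (a * r); rewrite // -scalerA.
  - move=> c hc; rewrite /colon /= scalerA mulrCA -!scalerA scalerA.
    by rewrite -scalerA; apply: submZ.
  - by move: hab; rewrite /colon /= !scalerA mulrA [b * a]mulrC.
by move=> a ha; apply: contrapT => na; apply: nr; apply: (satm_id pq); exists a.
Qed.

End Localization.

Section PrimeAvoidingMult.
Variables (R : comUnitRingType) (hn : noetherian R).

Lemma prime_disjoint (I T : set R) : ideal I -> T 1 ->
  (forall a b, T a -> T b -> T (a * b)) -> (forall a, I a -> ~ T a) ->
  exists P, [/\ prime_ideal P, I `<=` P & forall a, P a -> ~ T a].
Proof.
move=> iI T1 TM IT.
pose F : set (set R^o) := [set J | [/\ ideal J, I `<=` J & forall a, J a -> ~ T a]].
have [||J [iJ IJ JT] Jmax] := @max_principle R R^o F hn.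
- by exists I; split.
- by move=> J [].
exists J; split => //; split => //.
  by apply/eqP => e; apply: (JT 1) => //; rewrite e.
move=> a b Jab; apply: contrapT => nab.
have ext c : ~ J c -> exists r j, J j /\ T (j + r * c).
  move=> nc; apply: contrapT => h; apply: nc; apply: (Jmax (addl (M := R^o) J c)).
  - split; first exact: (addl_sub (M := R^o)).
      by move=> x /IJ; apply: (addl_incl (M := R^o)).
    by move=> x /(addl_ex (M := R^o))[n [r [Jn ->]]] Tx; apply: h; exists r, n.
  - exact: (addl_incl (M := R^o)).
  - exact: (addl_mem (M := R^o)).
have [na nb] : ~ J a /\ ~ J b by split => ?; apply: nab; [left | right].
have [r [j [Jj Tj]]] := ext _ na; have [r' [j' [Jj' Tj']]] := ext _ nb.
apply: (JT ((j + r * a) * (j' + r' * b))); last exact: TM.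
rewrite (_ : _ * _ = j * (j' + r' * b) + ((r * a) * j' + (r * r') * (a * b))).
  by do !apply: idealD => //; [apply: idealMr | apply: idealMl | apply: idealMl].
by ring.
Qed.

Lemma ideal_power_prime (I : set R) a : ideal I ->
  (forall P, prime_ideal P -> I `<=` P -> P a) -> exists k, I (a ^+ k).
Proof.
move=> iI h; apply: contrapT => hk.
have [|||P [pP IP PT]] := @prime_disjoint I [set a ^+ k | k in setT] iI.
- by exists 0%N => //; rewrite expr0.
- by move=> _ _ [k _ <-] [l _ <-]; exists (k + l)%N => //; rewrite exprD.
- by move=> b Ib [k _ e]; apply: hk; exists k; rewrite e.
by apply: (PT a (h P pP IP)); exists 1%N => //; rewrite expr1.
Qed.

(* Finite length of R_q / I R_q, in the guise of the descending chain condition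
   for q-saturated ideals: maximize the ideal C on which the chain K is
   stationary. *)
Lemma dcc_minimal_prime (q I : set R) (K : nat -> set R) :
  prime_ideal q -> ideal I ->
  (forall P, prime_ideal P -> I `<=` P -> P `<=` q -> q `<=` P) ->
  (forall n, ideal (K n)) -> (forall n, I `<=` K n) ->
  (forall n, satm (M := R^o) q (K n) `<=` K n) -> (forall n, K n.+1 `<=` K n) ->
  exists n, K n `<=` K n.+1.
Proof.
move=> pq iI qmin iK IK satK Kdec.
have mono i j : (i <= j)%N -> K j `<=` K i.
  by move=> /subnK <-; elim: (_ - _)%N => // k IH x /Kdec /IH.
pose Phi (C : set R) := exists n0, forall n, (n0 <= n)%N -> K n0 `&` C `<=` K n.
pose F : set (set R^o) := [set C | [/\ ideal C, I `<=` C & Phi C]].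
have [||C [iC IC [n0 PhiC]] Cmax] := @max_principle R R^o F hn.
- by exists I; split => //; exists 0%N => n _ x [_ /IK].
- by move=> C [].
have sS := satm_sub (M := R^o) pq iC.
have PhiS n : (n0 <= n)%N -> K n0 `&` satm (M := R^o) q C `<=` K n.
  move=> hn0 x [Kx [s ns Cx]]; apply: satK; exists s => //.
  by apply: (PhiC n hn0); split => //; apply: (submZ (M := R^o) _ (iK n0) Kx).
have [s ns Cs] : satm (M := R^o) q C 1.
  apply: contrapT => n1.
  have [g [ng pP Pq]] := ass_loc hn pq iC n1.
  have qP x : q x -> satm (M := R^o) q C (x *: (g *: (1 : R^o))).
    apply: (qmin _ pP) => // {}x Ix.
    by apply: (satm_incl (M := R^o) pq); apply: (idealMr _ iC (IC x Ix)).
  pose h : R^o := g *: (1 : R^o).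
  pose C' := addl (M := R^o) (satm (M := R^o) q C) h.
  have iC' : ideal C' by apply: (addl_sub (M := R^o)).
  have CC' : C `<=` C'.
    by move=> x Cx; apply: (addl_incl (M := R^o)); apply: (satm_incl (M := R^o)).
  apply: ng; apply: (satm_incl (M := R^o) pq); apply: (Cmax C') => //; last first.
    exact: (addl_mem (M := R^o)).
  split => //; first by move=> x /IC /CC'.
  pose A n := exists k s, [/\ K n k, ~ q s & satm (M := R^o) q C (k - s * h)].
  have sat_q t c x : q t -> satm (M := R^o) q C c -> x = c + t * h ->
      satm (M := R^o) q C x.
    by move=> qt hc ->; apply: (submD sS) => //; apply: qP.
  (* At q the enlargement of [C] by [h] is simple, because q [h] lies in the saturation of [C].
     Either every [K n] contains a multiple of [h] by an element outside q, up to that saturation,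
     or from some index on [K n] meets [C'] only inside it. The chain is stationary on [C'] in both
     cases. *)
  case: (pselect (forall n, A n)) => [hA|/existsNP[m nA]].
    exists n0 => n hn0 x [Kx /(addl_ex (M := R^o))[c [t [hc e]]]].
    case: (pselect (q t)) => [qt|nt].
      by apply: (PhiS n hn0); split => //; apply: (sat_q _ _ _ qt hc e).
    have [k [s [Kk ns hk]]] := hA n.
    apply: satK; exists s => //.
    have -> : s *: (x : R^o) = t * k + (s * x - t * k).
      by rewrite addrC subrK.
    apply: (idealD (iK n)); first exact: (idealMl _ (iK n)).
    apply: (PhiS n hn0); split.
      apply: (idealB (iK n0)); apply: (idealMl _ (iK n0)) => //.
      exact: (mono _ _ hn0).
    rewrite (_ : _ - _ = s * c - t * (k - s * h)).
      by apply: (idealB sS); apply: (idealMl _ sS).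
    by rewrite e /GRing.scale /=; ring.
  exists (maxn n0 m) => n hn' x [Kx /(addl_ex (M := R^o))[c [t [hc e]]]].
  apply: (PhiS n (leq_trans (leq_maxl _ _) hn')); split.
    exact: (mono _ _ (leq_maxl n0 m)).
  apply: (sat_q _ _ _ _ hc e); apply: contrapT => nt; apply: nA.
  exists x, t; split => //; first exact: (mono _ _ (leq_maxr n0 m)).
  by rewrite e addrK.
exists n0 => x Kx; apply: satK; exists s => //.
apply: (PhiC n0.+1) => //; split; first exact: (idealMl _ (iK n0)).
have -> : s *: (x : R^o) = x * (s *: (1 : R^o)).
  by rewrite /GRing.scale /= mulr1 mulrC.
exact: (idealMl _ iC).
Qed.

(** Krull's principal ideal theorem in R/p'. The [K n] are the symbolic powers of p modulo p'. The
    descending chain condition at q makes the localized ideals [K n] + (z) stationary; Nakayama at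
    q, using that z is not in p, and then at p pushes [K n] into p', and descending to [K 0] puts 1
    into p'. *)
Lemma principal_ideal (p' p q : set R) z :
  prime_ideal p' -> prime_ideal p -> prime_ideal q ->
  p' `<=` p -> ~ (p `<=` p') -> p `<=` q -> ~ (q `<=` p) -> q z ->
  (forall P, prime_ideal P -> p' `<=` P -> P z -> P `<=` q -> q `<=` P) -> False.
Proof.
move=> pp' pp pq p'p npp' p_q nqp qz qmin.
have npz : ~ p z by move=> pz; apply: nqp; apply: qmin.
have ip := prime_sub pp; have ip' := prime_sub pp'; have iq := prime_sub pq.
pose step (K : set R) := satm (M := R^o) p (addsm (M := R^o) p' (smul (M := R^o) p K)).
pose K n := iter n step setT.
have KS n : K n.+1 = step (K n) by [].
have iK n : ideal (K n).
  case: n => [|n]; first exact: (submT (R^o)).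
  by apply: satm_sub => //; apply: addsm_sub => //; apply: smul_sub.
have p'K n : p' `<=` K n.
  case: n => [//|n] x p'x; apply: (satm_incl (M := R^o) pp).
  by apply: (addsml (M := R^o)) => //; apply: smul_sub.
have satK n : satm (M := R^o) p (K n) `<=` K n.
  by case: n => [//|n]; apply: (satm_id (M := R^o)).
have stepm (A B : set R) : A `<=` B -> step A `<=` step B.
  move=> AB; apply: satm_mono => x [y p'y h]; exists y => //.
  exact: (smul_mono (M := R^o) (fun _ => id) AB h).
have Kdec n : K n.+1 `<=` K n by elim: n => [//|n IH]; rewrite !KS; apply: stepm.
have sat_qp (A : set R) : satm (M := R^o) q A `<=` satm (M := R^o) p A.
  by move=> x [t nt At]; exists t => // /p_q.
pose I := addl (M := R^o) p' z.
have iI : ideal I by apply: (addl_sub (M := R^o)).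
pose L n := satm (M := R^o) q (addl (M := R^o) (K n) z).
have iaK n : ideal (addl (M := R^o) (K n) z).
  exact: (addl_sub (M := R^o) z (iK n)).
have [|||||n LL] := @dcc_minimal_prime q I L pq iI.
- move=> P pP IP; apply: qmin => //.
    by move=> x p'x; apply: IP; apply: (addl_incl (M := R^o)).
  by apply: IP; apply: (addl_mem (M := R^o)).
- by move=> n; exact: (satm_sub (M := R^o) pq (iaK n)).
- move=> n x /(addl_ex (M := R^o))[y [a [p'y ->]]].
  apply: (satm_incl (M := R^o)) => //; apply: (addsmP (M := R^o)); last by exists a.
  exact: p'K.
- by move=> n; apply: (satm_id (M := R^o)).
- move=> n x [t nt] /(addl_ex (M := R^o))[y [a [/Kdec Ky e]]]; exists t => //.
  by rewrite e; apply: (addsmP (M := R^o)) => //; exists a.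
have KqK : K n `<=` satm (M := R^o) q (K n.+1).
  apply: (nakayama_loc (M := R^o) hn pq (iK n.+1) (iK n)) => x Kx.
  have [|s ns /(addl_ex (M := R^o))[k [t [Kk e]]]] := LL x.
    by apply: (satm_incl (M := R^o)) => //; apply: (addl_incl (M := R^o)).
  exists s => //; rewrite e; apply: (addsmP (M := R^o)) => //.
  rewrite /GRing.scale /= mulrC; apply: (smul_mem (M := R^o)) => //.
  apply: satK; exists z => //.
  have -> : z *: (t : R^o) = s * x - k.
    by rewrite [s * x]e addrC addKr /GRing.scale /= mulrC.
  by apply: (idealB (iK n)); [apply: (idealMl _ (iK n)) | apply: Kdec].
have Kp' : K n `<=` p'.
  have h : K n `<=` satm (M := R^o) p p'.
    apply: (nakayama_loc (M := R^o) hn pp ip' (iK n)) => x /KqK /sat_qp /satK.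
    by rewrite KS.
  move=> x /h[t nt]; case: pp' => _ _ h' /h'[] // /p'p //.
have down j : K j.+1 `<=` p' -> K j `<=` p'.
  move=> h x Kx; have /existsNP[y /not_implyP[py np'y]] := npp'.
  have : p' (y * x).
    apply: h; rewrite KS; apply: (satm_incl (M := R^o) pp).
    by apply: (addsmr (M := R^o) ip'); apply: (smul_mem (M := R^o)).
  by case: pp' => _ _ h' /h'[].
have K0p' j : K j `<=` p' -> K 0%N `<=` p' by elim: j => // j IH /down.
by apply: (prime1 pp'); apply: (K0p' n).
Qed.

Fixpoint prime_chain_to (l : nat) (P q : set R) : Prop :=
  if l is l'.+1 then
    exists p, [/\ prime_chain_to l' P p, prime_ideal p, p `<=` q & ~ (q `<=` p)]
  else P = q.

Lemma prime_chain_to_sub l P q : prime_chain_to l P q -> P `<=` q.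
Proof. by elim: l q => [q <-|l IH q [p [/IH Pp _ pq _]] x /Pp /pq]. Qed.

Lemma prime_chain_to_last l P p p1 : prime_chain_to l.+1 P p -> p `<=` p1 ->
  prime_chain_to l.+1 P p1.
Proof.
move=> [p0 [c pp0 p0p npp0]] pp1; exists p0; split=> // [x /p0p /pp1 //|h].
by apply: npp0 => x /pp1 /h.
Qed.

(** The height is measured from P. Let p1 be maximal among the primes above p and strictly below q,
    and zi a generator outside p1. Then q is minimal over p1 + (zi), so every other generator y
    satisfies [s * y ^+ n = a + r * zi] with a in p1 and s outside q. By the principal ideal theorem
    p1 is minimal over P and these elements a, of which there is one fewer. *)
Theorem krull_height (k l : nat) (P q : set R) (z : seq R) :
  prime_ideal P -> prime_ideal q -> size z = k -> [set` z] `<=` q ->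
  (forall q', prime_ideal q' -> P `<=` q' -> [set` z] `<=` q' -> q' `<=` q ->
     q `<=` q') ->
  prime_chain_to l P q -> (l <= k)%N.
Proof.
elim: k l P q z => [|k IH] l P q z pP pq zk zq qmin.
  case: l => [//|l [p [c pp pq' nqp]]]; case: nqp => x qx.
  apply: (prime_chain_to_sub c); apply: (qmin P pP) qx => //.
    by rewrite (size0nil zk).
  by move=> y /(prime_chain_to_sub c) /pq'.
case: l => [//|l [p [c pp pq' nqp]]]; rewrite ltnS; case: l c => [//|l c].
pose F : set (set R^o) :=
  [set p1 | [/\ prime_ideal p1, p `<=` p1, p1 `<=` q & ~ (q `<=` p1)]].
have [||p1 [pp1 pp1' p1q nqp1] p1max] := @max_principle R R^o F hn.
- by exists p; split.
- by move=> J [] /prime_sub.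
have {}c := prime_chain_to_last c pp1'.
have Pp1 := prime_chain_to_sub c.
have [zi [ziz nzi]] : exists zi, zi \in z /\ ~ p1 zi.
  apply: contrapT => h; apply: nqp1; apply: qmin => // y yz.
  by apply: contrapT => n1; apply: h; exists y.
have ip1 := prime_sub pp1.
pose I := addl (M := R^o) p1 zi.
have iI : ideal I by apply: (addl_sub (M := R^o)).
have ex (y : R) : exists a, q y -> p1 a /\ exists s n r, ~ q s /\ s * y ^+ n = a + r * zi.
  case: (pselect (q y)) => [qy|nqy]; last by exists 0.
  pose T := [set t | exists s n, ~ q s /\ t = s * y ^+ n].
  case: (pselect (exists2 t, I t & T t)) => [[t /(addl_ex (M := R^o))[a [r [p1a e]]] [s [n [ns e']]]]|nIT].
    by exists a => _; split => //; exists s, n, r; rewrite -e'.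
  exfalso; have [|||P' [pP' IP' P'T]] := @prime_disjoint I T iI.
  - by exists 1, 0%N; split; [exact: prime1 | rewrite expr0 mulr1].
  - move=> _ _ [s [n [ns ->]]] [s' [n' [ns' ->]]]; exists (s * s'), (n + n')%N.
    by split; [exact: primeM | rewrite exprD; ring].
  - by move=> a Ia Ta; apply: nIT; exists a.
  have P'q : P' `<=` q.
    move=> a P'a; apply: contrapT => nqa; apply: (P'T a P'a); exists a, 0%N.
    by rewrite expr0 mulr1.
  have p1P' : p1 `<=` P' by move=> a p1a; apply/IP'/(addl_incl (M := R^o)).
  have P'zi : P' zi by apply/IP'/(addl_mem (M := R^o)).
  have nqP' : ~ (q `<=` P').
    move=> qP'; apply: (P'T y (qP' _ qy)); exists 1, 1%N.
    by split; [exact: prime1 | rewrite expr1 mul1r].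
  apply: nzi; apply: (p1max P') => //; split => // x /pp1' /p1P' //.
have [f hf] := choice ex.
have zq' y : y \in rem zi z -> q y by move=> /mem_rem; apply: zq.
apply: (IH l.+1 P p1 [seq f y | y <- rem zi z] pP pp1) => //.
- by rewrite size_map size_rem // zk.
- by move=> _ /= /mapP[y /zq' qy ->]; case: (hf y qy).
move=> p' pp' Pp' fp' p'p1; apply: contrapT => np1p'.
apply: (@principal_ideal p' p1 q zi pp' pp1 pq) => //; first exact: zq.
move=> q' pq1 p'q' q'zi q'q; apply: qmin => //; first by move=> x /Pp' /p'q'.
move=> y /= yz; have [->//|yzi] := eqVneq y zi.
have yr : y \in rem zi z.
  by move: (perm_to_rem ziz) yz => /perm_mem ->; rewrite inE (negPf yzi).
have [_ [s [n [r [ns e]]]]] := hf y (zq' y yr).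
have : q' (s * y ^+ n).
  rewrite e; apply: (idealD (prime_sub pq1)); last exact: (idealMl _ (prime_sub pq1)).
  by apply: p'q'; apply: fp'; rewrite /= map_f.
by case: (pq1) => _ _ h /h[/q'q //|]; apply: primeX.
Qed.

End PrimeAvoidingMult.

(** * Regular sequences *)

Section Chains.
Variable R : comUnitRingType.

Definition chain_from (k : nat) (P : set R) := exists c : nat -> set R,
  [/\ c 0%N = P, forall i, (i <= k)%N -> prime_ideal (c i) &
      forall i, (i < k)%N -> c i `<` c i.+1].

Lemma chain_from0 P : prime_ideal P -> chain_from 0 P.
Proof. by move=> pP; exists (fun=> P). Qed.

Lemma chain_fromS k P P' : prime_ideal P -> P `<=` P' -> ~ (P' `<=` P) ->
  chain_from k P' -> chain_from k.+1 P.
Proof.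
move=> pP PP' nPP' [c [c0 cp cs]]; exists (fun i => if i is i'.+1 then c i' else P).
split=> [//|[|i] //= ik|[|i] //= ik]; [exact: cp| by rewrite c0; split | exact: cs].
Qed.

Lemma prime_chainE k : prime_chain R k <-> exists P, chain_from k P.
Proof.
split=> [[c [cp cs]]|[P [c [_ cp cs]]]]; last by exists c.
by exists (c 0%N), c.
Qed.

Lemma chain_from_prime k P : chain_from k P -> prime_ideal P.
Proof. by move=> [c [<- cp _]]; apply: cp. Qed.

Hypotheses (hn : noetherian R) (hl : local R).

Lemma prime_nonunits : prime_ideal (nonunits R).
Proof.
split=> //.
  apply/eqP => e; have : nonunits R 1 by rewrite e.
  by rewrite /nonunits /= unitr1.
move=> x y; rewrite /nonunits /= unitrM negb_and => /orP[]; by [left | right].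
Qed.

Lemma prime_le_nonunits P : prime_ideal P -> P `<=` nonunits R.
Proof.
move=> pP x Px; apply/negP => ux; apply: (prime1 pP).
by rewrite -(mulVr ux); apply: (idealMl _ (prime_sub pP)).
Qed.

Lemma chain_from_le k P (z : seq R) : chain_from k P -> [set` z] `<=` nonunits R ->
  (forall q, prime_ideal q -> P `<=` q -> [set` z] `<=` q -> nonunits R `<=` q) ->
  (k <= size z)%N.
Proof.
move=> cP zm hq; have pP := chain_from_prime cP; case: cP => c [c0 cp cs].
have ch i : (i <= k)%N -> prime_chain_to i P (c i).
  elim: i => [//|i IH] ik; exists (c i).
  have [ci nci] := cs i ik.
  by split=> //; [apply: IH; apply: ltnW | apply: cp; apply: ltnW].
have cm := prime_le_nonunits (cp k (leqnn k)).
have hk := krull_height hn pP prime_nonunits (erefl (size z)) zm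
  (fun q pq Pq zq _ => hq q pq Pq zq).
case: (pselect (nonunits R `<=` c k)) => h.
  by apply: hk; have := ch k (leqnn k); rewrite (_ : c k = nonunits R) //; apply/seteqP.
by apply: ltnW; apply: hk; exists (c k); split => //; [apply: ch | apply: cp].
Qed.

End Chains.

(** * Prime avoidance *)

Section PrimeAvoidance.
Variable R : comUnitRingType.

(** Only a covering list is required, with entries outside [A] allowed; subsets and unions are then
    handled without re-enumeration. *)
Definition fin_primes (A : set (set R)) :=
  exists n (ps : nat -> set R), forall P, A P -> exists2 i, (i < n)%N & ps i = P.

Lemma fin_primesU A B : fin_primes A -> fin_primes B -> fin_primes (A `|` B).
Proof.
move=> [n [ps h]] [n' [ps' h']].
exists (n + n')%N, (fun i => if (i < n)%N then ps i else ps' (i - n)%N).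
move=> P [/h[i ilt <-]|/h'[i ilt <-]].
  by exists i; rewrite ?ilt // ltn_addr.
by exists (n + i)%N; rewrite ?ltn_add2l // ltnNge leq_addr addKn.
Qed.

Lemma prime_prod P n (y : nat -> R) : prime_ideal P ->
  (forall i, (i < n)%N -> ~ P (y i)) -> ~ P (\prod_(i < n) y i).
Proof.
move=> pP; elim: n => [|n IH] h; first by rewrite big_ord0; apply: prime1.
rewrite big_ord_recr /=; apply: primeM => //; last exact: h.
by apply: IH => i ilt; apply: h; apply: ltnW.
Qed.

Lemma prime_avoidance (J : set R) (A : set (set R)) : ideal J -> fin_primes A ->
  (forall P, A P -> prime_ideal P /\ ~ (J `<=` P)) ->
  exists2 w, J w & forall P, A P -> ~ P w.
Proof.
move=> iJ [n [ps cov]] hA.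
suff [w Jw hw] : exists2 w, J w & forall i, (i < n)%N -> A (ps i) -> ~ ps i w.
  by exists w => // P AP; have [i ilt e] := cov P AP; rewrite -e; apply: hw; rewrite ?e.
elim: n ps {cov} => [|n IH] ps; first by exists 0; first exact: ideal0.
case: (pselect (A (ps n))) => [An|nAn]; last first.
  have [w Jw hw] := IH ps; exists w => // i; rewrite ltnS leq_eqVlt.
  by move=> /orP[/eqP->//|]; apply: hw.
have [pPn nJ] := hA _ An; have iPn := prime_sub pPn.
(* If an earlier prime lies inside the last one, the last prime takes its place in the list:
   avoiding the larger one avoids both. *)
case: (pselect (exists i, [/\ (i < n)%N, A (ps i) & ps i `<=` ps n])).
  move=> [i [ilt Ai sub]].
  have [w Jw hw] := IH (fun k => if k == i then ps n else ps k).
  have wn : ~ ps n w by have := hw i ilt; rewrite eqxx; apply.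
  exists w => // k; rewrite ltnS leq_eqVlt => /orP[/eqP->//|kn] Ak.
  have := hw k kn; case: eqP => [->|_]; last by apply.
  by move=> _ /sub.
move=> hno; have [w Jw hw] := IH ps.
case: (pselect (ps n w)) => [wn|nwn]; last first.
  by exists w => // i; rewrite ltnS leq_eqVlt => /orP[/eqP->//|]; apply: hw.
have /existsNP[y0 /not_implyP[Jy0 ny0]] := nJ.
have ex i : exists y, (i < n)%N -> A (ps i) -> ps i y /\ ~ ps n y.
  case: (pselect ((i < n)%N /\ A (ps i))) => [[ilt Ai]|h]; last first.
    by exists 0 => ilt Ai; case: h.
  have /existsNP[y /not_implyP[? ?]] : ~ (ps i `<=` ps n).
    by move=> sub; apply: hno; exists i.
  by exists y.
have [y hy] := choice ex.
(* Here [w] lies in the last prime only. The product [v] lies in all the earlier primes of [A] but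
   not in the last, so [w + v] avoids every one of them. *)
pose y' i := if `[< A (ps i) >] then y i else 1.
pose v := y0 * \prod_(i < n) y' i.
have nv : ~ ps n v.
  apply: primeM => //; apply: prime_prod => // i ilt; rewrite /y'.
  by case: asboolP => [Ai|_]; [case: (hy i ilt Ai) | apply: prime1].
exists (w + v).
  by apply: idealD => //; apply: idealMr.
move=> i; rewrite ltnS leq_eqVlt => /orP[/eqP->|ilt] Ai h.
  by apply: nv; rewrite -(addKr w v); apply: (submD (M := R^o)) => //; apply: (submN (M := R^o)).
have [pPi _] := hA _ Ai; apply: (hw i ilt Ai); rewrite -(addrK v w).
apply: (idealB (prime_sub pPi)) => //; apply: (idealMl _ (prime_sub pPi)).
rewrite (bigD1 (Ordinal ilt)) //=; apply: (idealMr _ (prime_sub pPi)).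
by rewrite /y'; case: asboolP => // _; case: (hy i ilt Ai).
Qed.

End PrimeAvoidance.

(** * Associated primes, grade and exchange of regular elements *)

Section RegularSequences.
Variables (R : comUnitRingType) (M : lmodType R).
Hypotheses (hn : noetherian R) (hl : local R) (hM : noeth_mod M).
Implicit Types (N K L : set M) (P : set R) (x w : R) (q : M).
Local Notation m := (nonunits R).

Lemma satm_local N : submodule N -> satm m N `<=` N.
Proof.
move=> sN q [t nt Nt]; have ut : t \is a GRing.unit by apply: contrapT => /negP.
by rewrite -[q]scale1r -(mulVr ut) -scalerA; apply: submZ.
Qed.

Lemma nakayama N L : submodule N -> submodule L ->
  N `<=` addsm L (smul m N) -> N `<=` L.
Proof.
move=> sN sL h q Nq; apply: (satm_local sL).
apply: (nakayama_loc hM (prime_nonunits hl) sL sN) => // x /h.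
exact: (satm_incl (prime_nonunits hl)).
Qed.

Definition assoc N P := prime_ideal P /\ exists q, P = colon N q.

Lemma assoc_ex N q : submodule N -> ~ N q -> exists r, assoc N (colon N (r *: q)).
Proof.
move=> sN nq; have satE : satm m N = N.
  by apply/seteqP; split; [apply: satm_local | apply: satm_incl (prime_nonunits hl)].
have [|r [_ pP _]] := @ass_loc R M hn m N q (prime_nonunits hl) sN.
  by rewrite satE.
by exists r; rewrite satE in pP; split => //; exists (r *: q).
Qed.

(** Take K maximal such that the elements of K produce only finitely many associated primes of M/N.
    If K were proper, an element [q1] with prime annihilator modulo K could be adjoined, and it
    contributes at most that one new prime. *)
Lemma assoc_finite N : submodule N -> fin_primes (assoc N).
Proof.
move=> sN.
pose F : set (set M) := [set K | [/\ submodule K, N `<=` K &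
  fin_primes [set P | prime_ideal P /\ exists2 q, K q & P = colon N q]]].
have [||K [sK NK finK] Kmax] := max_principle (F := F) hM.
- exists N; split=> //; exists 0%N, (fun=> set0) => P [pP [q Nq e]].
  by case: (prime1 pP); rewrite e /colon /= scale1r.
- by move=> K [].
have [n [ps h]] := finK.
case: (pselect (exists q, ~ K q)) => [[q0 nq0]|hK]; last first.
  exists n, ps => P [pP [q e]]; apply: h; split=> //; exists q => //.
  by apply: contrapT => nq; apply: hK; exists q.
have [r [pP0 _]] := assoc_ex sK nq0; set q1 := r *: q0 in pP0.
exfalso; have nKq1 : ~ K q1.
  by move=> Kq; apply: (prime1 pP0); rewrite /colon /= scale1r.
apply: nKq1; apply: (Kmax (addl K q1)); last exact: addl_mem; last exact: addl_incl.
split; [exact: addl_sub | by move=> x /NK; apply: addl_incl |].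
exists n.+1, (fun i => if i == n then colon K q1 else ps i) => P [pP [q hq e]].
suff [Pn|PP] : (exists2 i, (i < n)%N & ps i = P) \/ P = colon K q1.
- have [i ilt ei] := Pn; exists i; first exact: ltnW.
  by rewrite (ltn_eqF ilt).
- by exists n; rewrite ?eqxx.
case: (pselect (exists2 a, K (a *: q) & ~ N (a *: q))) => [[a Ka nNa]|hno].
  left; apply: h; split=> //; exists (a *: q) => //; apply/seteqP; split => b.
    by rewrite e /colon /= => Nb; rewrite scalerA mulrC -scalerA; apply: submZ.
  rewrite /colon /= scalerA => hb; have : P (b * a) by rewrite e.
  by case: (pP) => _ _ h' /h'[//|]; rewrite e => /nNa.
have KN a : K (a *: q) -> N (a *: q).
  by move=> Ka; apply: contrapT => nN; apply: hno; exists a.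
have [k [a [Kk eq]]] := addl_ex hq.
case: (pselect (colon K q1 a)) => [Ka|nKa].
  left; apply: h; split=> //; exists q => //.
  by rewrite eq; apply: submD.
right; rewrite e; apply/seteqP; split => b; rewrite /colon /=.
  move=> /NK; rewrite eq scalerDr => Kb.
  have : K (b *: (a *: q1)) by apply: submDr Kb => //; apply: submZ.
  by rewrite scalerA; case: (pP0) => _ _ h' /h'[].
move=> Kb; apply: KN; rewrite eq scalerDr; apply: submD => //; first exact: submZ.
by rewrite scalerA mulrC -scalerA; apply: submZ.
Qed.

Definition reg N x := forall q, N (x *: q) -> N q.

Lemma reg_assoc N x : submodule N -> ~ reg N x -> exists2 P, assoc N P & P x.
Proof.
move=> sN /existsNP[q /not_implyP[Nxq nq]].
have [r aP] := assoc_ex sN nq; exists (colon N (r *: q)) => //.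
by rewrite /colon /= scalerA mulrC -scalerA; apply: submZ.
Qed.

Lemma assoc_reg N P x : submodule N -> assoc N P -> reg N x -> ~ P x.
Proof.
move=> sN [pP [q e]] rx; rewrite {1}e => /rx Nq.
by apply: (prime1 pP); rewrite e /colon /= scale1r.
Qed.

Fixpoint grade_ge j N : Prop :=
  if j is j'.+1 then exists x, [/\ m x, reg N x & grade_ge j' (addx N x)] else True.

(** The inequality depth M/N <= dim R/P for an associated prime P. By Nakayama and the regularity of
    x, the elements killed by P modulo N are not all in N + xM. This produces an associated prime of
    M/(N + xM) that contains P and also x, which P does not contain. *)
Lemma grade_chain j N P : submodule N -> assoc N P -> grade_ge j N -> chain_from j P.
Proof.
elim: j N P => [|j IH] N P sN [pP [q e]]; first by move=> _; apply: chain_from0.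
move=> [x [mx rx gr]].
pose L : set M := [set y | forall a, P a -> N (a *: y)].
have sL : submodule L.
  split; first by move=> a _; rewrite scaler0; apply: submodule0.
  move=> b y z hy hz a Pa; rewrite scalerDr; apply: submD => //; last exact: hz.
  by rewrite scalerA mulrC -scalerA; apply: submZ => //; apply: hy.
have Lq : L q by move=> a; rewrite e.
have nNq : ~ N q.
  by move=> Nq; apply: (prime1 pP); rewrite e /colon /= scale1r.
have sNx := addx_sub x sN.
have [y [Ly ny]] : exists y, L y /\ ~ addx N x y.
  apply: contrapT => hno; apply: nNq; apply: (nakayama sL sN) Lq => y Ly.
  have : addx N x y by apply: contrapT => ny; apply: hno; exists y.
  move=> /addx_ex[n [y' [Nn ey]]]; rewrite ey; apply: addsmP => //.
  apply: smul_mem => // a Pa; apply: rx; have := Ly a Pa.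
  rewrite ey scalerDr !scalerA [x * a]mulrC; apply: submDr => //.
  exact: submZ.
have [r aP'] := assoc_ex sNx ny; have [pP' _] := aP'.
apply: chain_fromS (IH _ _ sNx aP' gr) => //.
  move=> a Pa; rewrite /colon /= scalerA mulrC -scalerA; apply: submZ => //.
  by apply: addx_incl; apply: Ly.
move=> sub; apply: (assoc_reg sN (conj pP (ex_intro _ q e)) rx).
by apply: sub; rewrite /colon /=; apply: addx_scal.
Qed.

(* If f, f2 is a regular sequence and x is regular, the socle of M/(N + xM)
   embeds into that of M/(N + fM), so it vanishes. *)
Lemma assoc_exchange N x f f2 P : submodule N -> m f -> m f2 -> reg N x -> reg N f ->
  reg (addx N f) f2 -> assoc (addx N x) P -> ~ (m `<=` P).
Proof.
move=> sN mf mf2 rx rf rf2 [pP [q e]] mP.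
have sNf := addx_sub f sN; have sNx := addx_sub x sN.
have nq : ~ addx N x q by move=> h; apply: (prime1 pP); rewrite e /colon /= scale1r.
have hq a : m a -> addx N x (a *: q) by move=> /mP; rewrite e.
have [n [q' [Nn eq']]] := addx_ex (hq f mf).
have h2 : addx N f (f2 *: q').
  have [n2 [q2 [Nn2 e2]]] := addx_ex (hq f2 mf2).
  rewrite (_ : f2 *: q' = (f2 *: q' - f *: q2) + f *: q2); last by rewrite subrK.
  apply: addsmP; last by exists q2.
  apply: rx.
  have -> : x *: (f2 *: q' - f *: q2) = f *: n2 - f2 *: n.
    have -> : n = f *: q - x *: q' by rewrite eq' addrK.
    have -> : n2 = f2 *: q - x *: q2 by rewrite e2 addrK.
    rewrite !scalerBr !scalerA opprB [f * f2]mulrC [f2 * x]mulrC [f * x]mulrC.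
    by rewrite [RHS]addrC addrA subrK.
  by apply: submB => //; apply: submZ.
have [n' [q2 [Nn' e']]] := addx_ex (rf2 _ h2).
apply: nq; rewrite -(subrK (x *: q2) q); apply: submD => //; last exact: addx_scal.
apply: addx_incl; apply: rf.
rewrite scalerBr eq' e' scalerDr !scalerA [f * x]mulrC addrA addrK.
by apply: submD => //; apply: submZ.
Qed.

Lemma reg_swap N f w : submodule N -> reg N w -> reg (addx N f) w -> reg N f ->
  reg (addx N w) f.
Proof.
move=> sN rw rfw rf q /addx_ex[n [q' [Nn e]]].
have : addx N f (w *: q').
  have -> : w *: q' = - n + f *: q by rewrite e addKr.
  by apply: addsmP; [apply: submN | exists q].
move=> /rfw /addx_ex[n' [q2 [Nn' e']]].
have : N (f *: (q - w *: q2)).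
  rewrite scalerBr e e' scalerDr !scalerA [f * w]mulrC addrA addrK.
  by apply: submD => //; apply: submZ.
move=> /rf h; rewrite -(subrK (w *: q2) q).
by apply: addsmP => //; exists q2.
Qed.

(** Prime avoidance gives one [w] that is regular modulo N, N + fM and N + xM. The induction
    hypothesis first replaces [f2] by [w] over N + fM; swapping gives a sequence starting with [w],
    in which a second use of the hypothesis replaces [f] by x. *)
Lemma grade_exchange j N x : submodule N -> m x -> reg N x -> grade_ge j.+1 N ->
  grade_ge j (addx N x).
Proof.
elim: j N x => [//|j IH] N x sN mx rx [f [mf rf [f2 [mf2 rf2 gr]]]].
have sNf := addx_sub f sN; have sNx := addx_sub x sN.
pose A := assoc N `|` (assoc (addx N f) `|` assoc (addx N x)).
have [|||w mw hw] := @prime_avoidance R m A.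
- exact: hl.
- by do !apply: fin_primesU; apply: assoc_finite.
- move=> P [aP|[aP|aP]]; (split; first by case: aP).
  + by move=> h; apply: (assoc_reg sN aP rx); apply: h.
  + by move=> h; apply: (assoc_reg sNf aP rf2); apply: h.
  + exact: (assoc_exchange sN mf mf2 rx rf rf2 aP).
have regw K : submodule K -> (forall P, assoc K P -> A P) -> reg K w.
  by move=> sK KA; apply: contrapT => /(reg_assoc sK)[P /KA /hw].
have rwN : reg N w by apply: regw => // P; left.
have rwf : reg (addx N f) w by apply: regw => // P; right; left.
have rwx : reg (addx N x) w by apply: regw => // P; right; right.
have sNw := addx_sub w sN.
have g1 : grade_ge j (addx (addx N f) w) by apply: IH => //; exists f2.
have g2 : grade_ge j.+1 (addx N w).
  by exists f; split; [|apply: reg_swap |rewrite addxC].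
exists w; split=> //; rewrite addxC //; apply: IH => //.
exact: reg_swap.
Qed.

Fixpoint regs N (xs : seq R) : Prop :=
  if xs is x :: xs' then reg N x /\ regs (addx N x) xs' else True.

Lemma regs_grade N xs : [set` xs] `<=` m -> regs N xs -> grade_ge (size xs) N.
Proof.
elim: xs N => [//|x xs IH] N xm /= [rx rxs]; exists x; split=> //.
  by apply: xm; rewrite /= inE eqxx.
by apply: IH => // y /= ys; apply: xm; rewrite /= inE ys orbT.
Qed.

(** If x were not regular, an associated prime P would contain it. [grade_chain] starts at P a chain
    as long as the whole list, while the remaining parameters already cut P down to the maximal
    ideal, against the height theorem. [grade_exchange] restores the hypotheses modulo x. *)
Lemma parameters_regular N xs : submodule N -> [set` xs] `<=` m ->
  grade_ge (size xs) N ->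
  (forall P, prime_ideal P -> [set` xs] `<=` P ->
     (forall r, (forall q, N (r *: q)) -> P r) -> m `<=` P) ->
  regs N xs.
Proof.
elim: xs N => [//|x xs IH] N sN xm gr hP /=.
have mx : m x by apply: xm; rewrite /= inE eqxx.
have xsm : [set` xs] `<=` m by move=> y /= ys; apply: xm; rewrite /= inE ys orbT.
have rx : reg N x.
  apply: contrapT => /(reg_assoc sN)[P aP Px].
  have := grade_chain sN aP gr => /(chain_from_le hn hl) /(_ xsm).
  rewrite ltnn => h; suff : false by []; apply: h => p pp Pp xsp.
  apply: hP => //.
    by move=> y /=; rewrite inE => /orP[/eqP->|/xsp//]; apply: Pp.
  by move=> r hr; apply: Pp; case: aP => _ [q ->]; apply: hr.
split=> //; apply: IH => //; first exact: addx_sub.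
  exact: grade_exchange.
move=> P pP xsP hr; apply: hP => //.
  move=> y /=; rewrite inE => /orP[/eqP->|/xsP//].
  by apply: hr => q; apply: addx_scal.
by move=> r Nr; apply: hr => q; apply: addx_incl.
Qed.

Lemma smul_gen_rcons (s : seq R) x :
  smul (ideal_gen [set` rcons s x]) setT = addx (smul (ideal_gen [set` s]) (setT : set M)) x.
Proof.
have sK := smul_sub (ideal_gen [set` s]) (setT : set M).
apply/seteqP; split.
  apply: smul_min; first exact: addx_sub.
  move=> a q ha _; have iC : ideal (colon (addx (smul (ideal_gen [set` s]) setT) x) q).
    by apply: colon_ideal; apply: addx_sub.
  have : ideal_gen [set` rcons s x] `<=` colon (addx (smul (ideal_gen [set` s]) setT) x) q.
    apply: (span_min (M := R^o)) => // b /=; rewrite mem_rcons inE => /orP[/eqP->|bs].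
      exact: addx_scal.
    apply: addx_incl; apply: smul_mem => //.
    exact: (sub_span (M := R^o)).
  exact.
apply: addsm_min; first exact: smul_sub.
  apply: smul_mono => //; apply: (span_mono (M := R^o)) => b /= bs.
  by rewrite mem_rcons inE bs orbT.
move=> _ [q _ <-]; apply: smul_mem => //; apply: (sub_span (M := R^o)).
by rewrite /= mem_rcons inE eqxx.
Qed.

Lemma smul_gen_foldl (s : seq R) :
  smul (ideal_gen [set` s]) (setT : set M) = foldl (@addx R M) [set 0] s.
Proof.
elim/last_ind: s => [|s x IH]; last by rewrite smul_gen_rcons IH -cats1 foldl_cat.
apply/seteqP; split => [|q ->]; last exact: (submodule0 (smul_sub _ _)).
apply: smul_min; first exact: subm_zero.
move=> a q; rewrite /ideal_gen span_seq_nil => -> _ /=.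
by rewrite scale0r.
Qed.

Lemma regsE N xs : regs N xs <-> forall i, (i < size xs)%N ->
  reg (foldl (@addx R M) N (take i xs)) xs`_i.
Proof.
elim: xs N => [|x xs IH] N; first by split.
split=> [[rx /IH rxs] [|i] //=|h]; first exact: rxs.
by split; [apply: (h 0%N) | apply/IH => i; apply: (h i.+1)].
Qed.

Lemma regular_seqE xs : regular_seq M xs <->
  regs [set 0] xs /\ smul (ideal_gen [set` xs]) (setT : set M) != setT.
Proof.
split=> -[h nT]; split=> //.
  by apply/regsE => i ix; rewrite -smul_gen_foldl; apply: h.
by move=> i ix; rewrite smul_gen_foldl; move/regsE: h; apply.
Qed.

End RegularSequences.

Lemma krull_dim_uniq (R : comUnitRingType) k l : krull_dim R k -> krull_dim R l -> k = l.
Proof.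
by move=> [ck hk] [cl hl]; apply/eqP; rewrite eqn_leq hl ?hk.
Qed.

(** The dimension is pinched: an associated prime of M starts a chain of length [size xs], and the
    elements z bound every chain from above. The same chain argument bounds the depth by the
    dimension. *)
Theorem MCM_criterion (R : comUnitRingType) (M : lmodType R) (xs : seq R) :
  noetherian R -> local R -> finitely_generated (setT : set M) ->
  [set` xs] `<=` nonunits R -> regular_seq M xs ->
  (forall P, prime_ideal P -> exists z, [/\ (size z <= size xs)%N,
     [set` z] `<=` nonunits R & forall q, prime_ideal q -> P `<=` q ->
       [set` z] `<=` q -> nonunits R `<=` q]) ->
  krull_dim R (size xs) /\ MCM M.
Proof.
move=> hn hl fg xm /(regular_seqE M)[rx nT] hP.
have hM := fg_noeth hn fg.
have [q nq] : exists q : M, ~ [set 0] q.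
  apply: contrapT => h; case/eqP: nT; apply/seteqP; split => // q _.
  have -> : q = 0 by apply: contrapT => nq; apply: h; exists q.
  exact: (submodule0 (smul_sub _ _)).
have s0 := subm_zero M.
have [r aP] := assoc_ex hn hl s0 nq.
have grx := regs_grade xm rx.
have dimx : krull_dim R (size xs).
  split; first by apply/prime_chainE; eexists; apply: (grade_chain hn hl hM s0 aP grx).
  move=> l /prime_chainE[P ch].
  have [z [zx zm hz]] := hP P (chain_from_prime ch).
  exact: leq_trans (chain_from_le hn hl ch zm hz) zx.
split=> //; split.
  exists (size xs) => //; split; first by exists xs; split=> //; apply/regular_seqE.
  move=> ys ym /(regular_seqE M)[ry _]; apply: dimx.2.
  apply/prime_chainE; eexists.
  exact: (grade_chain hn hl hM s0 aP (regs_grade ym ry)).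
move=> ys [dimy ym hy]; have e := krull_dim_uniq dimx dimy.
apply/regular_seqE; split.
  apply: (parameters_regular hn hl hM) => //; first by rewrite -e.
  move=> P pP yP _ a ma; have [k hk] := hy a ma.
  apply: (primeX (n := k) pP); move: hk.
  by apply: (span_min (M := R^o)) => //; apply: prime_sub.
apply/eqP => eT; apply: nq; apply: (nakayama hl hM (submT M) s0) => // x _.
apply: addsmr => //.
have : smul (ideal_gen [set` ys]) (setT : set M) x by rewrite eT.
apply: smul_mono => //; apply: (span_min (M := R^o)) => //.
Qed.

(** * Lengths and parameters *)

Section Length.
Variables (R : comUnitRingType) (M : lmodType R).
Implicit Types (N K L : set M).

(** The chains need not be saturated, so bounds pass along inclusions of submodules; a composition
    series is recovered as a longest chain. *)
Fixpoint length_ge (t : nat) N : Prop :=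
  if t is t'.+1 then
    exists K, [/\ submodule K, N `<=` K, ~ (K `<=` N) & length_ge t' K]
  else True.

Definition simple_step N K :=
  N `<=` K /\ forall L, submodule L -> N `<=` L -> L `<=` K -> L `<=` N \/ K `<=` L.

Definition length_le N h := forall t, length_ge t N -> (t <= h)%N.

Lemma length_ge_mono t N K : N `<=` K -> length_ge t K -> length_ge t N.
Proof.
case: t => // t NK [L [sL KL nLK hL]]; exists L; split=> //.
  by move=> x /NK /KL.
by move=> LN; apply: nLK => x /LN /NK.
Qed.

Lemma length_le_mono N K h : N `<=` K -> length_le N h -> length_le K h.
Proof. by move=> NK hN t /(length_ge_mono NK) /hN. Qed.

(** The core of Jordan-Hoelder: adding K to every member of a chain above N keeps the inclusions
    strict, except for one at the first member that contains K. *)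
Lemma length_ge_step t N K : submodule N -> submodule K -> simple_step N K ->
  length_ge t.+1 N -> length_ge t K.
Proof.
elim: t N K => [//|t IH] N K sN sK [NK simp] [N' [sN' NN' nN'N hN']].
case: (pselect (K `<=` N')) => [KN'|nKN'].
  exact: (length_ge_mono (t := t.+1) KN' hN').
have cap : N' `&` K `<=` N.
  have [|//|KI] := simp _ (submI sN' sK) _ (@subIsetr _ _ _).
    by move=> x Nx; split; [apply: NN' | apply: NK].
  by case: nKN' => x /KI[].
have sK' := addsm_sub sN' sK.
exists (addsm N' K); split=> //.
- exact: addsmr.
- move=> sub; apply: nN'N => x N'x; apply: cap; split=> //.
  by apply: sub; apply: addsml.
apply: IH hN' => //; split; first exact: addsml.
move=> L sL N'L LK'.
have [|LKN|KL] := simp _ (submI sL sK) _ (@subIsetr _ _ _).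
- by move=> x Nx; split; [apply/N'L/NN' | apply: NK].
- left => x Lx; have [y N'y Kxy] := LK' x Lx.
  rewrite -(subrK y x); apply: submD => //; apply: NN'; apply: LKN; split=> //.
  by apply: submB => //; apply: N'L.
- by right; apply: addsm_min => // x /KL[].
Qed.

Lemma length_le_step N K h : submodule N -> submodule K -> simple_step N K ->
  length_le K h -> length_le N h.+1.
Proof.
by move=> sN sK simp hK [//|t] /(length_ge_step sN sK simp) /hK.
Qed.

Lemma length_leT : length_le setT 0.
Proof. by move=> [//|t] [K [_ _ nK _]]; case: nK. Qed.

Lemma quot_has_length0 : quot_has_length (setT : set M) 0.
Proof. by exists (fun=> setT); split=> // i; rewrite ltn0. Qed.

Lemma quot_has_lengthS N K l : submodule N -> N `<=` K -> ~ (K `<=` N) ->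
  simple_step N K -> quot_has_length K l -> quot_has_length N l.+1.
Proof.
move=> sN NK nKN [_ simp] [c [c0 cl cs ci]].
exists (fun i => if i is i'.+1 then c i' else N); split=> //.
  by case=> [//|i]; apply: cs.
case=> [_|i]; last exact: ci.
rewrite c0; split; first by split.
move=> L sL NL LK; have [LN|KL] := simp L sL NL LK; [left | right]; exact/seteqP.
Qed.

Lemma quot_has_length_inv N l : quot_has_length N l.+1 ->
  exists K, [/\ submodule N, submodule K, N `<=` K, ~ (K `<=` N) &
     simple_step N K /\ quot_has_length K l].
Proof.
move=> [c [c0 cl cs ci]]; exists (c 1%N).
have [[c01 nc10] simp] := ci 0%N (ltn0Sn _); rewrite c0 in c01 nc10 simp.
split=> //; first by rewrite -c0; apply: cs.
  exact: cs.
split.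
  split=> // L sL NL LK; have [->|->] := simp L sL NL LK; by [left | right].
exists (fun i => c i.+1); split=> // i il; first exact: cs.
exact: ci.
Qed.

Lemma quot_has_length_le N l : quot_has_length N l -> length_le N l.
Proof.
elim: l N => [|l IH] N; last first.
  move=> /quot_has_length_inv[K [sN sK _ _ [simp /IH]]]; exact: length_le_step.
by move=> [c [<- -> _ _]]; apply: length_leT.
Qed.

Lemma quot_has_length_ge N l : quot_has_length N l -> length_ge l N.
Proof.
elim: l N => [//|l IH] N /quot_has_length_inv[K [sN sK NK nKN [_ /IH h]]].
by exists K.
Qed.

Lemma quot_has_length_max N l : submodule N -> length_ge l N -> ~ length_ge l.+1 N ->
  quot_has_length N l.
Proof.
elim: l N => [|l IH] N sN.
  move=> _ h; rewrite (_ : N = setT); first exact: quot_has_length0.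
  apply/seteqP; split => // x _; apply: contrapT => nx; apply: h.
  by exists setT; split=> // sub; apply/nx/sub.
move=> [K [sK NK nKN hK]] hmax.
have nK : ~ length_ge l.+1 K by move=> h; apply: hmax; exists K.
apply: (quot_has_lengthS sN NK nKN) (IH _ sK hK nK).
split=> // L sL NL LK; apply: contrapT => /not_orP[nLN nKL].
by apply: hmax; exists L; split=> //; exists K.
Qed.

Lemma quot_has_length_ex N h : submodule N -> length_le N h ->
  exists l, quot_has_length N l.
Proof.
move=> sN hN; have [l hl hmax] : exists2 l, length_ge l N & ~ length_ge l.+1 N.
  apply: contrapT => hno; have all t : length_ge t N.
    by elim: t => [//|t IH]; apply: contrapT => ?; apply: hno; exists t.
  by have := hN _ (all h.+1); rewrite ltnn.
by exists l; apply: quot_has_length_max.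
Qed.

End Length.

Section LengthAdd.
Variables (R : comUnitRingType) (M : lmodType R).
Implicit Types (N K L : set M).

Definition image_line (g : M) (I : set R) : set M := [set a *: g | a in I].
Lemma image_line_sub g I : ideal I -> submodule (image_line g I).
Proof.
move=> iI; split; first by exists 0; rewrite ?scale0r //; apply: ideal0.
move=> b _ _ [a Ia <-] [c Ic <-]; exists (b * a + c).
  by apply: idealD => //; apply: idealMl.
by rewrite scalerDl scalerA.
Qed.

(** (L + Rg)/L is a quotient of R/J, and a composition series of R/J is pushed forward step by step
    to the submodules L + I g. *)
Lemma length_le_addl (J : set R) l L g h : quot_has_length (M := R^o) J l ->
  submodule L -> (forall a, J a -> L (a *: g)) ->
  length_le (addl L g) h -> length_le L (h + l)%N.
Proof.
move=> qJ sL JL; pose T I := addsm L (image_line g I).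
have sT I : ideal I -> submodule (T I).
  by move=> iI; apply: addsm_sub => //; apply: image_line_sub.
suff : forall I, quot_has_length (M := R^o) I l -> length_le (addl L g) h ->
    length_le (T I) (h + l)%N.
  move=> H hL; apply: length_le_mono (H J qJ hL); apply: addsm_min => //.
  by move=> _ [a /JL ? <-].
move=> {JL J qJ} I qI hL; elim: l I qI => [|l IH] I.
  by move=> [c [<- -> _ _]]; rewrite addn0.
move=> /(quot_has_length_inv (M := R^o))[K [sI sK IK nKI [[_ simp] /IH hK]]].
rewrite addnS; apply: (length_le_step (sT I sI) (sT K sK)) hK; split.
  apply: addsm_min; [exact: sT | exact/addsml/image_line_sub |].
  by move=> _ [a /IK Ka <-]; apply: addsmr => //; exists a.
move=> X sX IX XK.
have LX : L `<=` X by move=> x Lx; apply/IX/addsml => //; apply: image_line_sub.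
have [|XI|KX] := simp _ (submI (M := R^o) (colon_ideal g sX) sK) _ (@subIsetr _ _ _).
- move=> a Ia; split; last exact: IK.
  by apply: IX; apply: addsmr => //; exists a.
- left => x Xx; have [y Ly [a Ka e]] := XK x Xx; exists y => //; exists a => //.
  apply: XI; split=> //; rewrite /colon /= e; apply: submB => //; exact: LX.
- right; apply: addsm_min => // _ [a /KX[Xa _] <-]; exact: Xa.
Qed.

Lemma length_le_addls (J : set R) l L (gs : seq M) h :
  quot_has_length (M := R^o) J l -> submodule L ->
  (forall a g, g \in gs -> J a -> L (a *: g)) ->
  length_le (addsm L (span [set` gs])) h -> length_le L (h + size gs * l)%N.
Proof.
move=> qJ; elim: gs L => [|g gs IH] L sL hg hL.
  rewrite mul0n addn0; apply: length_le_mono hL.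
  by apply: addsm_min => //; rewrite span_seq_nil => _ ->; apply: submodule0.
rewrite mulSn addnCA addnC; apply: (length_le_addl qJ sL (g := g)).
  by move=> a Ja; apply: hg => //; rewrite mem_head.
apply: IH; first exact: addl_sub.
  by move=> a g' g'gs Ja; apply: addl_incl; apply: hg => //; rewrite inE g'gs orbT.
apply: length_le_mono hL.
have sS : submodule (addsm (addl L g) (span [set` gs])).
  by apply: addsm_sub; [apply: addl_sub | apply: span_sub].
apply: addsm_min => //.
  by move=> x Lx; apply: addsml; [apply: span_sub | apply: addl_incl].
rewrite span_seq_cons; apply: addl_min => //.
  exact/addsmr/addl_sub.
by apply: addsml; [apply: span_sub | apply: addl_mem].
Qed.

End LengthAdd.

Lemma mnm_pos K (gam : 'X_{1..K}) : gam != 0%MM -> exists l, (0 < gam l)%N.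
Proof.
move=> ng; apply/existsP; apply: contraNT ng; rewrite negb_exists => /forallP h.
by apply/eqP/mnmP => l; rewrite mnm0E; apply/eqP; rewrite eqn0Ngt h.
Qed.

(** * Counting monomials; powers of an ideal with k generators *)

Section MonomialCount.
Variable k : nat.

Definition nmon (t : nat) := #|{: 'X_{1..k < t}}|.

Definition mon_deg t : seq 'X_{1..k} :=
  [seq bmnm b | b : 'X_{1..k < t.+1} <- enum {: 'X_{1..k < t.+1}} & mdeg b == t].

Lemma mem_mon_deg t b : (b \in mon_deg t) = (mdeg b == t).
Proof.
apply/mapP/idP => [[c]|/eqP e].
  by rewrite mem_filter => /andP[? _] ->.
have bt : (mdeg b < t.+1)%N by rewrite e.
by exists (BMultinom bt) => //; rewrite mem_filter /= e eqxx mem_enum.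
Qed.

Definition mon_lt t : seq 'X_{1..k} := [seq bmnm b | b : 'X_{1..k < t} <- enum {: 'X_{1..k < t}}].

Lemma mem_mon_lt t b : (b \in mon_lt t) = (mdeg b < t)%N.
Proof.
apply/mapP/idP => [[c _ ->]|bt]; first exact: bmdeg.
by exists (BMultinom bt); rewrite // mem_enum.
Qed.
Lemma mon_lt_uniq t : uniq (mon_lt t).
Proof. by rewrite map_inj_uniq ?enum_uniq // => b c e; apply: val_inj. Qed.
Lemma mon_deg_uniq t : uniq (mon_deg t).
Proof.
rewrite map_inj_uniq; last by move=> b c e; apply: val_inj.
by apply: filter_uniq; apply: enum_uniq.
Qed.
Lemma size_mon_lt t : size (mon_lt t) = nmon t.
Proof. by rewrite size_map -cardE. Qed.

Lemma nmonS t : nmon t.+1 = (nmon t + size (mon_deg t))%N.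
Proof.
rewrite -!size_mon_lt -size_cat; apply: perm_size; apply: uniq_perm.
- exact: mon_lt_uniq.
- rewrite cat_uniq mon_lt_uniq mon_deg_uniq andbT /=; apply/hasPn => b.
  by rewrite mem_mon_deg mem_mon_lt => /eqP->; rewrite ltnn.
by move=> b; rewrite mem_cat !mem_mon_lt mem_mon_deg ltnS leq_eqVlt orbC.
Qed.

Lemma nmon0 : nmon 0 = 0%N.
Proof. by rewrite -size_mon_lt; case: (mon_lt 0) (mem_mon_lt 0) => // b s /(_ b); rewrite mem_head. Qed.

End MonomialCount.

Section IdealPowers.
Variables (R : comUnitRingType) (k : nat) (x : seq R).
Hypothesis xk : size x = k.
Local Notation J := (ideal_gen [set` x]).

Definition seq_mon (b : 'X_{1..k}) : R := \prod_(i < k) x`_i ^+ b i.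

Lemma ideal_exp_sub n : ideal (ideal_exp J n).
Proof. by case: n => [|n]; [apply: (submT R^o) | apply: (smul_sub (M := R^o))]. Qed.

Lemma gen_mem i : (i < k)%N -> J x`_i.
Proof. by move=> ik; apply: (sub_span (M := R^o)); rewrite /= mem_nth // xk. Qed.

Lemma seq_monD b i : seq_mon (b + U_(i))%MM = x`_i * seq_mon b.
Proof.
rewrite /seq_mon (bigD1 i) //= [in RHS](bigD1 i) //= mulrA; congr (_ * _).
  by rewrite mnmDE mnm1E eqxx addn1 exprS.
by apply: eq_bigr => j ji; rewrite mnmDE mnm1E eq_sym (negPf ji) addn0.
Qed.

Lemma seq_mon_exp n b : mdeg b = n -> ideal_exp J n (seq_mon b).
Proof.
elim: n b => [//|n IH] b hb.
have [i bi] : exists i, (0 < b i)%N by apply: mnm_pos; rewrite -mdeg_eq0 hb.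
have e : b = ((b - U_(i)) + U_(i))%MM.
  by rewrite submK //; apply/mnm_lepP => j; rewrite mnm1E; case: eqP => // <-.
rewrite e seq_monD; apply: (smul_mem (M := R^o)); first exact: gen_mem.
by apply: IH; move: hb; rewrite {1}e mdegD mdeg1 addn1 => -[].
Qed.

Lemma ideal_exp_split n : ideal_exp J n `<=`
  addsm (M := R^o) (ideal_exp J n.+1) (span (M := R^o) [set` [seq seq_mon b | b <- mon_deg k n]]).
Proof.
have sT i : ideal (addsm (M := R^o) (ideal_exp J i.+1)
      (span (M := R^o) [set` [seq seq_mon b | b <- mon_deg k i]])).
  by apply: addsm_sub; [apply: ideal_exp_sub | apply: span_sub].
elim: n => [|n IH].
  have h1 : addsm (M := R^o) (ideal_exp J 1)
      (span (M := R^o) [set` [seq seq_mon b | b <- mon_deg k 0]]) 1.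
    apply: (addsmr (M := R^o)); first exact: (ideal_exp_sub 1).
    apply: (sub_span (M := R^o)); apply/mapP; exists 0%MM.
      by rewrite mem_mon_deg mdeg0.
    by rewrite /seq_mon big1 // => i _; rewrite mnm0E expr0.
  by move=> a _; rewrite -[a]mulr1; apply: (idealMl _ (sT 0%N)).
apply: (smul_min (M := R^o) (sT n.+1)) => a y Ja /IH[y1 Jy1 hy].
have -> : a *: y = a *: y1 + a *: (y - y1) :> R^o by rewrite -scalerDr addrC subrK.
apply: (submD (M := R^o) (sT n.+1)).
  apply: (addsml (M := R^o)); first exact: span_sub.
  exact: (smul_mem (M := R^o)).
move: (y - y1) hy => z.
have iC : submodule (M := R^o) [set z | addsm (M := R^o) (ideal_exp J n.+2)
      (span (M := R^o) [set` [seq seq_mon b | b <- mon_deg k n.+1]]) (a *: z)].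
  split; first by rewrite /= scaler0; apply: (submodule0 (M := R^o) (sT n.+1)).
  move=> c u v hu hv; rewrite /= scalerDr; apply: (submD (M := R^o) (sT n.+1)) => //.
  by rewrite scalerA mulrC -scalerA; apply: (submZ (M := R^o) _ (sT n.+1)).
apply: (span_min (M := R^o) iC) => y' /= /mapP[b]; rewrite mem_mon_deg => /eqP hb ->.
have : J `<=` colon (M := R^o) (addsm (M := R^o) (ideal_exp J n.+2)
      (span (M := R^o) [set` [seq seq_mon b | b <- mon_deg k n.+1]])) (seq_mon b).
  apply: (span_min (M := R^o)); first exact: (colon_ideal (M := R^o) _ (sT n.+1)).
  move=> c /= /(nthP 0)[i ik <-]; rewrite xk in ik.
  apply: (addsmr (M := R^o)); first exact: (ideal_exp_sub n.+2).
  apply: (sub_span (M := R^o)); apply/mapP; exists (b + U_(Ordinal ik))%MM.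
    by rewrite mem_mon_deg mdegD mdeg1 hb addn1.
  by rewrite seq_monD.
exact.
Qed.

(** J^i / J^(i+1) is killed by J and generated by the monomials of degree i in the generators, so
    each monomial costs at most the length of R/J. *)
Lemma length_le_exp l n : quot_has_length (M := R^o) J l ->
  length_le (M := R^o) (ideal_exp J n) (l * nmon k n)%N.
Proof.
move=> qJ; elim: n => [|n IH]; first by rewrite nmon0 muln0; apply: length_leT.
rewrite nmonS mulnDr [X in (_ + X)%N]mulnC -(size_map seq_mon).
apply: (length_le_addls qJ); first exact: ideal_exp_sub.
  move=> a g /mapP[b]; rewrite mem_mon_deg => /eqP hb -> Ja.
  by apply: (smul_mem (M := R^o)) => //; apply: seq_mon_exp.
by apply: length_le_mono IH; apply: ideal_exp_split.
Qed.

End IdealPowers.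

(** * Existence of systems of parameters and of the parameter degree *)

Section ParameterDegree.
Variable R : comUnitRingType.
Hypotheses (hn : noetherian R) (hl : local R).
Local Notation m := (nonunits R).

(** Noetherian induction: a maximal counterexample [C] is not prime, and if ab lies in [C], every
    prime over [C] lies over [C] + (a) or [C] + (b). The list may be redundant. *)
Lemma minimal_primes (I : set R) : ideal I -> exists n (ps : nat -> set R),
  (forall i, (i < n)%N -> prime_ideal (ps i) /\ I `<=` ps i) /\
  forall P, prime_ideal P -> I `<=` P -> exists2 i, (i < n)%N & ps i `<=` P.
Proof.
move=> iI; apply: contrapT => hI.
pose good I := exists n (ps : nat -> set R),
  (forall i, (i < n)%N -> prime_ideal (ps i) /\ I `<=` ps i) /\
  forall P, prime_ideal P -> I `<=` P -> exists2 i, (i < n)%N & ps i `<=` P.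
pose F : set (set R^o) := [set I | ideal I /\ ~ good I].
have [||C [iC nC] Cmax] := @max_principle R R^o F hn.
- by exists I.
- by move=> J [].
have npC : ~ prime_ideal C.
  by move=> pC; apply: nC; exists 1%N, (fun=> C); split=> [i _|P _ CP]; [split | exists 0%N].
have nT : C != setT.
  apply/eqP => e; apply: nC; exists 0%N, (fun=> C); split=> // P pP CP.
  by case: (prime1 pP); apply: CP; rewrite e.
have [a [b [Cab nCa nCb]]] : exists a b, [/\ C (a * b), ~ C a & ~ C b].
  apply: contrapT => h; apply: npC; split=> // a b Cab; apply: contrapT => hab.
  by apply: h; exists a, b; split=> // ?; apply: hab; [left | right].
have ext c : ~ C c -> good (addl (M := R^o) C c).
  move=> nc; apply: contrapT => h; apply: nc.
  apply: (Cmax (addl (M := R^o) C c)); last exact: (addl_mem (M := R^o)).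
    by split=> //; apply: (addl_sub (M := R^o)).
  exact: (addl_incl (M := R^o)).
have [n1 [p1 [hp1 hp1']]] := ext a nCa; have [n2 [p2 [hp2 hp2']]] := ext b nCb.
apply: nC; exists (n1 + n2)%N, (fun i => if (i < n1)%N then p1 i else p2 (i - n1)%N).
have Cs c : C `<=` addl (M := R^o) C c by apply: (addl_incl (M := R^o)).
split.
  move=> i ilt; case: ltnP => hi.
    by have [? sub] := hp1 i hi; split=> // x /(Cs a) /sub.
  have [|? sub] := hp2 (i - n1)%N; first by rewrite ltn_subLR.
  by split=> // x /(Cs b) /sub.
move=> P pP CP; have [Pa|Pb] : P a \/ P b by case: (pP) => _ _; apply; apply: CP.
  have [|i ilt sub] := hp1' P pP.
    by apply: (addl_min (M := R^o)) => //; apply: prime_sub.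
  by exists i; rewrite ?ilt // ltn_addr.
have [|i ilt sub] := hp2' P pP.
  by apply: (addl_min (M := R^o)) => //; apply: prime_sub.
by exists (n1 + i)%N; rewrite ?ltn_add2l // ltnNge leq_addr addKn.
Qed.

(** Invariant: chains starting at a prime over the first j elements have length at most k - j. The
    next element avoids the minimal primes over the previous ones, except the maximal ideal, so a
    prime containing it lies strictly above one of them. *)
Lemma sop_exists k : krull_dim R k -> exists2 x : seq R, sop x & size x = k.
Proof.
move=> dimk; have [_ kmax] := dimk.
have step j : (j <= k)%N -> exists x : seq R, [/\ size x = j, [set` x] `<=` m &
    forall P t, prime_ideal P -> [set` x] `<=` P -> chain_from t P -> (t + j <= k)%N].
  elim: j => [_|j IH jk].
    exists [::]; split=> // P t _ _ ch; rewrite addn0; apply: kmax.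
    by apply/prime_chainE; exists P.
  have [x [xj xm hx]] := IH (ltnW jk).
  have iJ : ideal (ideal_gen [set` x]) by apply: (span_sub (M := R^o)).
  have [n [ps [hps cov]]] := minimal_primes iJ.
  pose A P := exists2 i, (i < n)%N & P = ps i /\ ~ (m `<=` P).
  have [||w mw hw] := @prime_avoidance R m A hl.
  - by exists n, ps => P [i ilt [-> _]]; exists i.
  - by move=> P [i ilt [-> ?]]; have [] := hps i ilt.
  exists (rcons x w); split; first by rewrite size_rcons xj.
    by move=> y /=; rewrite mem_rcons inE => /orP[/eqP->|/xm].
  move=> P t pP xwP ch.
  have JP : ideal_gen [set` x] `<=` P.
    apply: (span_min (M := R^o)); first exact: prime_sub.
    by move=> y /= yx; apply: xwP; rewrite /= mem_rcons inE yx orbT.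
  have [i ilt sub] := cov P pP JP; have [pi Ji] := hps i ilt.
  case: (pselect (m `<=` ps i)) => mi.
    case: t ch => [//|t] [c [c0 cp cs]].
    have [] := cs 0%N (ltn0Sn _); rewrite c0 => _; case=> y.
    by move=> /(prime_le_nonunits (cp 1%N (ltn0Sn _))) /mi /sub.
  rewrite addnS -addSn; apply: (hx (ps i)) => //.
    by move=> y /= yx; apply: Ji; apply: (sub_span (M := R^o)).
  apply: (chain_fromS pi sub _ ch) => Pi; apply: (hw (ps i)); first by exists i.
  by apply: Pi; apply: xwP; rewrite /= mem_rcons mem_head.
have [x [xk xm hx]] := step k (leqnn k).
exists x => //; split=> //; first by rewrite xk.
move=> a ma; apply: ideal_power_prime => //; first exact: (span_sub (M := R^o)).
move=> P pP xP; apply: contrapT => nPa.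
suff : (1 + k <= k)%N by rewrite ltnn.
apply: (hx P 1%N pP).
  by move=> y yx; apply: xP; apply: (sub_span (M := R^o)).
apply: (chain_fromS pP (prime_le_nonunits pP) _ (chain_from0 (prime_nonunits hl))).
by move=> sub; apply/nPa/sub.
Qed.

(** Let [C] be maximal among the ideals over I for which a length bound on R/[C] implies one on R/I.
    If [C] is proper, all its associated primes are the maximal ideal, and [C] can be enlarged by
    one simple step. *)
Lemma finite_length (I : set R) : ideal I ->
  (forall P, prime_ideal P -> I `<=` P -> m `<=` P) ->
  exists l, quot_has_length (M := R^o) I l.
Proof.
move=> iI hI.
pose F : set (set R^o) := [set C | [/\ ideal C, I `<=` C &
  forall h, length_le (M := R^o) C h -> exists h', length_le (M := R^o) I h']].
have [||C [iC IC hC] Cmax] := @max_principle R R^o F hn.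
- by exists I; split=> // h hh; exists h.
- by move=> J [].
case: (pselect (C 1)) => [C1|nC1].
  have CT : C = setT.
    by apply/seteqP; split=> // x _; rewrite -[x]mulr1; apply: (idealMl _ iC).
  have [|h hh] := hC 0%N; first by rewrite CT; apply: length_leT.
  exact: quot_has_length_ex hh.
exfalso; have [r [pP [q _]]] := assoc_ex (M := R^o) hn hl iC nC1.
move: pP; set g : R^o := r *: (1 : R^o) => pP.
have mP : m `<=` colon (M := R^o) C g.
  by apply: hI => // x Ix; apply: (idealMr _ iC (IC x Ix)).
have nCg : ~ C g by move=> Cg; apply: (prime1 pP); rewrite /colon /= scale1r.
apply: nCg; have sg := addl_sub (M := R^o) g iC.
apply: (Cmax (addl (M := R^o) C g)); last exact: (addl_mem (M := R^o)).
  split=> //; first by move=> x /IC; apply: (addl_incl (M := R^o)).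
  move=> h hh; apply: (hC h.+1); apply: (length_le_step (M := R^o) iC sg) hh.
  split; first exact: (addl_incl (M := R^o)).
  move=> X sX CX XC; case: (pselect (X g)) => [Xg|nXg].
    by right; apply: (addl_min (M := R^o)).
  left => x Xx; have [c [a [Cc e]]] := addl_ex (M := R^o) (XC x Xx).
  rewrite e; apply: (idealD iC) => //; apply: mP; apply/negP => ua; apply: nXg.
  have -> : g = a^-1 *: ((x : R^o) - c).
    by rewrite e addrC addKr scalerA mulVr // scale1r.
  apply: (submZ (M := R^o)) => //; apply: (submB (M := R^o)) => //; exact: CX.
exact: (addl_incl (M := R^o)).
Qed.

Lemma parameter_degree_ex k : krull_dim R k -> exists c, parameter_degree R c.
Proof.
move=> dimk; have [x0 sx0 _] := sop_exists dimk.
have ex : exists l, `[< exists2 x : seq R, sop x & quot_has_length (M := R^o) (ideal_gen [set` x]) l >].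
  have [|l hl'] := @finite_length (ideal_gen [set` x0]) (span_sub (M := R^o) _).
    move=> P pP xP a ma; case: sx0 => _ _ /(_ a ma)[j /xP]; exact: primeX.
  by exists l; apply/asboolP; exists x0.
case: (ex_minnP ex) => c /asboolP hc cmin; exists c; split=> // x l sx ql.
by apply: cmin; apply/asboolP; exists x.
Qed.

End ParameterDegree.

(** * Power series *)

Lemma mdeg_le n (a b : 'X_{1..n}) : (a <= b)%MM -> (mdeg a <= mdeg b)%N.
Proof. by move=> /submK <-; rewrite mdegD leq_addl. Qed.

Section PowerSeries.
Variables (n : nat) (A : comNzRingType).
Implicit Types (f g h : mpseries n A) (a b c : 'X_{1..n}).

Definition lows a : seq 'X_{1..n} := [seq c <- mon_lt n (mdeg a).+1 | (c <= a)%MM].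

Lemma mem_lows a c : (c \in lows a) = (c <= a)%MM.
Proof.
rewrite mem_filter mem_mon_lt ltnS; apply/andP/idP => [[]//|ca].
by split=> //; apply: mdeg_le.
Qed.
Lemma lows_uniq a : uniq (lows a).
Proof. exact/filter_uniq/mon_lt_uniq. Qed.

Lemma pscoefM f g a :
  pscoef (f * g) a = \sum_(c <- lows a) pscoef f c * pscoef g (a - c)%MM.
Proof.
have ak : (mdeg a < (mdeg a).+1)%N by [].
transitivity ((mps_trunc (mdeg a).+1 f * mps_trunc (mdeg a).+1 g)@_a).
  by rewrite mps_trunc_mul.
transitivity (\sum_(k : 'X_{1..n < (mdeg a).+1} | (k <= a)%MM)
   (mps_trunc (mdeg a).+1 f)@_k * (mps_trunc (mdeg a).+1 g)@_(a - k)).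
  exact: mcoeff_poly_mul_lin.
rewrite /lows big_filter /mon_lt big_map big_enum_cond; apply: eq_big => // k ka.
rewrite !mps_truncE ?bmdeg //; apply: (leq_ltn_trans _ ak).
by apply: mdeg_le; apply: lem_subr.
Qed.

Lemma pscoefD f g a : pscoef (f + g) a = pscoef f a + pscoef g a.
Proof. by []. Qed.
Lemma pscoefN f a : pscoef (- f) a = - pscoef f a.
Proof. by []. Qed.
Lemma pscoefB f g a : pscoef (f - g) a = pscoef f a - pscoef g a.
Proof. by []. Qed.
Lemma pscoef0 a : pscoef (0 : mpseries n A) a = 0.
Proof. by []. Qed.
Lemma pscoef1 a : pscoef (1 : mpseries n A) a = (a == 0%MM)%:R.
Proof. by rewrite /=; case: eqP. Qed.
Lemma pscoef_sum (I : Type) (s : seq I) (P : pred I) (F : I -> mpseries n A) a :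
  pscoef (\sum_(i <- s | P i) F i) a = \sum_(i <- s | P i) pscoef (F i) a.
Proof. by elim/big_rec2: _ => // i x y _ <-. Qed.

Lemma lem0 a : (0%MM <= a)%MM.
Proof. by apply/mnm_lepP => i; rewrite mnm0E. Qed.

Lemma pscoefC (x : A) a : pscoef (mpsC n x) a = if a == 0%MM then x else 0.
Proof. by []. Qed.
Lemma pscoefX i a : pscoef (mpsX A i) a = (a == U_(i)%MM)%:R.
Proof. by rewrite /=; case: eqP. Qed.

Lemma pscoefCM (x : A) f a : pscoef (mpsC n x * f) a = x * pscoef f a.
Proof.
rewrite pscoefM (bigD1_seq 0%MM) ?lows_uniq //=; last by rewrite mem_lows lem0.
rewrite eqxx subm0 big1 ?addr0 // => c nc.
by rewrite (negPf nc) mul0r.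
Qed.

Lemma pscoefXM i f a :
  pscoef (mpsX A i * f) a = if (0 < a i)%N then pscoef f (a - U_(i))%MM else 0.
Proof.
rewrite pscoefM; case: ifP => ai.
  have ua : (U_(i) <= a)%MM by rewrite lep1mP -lt0n.
  rewrite (bigD1_seq U_(i)%MM) ?lows_uniq //=; last by rewrite mem_lows.
  rewrite eqxx mul1r big1 ?addr0 // => c nc.
  by rewrite (negPf nc) mul0r.
rewrite big1_seq // => c; rewrite mem_lows => ca; rewrite pscoefX.
case: eqP => [e|]; rewrite ?mul0r //.
by move: ca; rewrite e lep1mP -lt0n ai.
Qed.

Lemma mpsCM : {morph mpsC n (A := A) : x y / x * y}.
Proof.
by move=> x y; apply: mpseriesP => a; rewrite pscoefCM /=; case: eqP; rewrite ?mulr0.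
Qed.
Lemma mpsCD : {morph mpsC n (A := A) : x y / x + y}.
Proof.
by move=> x y; apply: mpseriesP => a; rewrite pscoefD /=; case: eqP; rewrite ?addr0.
Qed.
Lemma mpsCN : {morph mpsC n (A := A) : x / - x}.
Proof.
by move=> x; apply: mpseriesP => a; rewrite pscoefN /=; case: eqP; rewrite ?oppr0.
Qed.
Lemma mpsC0 : mpsC n (0 : A) = 0.
Proof. by apply: mpseriesP => a; rewrite pscoefC; case: eqP. Qed.
Lemma mpsC1 : mpsC n (1 : A) = 1.
Proof. by []. Qed.
Lemma mpsCX x k : mpsC n ((x : A) ^+ k) = mpsC n x ^+ k.
Proof. by elim: k => [//|k IH]; rewrite !exprS mpsCM IH. Qed.

(* The monomial with exponent a <> 0 is assigned to the least i with a_i > 0. *)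
Definition first_var (a : 'X_{1..n}) (i : 'I_n) :=
  (0 < a i)%N && [forall j : 'I_n, (j < i)%N ==> (a j == 0%N)].

Lemma first_varP a : a != 0%MM -> exists i, forall j, first_var a j = (j == i).
Proof.
move=> /mnm_pos[i0 hi0].
have [i hi imin] := @arg_minnP _ i0 (fun i => 0 < a i)%N (fun i : 'I_n => i : nat) hi0.
have fi : first_var a i.
  rewrite /first_var hi; apply/forallP => j; apply/implyP => ji.
  by rewrite eqn0Ngt; apply: contraL ji => /imin; rewrite -leqNgt.
exists i => j; apply/idP/eqP => [/andP[aj /forallP h]|->//].
apply/val_inj/eqP; rewrite eqn_leq imin //= andbT leqNgt; apply/negP => ij.
by have := h i; rewrite ij /= => /eqP e; move: hi; rewrite e.
Qed.

Lemma mps_split f : exists g : 'I_n -> mpseries n A,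
  f = mpsC n (pscoef f 0%MM) + \sum_i mpsX A i * g i /\
  forall k, (forall a, (mdeg a < k.+1)%N -> pscoef f a = 0) ->
    forall i a, (mdeg a < k)%N -> pscoef (g i) a = 0.
Proof.
pose g i := MPSeries (fun b =>
  if first_var (b + U_(i))%MM i then pscoef f (b + U_(i))%MM else 0).
exists g; split; last first.
  move=> k hk i a ak /=; case: ifP => // _; apply: hk.
  by rewrite mdegD mdeg1 addn1 ltnS.
rewrite {}/g.
apply: mpseriesP => a; rewrite pscoefD pscoef_sum pscoefC.
have e i : pscoef (mpsX A i * MPSeries (fun b =>
    if first_var (b + U_(i))%MM i then pscoef f (b + U_(i))%MM else 0)) a =
    if first_var a i then pscoef f a else 0.
  rewrite pscoefXM; case: ifP => ai /=; last by rewrite /first_var ai.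
  by rewrite submK // lep1mP -lt0n.
rewrite (eq_bigr _ (fun i _ => e i)); case: eqP => [->|/eqP na].
  by rewrite big1 ?addr0 // => i _; rewrite /first_var mnm0E.
have [i hi] := first_varP na.
rewrite (bigD1 i) //= hi eqxx big1 ?addr0 ?add0r // => j ji.
by rewrite hi (negPf ji).
Qed.

Definition ord_ge k f := forall a, (mdeg a < k)%N -> pscoef f a = 0.

Lemma ord_geM k l f g : ord_ge k f -> ord_ge l g -> ord_ge (k + l) (f * g).
Proof.
move=> hf hg a akl; rewrite pscoefM big1_seq // => c; rewrite mem_lows => /= ca.
have [ck|kc] := ltnP (mdeg c) k; first by rewrite hf // mul0r.
rewrite hg ?mulr0 //; have := akl; rewrite -{1}(submK ca) mdegD.
by move: kc; lia.
Qed.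
Lemma ord_geX k f : ord_ge 1 f -> ord_ge k (f ^+ k).
Proof. by move=> hf; elim: k => [//|k IH]; rewrite exprS -add1n; apply: ord_geM. Qed.

Lemma ord_ge_eqM k f f' g : ord_ge k (f - f') -> ord_ge k (f * g - f' * g).
Proof. by move=> h; rewrite -mulrBl -[k]addn0; apply: ord_geM. Qed.

Lemma mps_unitP f x : x * pscoef f 0%MM = 1 -> f \is a GRing.unit.
Proof.
move=> xf; pose h := 1 - mpsC n x * f.
have h0 : ord_ge 1 h.
  move=> a; rewrite ltnS leqn0 mdeg_eq0 => /eqP->.
  by rewrite pscoefB pscoef1 pscoefCM xf eqxx subrr.
pose s k := \sum_(i < k) h ^+ i.
have hs k : (1 - h) * s k = 1 - h ^+ k.
  by rewrite -[RHS](opprB (h ^+ k)) subrX1 -mulNr (opprB h).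
(* The geometric series: since [h] has order at least 1, its coefficient at a is that of any partial
   sum with more than |a| terms. *)
pose g := MPSeries (fun a => pscoef (s (mdeg a).+1) a).
have gs k : ord_ge k (s k - g).
  move=> a ak; rewrite pscoefB /= /s -(big_mkord xpredT (fun i => h ^+ i)).
  rewrite -(big_mkord xpredT (fun i => h ^+ i)) (big_cat_nat (n := (mdeg a).+1) (leq0n _) ak) //=.
  rewrite addrAC subrr add0r pscoef_sum big1_seq // => i.
  rewrite mem_index_iota => /andP[_ /andP[ai _]].
  exact: (ord_geX (k := i) h0).
suff e : (1 - h) * g = 1.
  apply/unitrPr; exists (mpsC n x * g); rewrite mulrA [f * _]mulrC.
  by rewrite -[RHS]e /h opprB addrC subrK.
apply: mpseriesP => a; have ak : (mdeg a < (mdeg a).+1)%N by [].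
have := ord_ge_eqM (1 - h) (gs (mdeg a).+1) ak.
rewrite pscoefB ![_ * (1 - h)]mulrC hs => /eqP; rewrite subr_eq0 => /eqP <-.
by rewrite pscoefB (ord_geX (k := (mdeg a).+1) h0) ?subr0.
Qed.

Lemma pscoefM0 f g : pscoef (f * g) 0%MM = pscoef f 0%MM * pscoef g 0%MM.
Proof.
rewrite pscoefM (bigD1_seq 0%MM) ?lows_uniq //=; last by rewrite mem_lows lem0.
rewrite subm0 big1_seq ?addr0 // => c /andP[nc]; rewrite mem_lows => /mnm_lepP h.
case/eqP: nc; apply/mnmP => i; rewrite mnm0E; apply/eqP.
by have := h i; rewrite mnm0E leqn0.
Qed.

(** Induction on the order of g: in lowest degree only the constant coefficient of f acts. *)
Lemma mps_reg f g : (forall x : A, pscoef f 0%MM * x = 0 -> x = 0) -> f * g = 0 -> g = 0.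
Proof.
move=> reg fg; suff h k : ord_ge k g by apply: mpseriesP => a; apply: (h (mdeg a).+1).
elim: k => [//|k IH] a; rewrite ltnS leq_eqVlt => /orP[/eqP ak|]; last exact: IH.
apply: reg; have := congr1 (fun h => pscoef h a) fg; rewrite pscoefM pscoef0.
rewrite (bigD1_seq 0%MM) ?lows_uniq //=; last by rewrite mem_lows lem0.
rewrite subm0 big1_seq ?addr0 // => c /andP[nc]; rewrite mem_lows => ca.
rewrite IH ?mulr0 //; have := congr1 (@mdeg n) (submK ca); rewrite mdegD ak.
by move: nc; rewrite -mdeg_eq0; lia.
Qed.

End PowerSeries.

(** * Adic filtrations and evaluation of power series *)

Section Filtration.
Variables (n : nat) (W : comNzRingType) (w : W).
Implicit Types (f g : mpseries n W).

(** The element w is p over a complete p-ring and 0 over a field. Since [0 ^+ 0 = 1], the case w = 0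
    is the discrete topology: everything for k = 0, only zero afterwards. *)
Definition wdiv k (x : W) := exists y, x = w ^+ k * y.

Lemma wdiv0 k : wdiv k 0. Proof. by exists 0; rewrite mulr0. Qed.
Lemma wdivD k x y : wdiv k x -> wdiv k y -> wdiv k (x + y).
Proof. by move=> [u ->] [v ->]; exists (u + v); rewrite mulrDr. Qed.
Lemma wdivN k x : wdiv k x -> wdiv k (- x).
Proof. by move=> [u ->]; exists (- u); rewrite mulrN. Qed.
Lemma wdivM k l x y : wdiv k x -> wdiv l y -> wdiv (k + l) (x * y).
Proof. by move=> [u ->] [v ->]; exists (u * v); rewrite exprD; ring. Qed.
Lemma wdivW k l x : (l <= k)%N -> wdiv k x -> wdiv l x.
Proof. by move=> /subnK <- [u ->]; exists (w ^+ (k - l) * u); rewrite exprD; ring. Qed.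
Lemma wdiv_0 x : wdiv 0 x.
Proof. by exists x; rewrite mul1r. Qed.
Lemma wdiv_sum k (I : Type) (s : seq I) (P : pred I) (F : I -> W) :
  (forall i, P i -> wdiv k (F i)) -> wdiv k (\sum_(i <- s | P i) F i).
Proof. by move=> h; elim/big_ind: _ => //; [apply: wdiv0 | move=> x y; apply: wdivD]. Qed.
Lemma wdiv_sum_seq k (I : eqType) (s : seq I) (F : I -> W) :
  (forall i, i \in s -> wdiv k (F i)) -> wdiv k (\sum_(i <- s) F i).
Proof. by move=> h; rewrite big_seq; apply: wdiv_sum. Qed.

(* The (w, X_1, .., X_n)-adic filtration. *)
Definition fil k f := forall a, wdiv (k - mdeg a) (pscoef f a).

Lemma fil0 k : fil k 0. Proof. by move=> a; apply: wdiv0. Qed.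
Lemma filD k f g : fil k f -> fil k g -> fil k (f + g).
Proof. by move=> hf hg a; apply: wdivD. Qed.
Lemma filN k f : fil k f -> fil k (- f).
Proof. by move=> hf a; apply: wdivN. Qed.
Lemma fil_0 f : fil 0 f.
Proof. by move=> a; apply: wdiv_0. Qed.
Lemma filM k l f g : fil k f -> fil l g -> fil (k + l) (f * g).
Proof.
move=> hf hg a; rewrite pscoefM; apply: wdiv_sum_seq => c; rewrite mem_lows => ca.
apply: wdivW (wdivM (hf c) (hg (a - c)%MM)).
by rewrite -{1}(submK ca) mdegD; lia.
Qed.
Lemma filW k l f : (l <= k)%N -> fil k f -> fil l f.
Proof. by move=> lk h a; apply: wdivW (h a); apply: leq_sub2r. Qed.
Lemma fil_sum k (I : Type) (s : seq I) (P : pred I) (F : I -> mpseries n W) :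
  (forall i, P i -> fil k (F i)) -> fil k (\sum_(i <- s | P i) F i).
Proof. by move=> h; elim/big_ind: _ => //; [apply: fil0 | move=> x y; apply: filD]. Qed.
Lemma filX i : fil 1 (mpsX W i).
Proof.
move=> a; rewrite pscoefX; case: eqP => [->|_]; last exact: wdiv0.
by rewrite mdeg1; apply: wdiv_0.
Qed.
Lemma filC : fil 1 (mpsC n w).
Proof.
move=> a; rewrite pscoefC; case: eqP => _; last exact: wdiv0.
by apply: (wdivW (leq_subr _ _)); exists 1; rewrite expr1 mulr1.
Qed.

Hypothesis wsep : forall x, (forall k, wdiv k x) -> x = 0.
Hypothesis wcomp : forall x : nat -> W, (forall k, wdiv k (x k.+1 - x k)) ->
  exists l, forall k, wdiv k (l - x k).

Lemma fil_sep f : (forall k, fil k f) -> f = 0.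
Proof.
move=> h; apply: mpseriesP => a; apply: wsep => k.
by have := h (k + mdeg a)%N a; rewrite addnK.
Qed.

Lemma fil_complete (f : nat -> mpseries n W) : (forall k, fil k (f k.+1 - f k)) ->
  exists l, forall k, fil k (l - f k).
Proof.
move=> hf.
have ex a : exists l, forall k, wdiv k (l - pscoef (f (k + mdeg a)%N) a).
  by apply: wcomp => k; have := hf (k + mdeg a)%N a; rewrite addnK.
have [l hl] := choice ex.
exists (MPSeries l) => k a; rewrite pscoefB /=.
have [ka|ka] := leqP (mdeg a) k; first by have := hl a (k - mdeg a)%N; rewrite subnK.
by rewrite (eqP (ltnW ka)); apply: wdiv_0.
Qed.

End Filtration.

Section Evaluation.
Variables (n : nat) (S : comNzRingType) (A : nzRingType).
Variables (theta : {rmorphism S -> A}) (w : 'I_n -> A).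
Hypothesis ww : forall i j, GRing.comm (w i) (w j).
Hypothesis tw : forall s i, GRing.comm (theta s) (w i).

Lemma mmap1_comm a b : mmap1 w (a + b)%MM = mmap1 w a * mmap1 w b.
Proof.
rewrite /mmap1; elim: (index_enum _) => [|i s IH]; first by rewrite !big_nil mulr1.
rewrite !big_cons mnmDE exprD IH -!mulrA; congr (_ * _); rewrite !mulrA; congr (_ * _).
apply: commr_prod => j _; apply: commrX; apply: commr_sym; apply: commrX; exact: ww.
Qed.

Lemma theta_mmap1 s a : GRing.comm (theta s) (mmap1 w a).
Proof. by apply: commr_prod => j _; apply: commrX; apply: tw. Qed.

Lemma mmap_comm p q : mmap theta w (p * q) = mmap theta w p * mmap theta w q.
Proof.
pose_big_enough i.
  rewrite (mpolywME (k := i)) // raddf_sum /= !(mmapE i) //.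
  rewrite big_distrlr /= pair_bigA; apply/eq_bigr => /=.
  case=> j1 j2 _ /=; rewrite mmapZ mmapX mmap1_comm rmorphM -!mulrA; congr (_ * _).
  by rewrite !mulrA; congr (_ * _); apply: theta_mmap1.
by close.
Qed.

Variables (F : nat -> set A) (N : nat).
Hypothesis FD : forall k x y, F k x -> F k y -> F k (x + y).
Hypothesis FN : forall k x, F k x -> F k (- x).
Hypothesis F0 : forall k, F k 0.
Hypothesis FMl : forall k x y, F k y -> F k (x * y).
Hypothesis FMr : forall k x y, F k x -> F k (x * y).
Hypothesis Fsep : forall x, (forall k, F k x) -> x = 0.
Hypothesis Fcomp : forall x : nat -> A, (forall k, F k (x k.+1 - x k)) ->
  exists l, forall k, F k (l - x k).
Hypothesis wF : forall a k, (N * k <= mdeg a)%N -> F k (mmap1 w a).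

Lemma FB k x y : F k x -> F k y -> F k (x - y).
Proof. by move=> hx hy; apply: FD => //; apply: FN. Qed.

Lemma mmap_fil k (p : {mpoly S[n]}) : (forall a, (mdeg a < N * k)%N -> p@_a = 0) ->
  F k (mmap theta w p).
Proof.
move=> hp; rewrite /mmap; elim/big_ind: _ => // [x y|a _]; first exact: FD.
have [/hp ->|Na] := ltnP (mdeg a) (N * k); first by rewrite rmorph0 mul0r.
exact/FMl/wF.
Qed.

Definition agree k (p : {mpoly S[n]}) (f : mpseries n S) :=
  forall a, (mdeg a < N * k)%N -> p@_a = pscoef f a.

Lemma eval_ex (f : mpseries n S) :
  exists x, forall k p, agree k p f -> F k (x - mmap theta w p).
Proof.
have [k|x hx] := Fcomp (x := fun k => mmap theta w (mps_trunc (N * k) f)).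
  rewrite -mmapB; apply: mmap_fil => a ak; rewrite mcoeffB !mps_truncE ?subrr //.
  by apply: leq_trans ak _; rewrite mulnS leq_addl.
exists x => k p hp; rewrite -[x](subrK (mmap theta w (mps_trunc (N * k) f))) -addrA.
apply: FD => //; rewrite -mmapB; apply: mmap_fil => a ak.
by rewrite mcoeffB mps_truncE // hp // subrr.
Qed.

(** The target is noncommutative because matrices will be substituted; commutation is asked only of
    the values. The value at f is the limit of the values at truncations below degree [N * k], and
    multiplicativity holds because products of truncations are correct below that degree. *)
Theorem evaluation : exists ev : mpseries n S -> A,
  [/\ forall f g, ev (f + g) = ev f + ev g,
      forall f g, ev (f * g) = ev f * ev g,
      forall s, ev (mpsC n s) = theta s &
      forall i, ev (mpsX S i) = w i].
Proof.
have [ev hev] := choice eval_ex.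
have uniq f x : (forall k, exists2 p, agree k p f & F k (x - mmap theta w p)) -> ev f = x.
  move=> h; apply/eqP; rewrite -subr_eq0; apply/eqP/Fsep => k.
  have [p hp hx] := h k.
  rewrite (_ : _ - _ = (ev f - mmap theta w p) - (x - mmap theta w p)).
    by apply: FB => //; apply: hev.
  by rewrite opprB addrA subrK.
have trunc k f : agree k (mps_trunc (N * k) f) f by move=> a ak; apply: mps_truncE.
exists ev; split=> [f g|f g|s|i]; apply: uniq => k.
- exists (mps_trunc (N * k) f + mps_trunc (N * k) g).
    by move=> a ak; rewrite mcoeffD !mps_truncE.
  by rewrite mmapD opprD addrACA; apply: FD; apply: hev.
- exists (mps_trunc (N * k) f * mps_trunc (N * k) g).
    by move=> a ak; rewrite mps_trunc_mul.
  rewrite mmap_comm; set u := mmap _ _ _; set v := mmap _ _ _.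
  rewrite (_ : _ - _ = (ev f - u) * ev g + u * (ev g - v)).
    by apply: FD; [apply: FMr | apply: FMl]; apply: hev.
  by rewrite mulrBl mulrBr addrA subrK.
- by exists s%:MP; [move=> a _; rewrite mpsC_trunc | rewrite mmapC subrr; apply: F0].
- exists 'X_i; first by move=> a _; rewrite mcoeffX /= eq_sym; case: eqP.
  by rewrite mmapX mmap1U subrr; apply: F0.
Qed.

End Evaluation.

(** * Killing variables and changing coefficients *)

Section Restriction.
Variables (V W : comNzRingType) (iota : {rmorphism V -> W}).
Variables (d d' : nat) (g : 'I_d' -> 'I_d).
Hypothesis ginj : injective g.

Definition mext (b : 'X_{1..d'}) : 'X_{1..d} :=
  [multinom (if [pick j | g j == l] is Some j then b j else 0%N) | l < d].
Definition mres (a : 'X_{1..d}) : 'X_{1..d'} := [multinom a (g j) | j < d'].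

Lemma mext_g b j : mext b (g j) = b j.
Proof.
rewrite mnmE; case: pickP => [i /eqP /ginj ->//|/(_ j)]; by rewrite eqxx.
Qed.
Lemma mext_out b l : l \notin codom g -> mext b l = 0%N.
Proof.
by move=> hl; rewrite mnmE; case: pickP => // i /eqP e; rewrite -e codom_f in hl.
Qed.
Lemma mextP (b : 'X_{1..d'}) (a : 'X_{1..d}) : (forall j, a (g j) = b j) ->
  (forall l, l \notin codom g -> a l = 0%N) -> a = mext b.
Proof.
move=> h1 h2; apply/mnmP => l; have [/codomP[j ->]|hl] := boolP (l \in codom g).
  by rewrite mext_g.
by rewrite mext_out // h2.
Qed.
Lemma mresK b : mres (mext b) = b.
Proof. by apply/mnmP => j; rewrite mnmE mext_g. Qed.
Lemma mext_inj : injective mext.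
Proof. exact: can_inj mresK. Qed.
Lemma mextB b c : mext (b - c) = (mext b - mext c)%MM.
Proof.
symmetry; apply: mextP => [j|l hl]; rewrite !mnmBE ?mext_g //.
by rewrite !mext_out.
Qed.
Lemma mext0 : mext 0%MM = 0%MM.
Proof. by symmetry; apply: mextP => *; rewrite !mnm0E. Qed.
Lemma mext_le b c : (mext b <= mext c)%MM = (b <= c)%MM.
Proof.
apply/mnm_lepP/mnm_lepP => h i; first by have := h (g i); rewrite !mext_g.
have [/codomP[j ->]|hl] := boolP (i \in codom g); first by rewrite !mext_g.
by rewrite mext_out.
Qed.

Definition restrict (f : mpseries d V) : mpseries d' W :=
  MPSeries (fun b => iota (pscoef f (mext b))).

Lemma restrictB : {morph restrict : f h / f - h}.
Proof. by move=> f h; apply: mpseriesP => b; rewrite /= rmorphB. Qed.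

Lemma lows_mext b : perm_eq (lows (mext b)) [seq mext c | c <- lows b].
Proof.
apply: uniq_perm; first exact: lows_uniq.
  by rewrite (map_inj_uniq mext_inj) lows_uniq.
move=> a; rewrite mem_lows; apply/idP/mapP => [ab|[c]]; last first.
  by rewrite mem_lows => cb ->; rewrite mext_le.
have ea : a = mext (mres a).
  apply: mextP => [j|l hl]; first by rewrite mnmE.
  by move/mnm_lepP: ab => /(_ l); rewrite (mext_out _ hl) leqn0 => /eqP.
by exists (mres a) => //; rewrite mem_lows -mext_le -ea.
Qed.

(** Divisors of an exponent supported on the image of [g] are supported there too, so both Cauchy
    products run over the same pairs. *)
Lemma restrictM : {morph restrict : f h / f * h}.
Proof.
move=> f h; apply: mpseriesP => b.
transitivity (iota (pscoef (f * h) (mext b))); first by [].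
rewrite !pscoefM rmorph_sum (perm_big _ (lows_mext b)) big_map.
by apply: eq_bigr => c _; rewrite rmorphM /= mextB.
Qed.

Lemma restrictC v : restrict (mpsC d v) = mpsC d' (iota v).
Proof.
apply: mpseriesP => b; rewrite pscoefC -(inj_eq mext_inj) mext0 /=.
by case: eqP => // _; rewrite rmorph0.
Qed.

Lemma restrictX j : restrict (mpsX V (g j)) = mpsX W j.
Proof.
apply: mpseriesP => b; rewrite pscoefX.
have -> : (b == U_(j)%MM) = (mext b == U_(g j)%MM).
  rewrite -(inj_eq mext_inj); congr (_ == _); symmetry; apply: mextP => [i|l hl].
    by rewrite !mnm1E (inj_eq ginj).
  by rewrite mnm1E; case: eqP => // e; rewrite -e codom_f in hl.
by rewrite /=; case: eqP => _; rewrite ?rmorph1 ?rmorph0.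
Qed.

Lemma restrictX0 l : l \notin codom g -> restrict (mpsX V l) = 0.
Proof.
move=> hl; apply: mpseriesP => b; rewrite /=; case: eqP => [e|]; last by rewrite rmorph0.
by have := mext_out b hl; rewrite e mnm1E eqxx.
Qed.

Lemma restrict_surj : (forall y, exists x, iota x = y) -> forall y, exists f, restrict f = y.
Proof.
move=> h y; have [s hs] := choice h.
exists (MPSeries (fun a => s (pscoef y (mres a)))).
by apply: mpseriesP => b; rewrite /= mresK hs.
Qed.

Lemma restrict_rmorphism :
  exists t : {rmorphism mpseries d V -> mpseries d' W}, t =1 restrict.
Proof.
have m1 : GRing.monoid_morphism restrict.
  by split; [rewrite -[RHS]/(mpsC d' 1) -(rmorph1 iota) -restrictC | apply: restrictM].
pose t : {rmorphism mpseries d V -> mpseries d' W} :=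
  HB.pack restrict (GRing.isZmodMorphism.Build _ _ restrict restrictB)
    (GRing.isMonoidMorphism.Build _ _ restrict m1).
by exists t.
Qed.

End Restriction.

(** * Monomial matrices and the module Q *)

Section MonomialMatrices.
Variables (S : comNzRingType) (K r' : nat) (eta : 'I_K -> S).
Local Notation r := r'.+1.
Local Notation mon := (mmap1 eta).
Implicit Types (i j k : 'I_r) (gam : 'X_{1..K}).

Lemma monD g1 g2 : mon (g1 + g2)%MM = mon g1 * mon g2.
Proof. by apply: mmap1_comm => i j; apply: mulrC. Qed.
Lemma monMn gam q : mon (gam *+ q)%MM = mon gam ^+ q.
Proof.
elim: q => [|q IH]; first by rewrite mulm0n mmap11 expr0.
by rewrite mulmS monD IH exprS.
Qed.

Definition regular_elt (x : S) := forall s, x * s = 0 -> s = 0.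

Lemma regular_mon gam : (forall l, (0 < gam l)%N -> regular_elt (eta l)) ->
  regular_elt (mon gam).
Proof.
move=> h; rewrite /mmap1; elim/big_ind: _ => [s|x y hx hy s|l _].
- by rewrite mul1r.
- by rewrite -mulrA => /hx /hy.
case e : (gam l) => [|k] s; first by rewrite expr0 mul1r.
have hl : regular_elt (eta l) by apply: h; rewrite e.
by elim: k.+1 s => [|q IH] s; [rewrite mul1r | rewrite exprS -mulrA => /hl /IH].
Qed.

Lemma mon_eq0 gam l : (0 < gam l)%N -> eta l = 0 -> mon gam = 0.
Proof.
by move=> gl el; rewrite /mmap1 (bigD1 l) //= el expr0n eqn0Ngt gl mul0r.
Qed.

(* e_j stands for u^j / eta^(expo j), where u^r = x eta^alpha; then
   u e_j = cst j eta^(step j) e_(j+1). *)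
Variables (x y : S) (alpha : 'X_{1..K}).
Hypothesis xy : x * y = 1.

Definition expo (t : nat) : 'X_{1..K} := [multinom (t * alpha l) %/ r | l < K].
(** If u is given the fractional exponent alpha / r, this is r times the exponent of the basis
    vector e_t. *)
Definition rexp (t : nat) : 'X_{1..K} := [multinom (t * alpha l) %% r | l < K].
Definition step t : 'X_{1..K} := (expo t.+1 - expo t)%MM.
Definition cst (j : nat) : S := if j.+1 == r then x else 1.
Definition cst_inv (j : nat) : S := if j.+1 == r then y else 1.

Lemma expoE t l : expo t l = ((t * alpha l) %/ r)%N.
Proof. exact: mnmE. Qed.
Lemma rexpE t l : rexp t l = ((t * alpha l) %% r)%N.
Proof. exact: mnmE. Qed.
Lemma expo_le t s : (t <= s)%N -> (expo t <= expo s)%MM.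
Proof.
by move=> ts; apply/mnm_lepP => l; rewrite !expoE leq_div2r // leq_mul2r ts orbT.
Qed.
Lemma expoD t : expo (t + r) = (alpha + expo t)%MM.
Proof. by apply/mnmP => l; rewrite mnmDE !expoE mulnDl addnC mulnC divnMDl. Qed.
Lemma expo0 : expo 0 = 0%MM.
Proof. by apply/mnmP => l; rewrite [RHS]mnm0E expoE mul0n div0n. Qed.
Lemma step_mod t : step (t %% r) = step t.
Proof.
rewrite [in RHS](divn_eq t r); move: (t %% r)%N => s; elim: (t %/ r)%N => // q IH.
rewrite mulSn -addnA addnC {}IH /step.
have -> : expo (q * r + s + r).+1 = (alpha + expo (q * r + s).+1)%MM by rewrite -addSn expoD.
by rewrite expoD; apply/mnmP => l; rewrite !mnmBE !mnmDE subnDl.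
Qed.

(** The vector u^t / eta^(expo t) for every natural t, reduced by u^r = x eta^alpha. Indexing beyond
    r - 1 removes the wrap-around from the computations. *)
Definition evec (t : nat) : 'cV[S]_r := x ^+ (t %/ r) *: delta_mx (inord (t %% r)) 0.

Lemma evec_ord j : evec j = delta_mx j 0.
Proof. by rewrite /evec divn_small // modn_small // inord_val expr0 scale1r. Qed.

Definition shift_up : 'M[S]_r :=
  \matrix_(k, j) if k == ordS j then cst j * mon (step j) else 0.

Lemma shift_up_delta j :
  shift_up *m delta_mx j 0 = (cst j * mon (step j)) *: delta_mx (ordS j) (0 : 'I_1).
Proof.
apply/matrixP => k z; rewrite ord1 -colE !mxE eqxx andbT.
by case: eqP; rewrite ?mulr1 ?mulr0.
Qed.

Lemma shift_up_evec t :
  shift_up *m evec t = mon (expo t.+1 - expo t)%MM *: evec t.+1.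
Proof.
have tr : (t %% r < r)%N by rewrite ltn_mod.
rewrite -scalemxAr shift_up_delta inordK // step_mod.
rewrite /evec !scalerA; congr (_ *: delta_mx _ _); last first.
  apply/val_inj; rewrite /= !inordK ?ltn_mod //.
  by rewrite -addn1 modnDml addn1.
rewrite -/(step t) [RHS]mulrC mulrA; congr (_ * _).
rewrite divnS // /cst.
have -> : ((t %% r).+1 == r) = (r %| t.+1)%N.
  rewrite /dvdn -[X in _ = (X %% _ == _)%N]addn1 -modnDml addn1; case: eqP => [->|]; first by rewrite modnn.
  by move=> h; rewrite modn_small // ltn_neqAle tr andbT; apply/eqP.
by case: (r %| t.+1)%N; rewrite ?mulr1 // add1n exprS mulrC.
Qed.

Lemma shift_upX_evec s t :
  shift_up ^+ s *m evec t = mon (expo (t + s) - expo t)%MM *: evec (t + s).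
Proof.
elim: s => [|s IH]; first by rewrite expr0 mul1mx addn0 -[X in (X - _)%MM]add0m addmK mmap11 scale1r.
rewrite exprS -mulmxE -mulmxA IH -scalemxAr shift_up_evec scalerA -monD addnS.
congr (mon _ *: _); apply/mnmP => l; rewrite mnmDE !mnmBE.
have /mnm_lepP/(_ l) := expo_le (leqnSn (t + s)).
have /mnm_lepP/(_ l) := expo_le (leq_addr s t).
by lia.
Qed.

Lemma shift_upXr : shift_up ^+ r = (x * mon alpha)%:M.
Proof.
have col_eq (M1 M2 : 'M[S]_r) : (forall j, M1 *m delta_mx j (0 : 'I_1) = M2 *m delta_mx j 0) -> M1 = M2.
  move=> h; apply/matrixP => k j; have := h j; rewrite -!colE => /matrixP/(_ k 0).
  by rewrite !mxE.
apply: col_eq => j; rewrite -evec_ord shift_upX_evec mul_scalar_mx expoD addmK.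
by rewrite /evec divnDr // divnn /= modnDr divn_small // modn_small // expr1 expr0 scale1r !scalerA mulrC.
Qed.

Lemma shift_upX_delta0 j :
  shift_up ^+ j *m delta_mx ord0 0 = mon (expo j) *: delta_mx j (0 : 'I_1).
Proof.
have -> : delta_mx ord0 0 = evec 0 by rewrite -(evec_ord ord0).
by rewrite shift_upX_evec add0n expo0 subm0 evec_ord.
Qed.

Section ShiftDown.
Variables (b : S) (beta alpha' : 'X_{1..K}).
Hypothesis ab : (alpha + alpha' = beta *+ r)%MM.

(** Since alpha <= r beta, floor((t + 1) alpha / r) exceeds floor(t alpha / r) by at most beta.
    Hence the truncated difference [beta - step] is a true one. *)
Lemma step_le t : (step t <= beta)%MM.
Proof.
apply/mnm_lepP => l; rewrite mnmBE !expoE leq_subLR addnC -divnMDl //.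
rewrite leq_div2r // mulSn leq_add2r.
by have /mnmP/(_ l) := ab; rewrite mnmDE mulmnE => <-; apply: leq_addr.
Qed.

(** The matrix of b eta^beta / u, the operator forced on a second generator u' by the relation u u'
    = b eta^beta. *)
Definition shift_down : 'M[S]_r :=
  \matrix_(k, j) if k == ord_pred j then
     b * cst_inv (ord_pred j) * mon (beta - step (ord_pred j))%MM else 0.

Lemma cst_mul j : cst j * cst_inv j = 1.
Proof. by rewrite /cst /cst_inv; case: eqP; rewrite ?mulr1. Qed.

Lemma mon_step j : mon (step j) * mon (beta - step j)%MM = mon beta.
Proof. by rewrite -monD addmC submK // step_le. Qed.

Lemma shift_up_down : shift_up * shift_down = (b * mon beta)%:M.
Proof.
apply/matrixP => k j; rewrite !mxE (bigD1 (ord_pred j)) //= big1 ?addr0.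
  rewrite !mxE eqxx ord_predK; case: eqP => _; last by rewrite mul0r mulr0n.
  rewrite mulr1n mulrACA; congr (_ * _); last exact: mon_step.
  by rewrite mulrCA cst_mul mulr1.
by move=> l lj; rewrite !mxE (negPf lj) mulr0.
Qed.

Lemma shift_down_up : shift_down * shift_up = (b * mon beta)%:M.
Proof.
apply/matrixP => k j; rewrite !mxE (bigD1 (ordS j)) //= big1 ?addr0.
  rewrite !mxE eqxx ordSK; case: eqP => _; last by rewrite mul0r mulr0n.
  rewrite mulr1n mulrACA [X in _ * X]mulrC; congr (_ * _); last exact: mon_step.
  by rewrite -mulrA [_ * cst j]mulrC cst_mul mulr1.
by move=> l lj; rewrite !mxE (negPf lj) mulr0.
Qed.

(** Homogeneity: multiplication by u adds alpha to the degree of a basis vector, also at the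
    wrap-around. *)
Lemma rexp_up j l : (r * step j l + rexp (ordS j) l = rexp j l + alpha l)%N.
Proof.
have e t : (t * alpha l = expo t l * r + rexp t l)%N by rewrite expoE rexpE -divn_eq.
have em : rexp (ordS j) l = rexp j.+1 l by rewrite !rexpE /= modnMml.
have h := e j; have h' := e j.+1; rewrite mulSn in h'.
have /mnm_lepP/(_ l) := expo_le (leqnSn j).
by rewrite em mnmBE; nia.
Qed.

Lemma rexp_down j l :
  (r * (beta - step (ord_pred j))%MM l + rexp (ord_pred j) l = rexp j l + alpha' l)%N.
Proof.
have := rexp_up (ord_pred j) l; rewrite ord_predK mnmBE.
have /mnm_lepP/(_ l) := step_le (ord_pred j).
have /mnmP/(_ l) := ab; rewrite mnmDE mulmnE.
by nia.
Qed.

End ShiftDown.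
End MonomialMatrices.

(** * Simultaneous monomial action of all the u_i *)

Section MonomialAction.
Variables (S : comNzRingType) (K n m : nat) (eta : 'I_K -> S).
Variables (a : 'I_n -> S) (b : 'I_n -> 'I_n -> S).
Variables (alpha : 'I_n -> 'X_{1..K}) (beta : 'I_n -> 'I_n -> 'X_{1..K}).
Variable Z : {set 'I_K}.
Local Notation mon := (mmap1 eta).

(** If alpha_i involves a killed entry, u_i^m becomes 0 and u_i is made to act by 0; the remaining
    indices are the active ones. *)
Definition active (i : 'I_n) := [forall l, (0 < alpha i l)%N ==> (l \notin Z)].

(* A representation of the u_i by commuting r x r matrices (r = mr + 1), monomial
   in the basis e_j; the degree of eta^gam e_j is r gam + mbasis j. *)
Record monomial_action := MonomialAction {
  mr : nat;
  mU : 'I_n -> 'M[S]_mr.+1;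
  mbasis : 'I_mr.+1 -> 'X_{1..K};
  mexpo : 'I_mr.+1 -> 'X_{1..K};
  mU_comm : forall i j, mU i * mU j = mU j * mU i;
  mU_pow : forall i, mU i ^+ m = (a i * mon (alpha i))%:M;
  mU_mul : forall i j : 'I_n, (i < j)%N -> mU i * mU j = (b i j * mon (beta i j))%:M;
  mU_inactive : forall i, ~~ active i -> mU i = 0;
  mU_active : forall i, active i -> exists (s : 'I_mr.+1 -> 'I_mr.+1) (u : 'I_mr.+1 -> S)
      (e : 'I_mr.+1 -> 'X_{1..K}),
    [/\ injective s, forall j, exists v, u j * v = 1,
        forall k j, mU i k j = if k == s j then u j * mon (e j) else 0 &
        forall j l, (mr.+1 * e j l + mbasis (s j) l = mbasis j l + alpha i l)%N];
  mbasis_lt : forall j l, (mbasis j l < mr.+1)%N;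
  mbasis_supp : forall j l, l \in Z -> mbasis j l = 0%N;
  mexpo_ex : forall j, (j = ord0 /\ mexpo j = 0%MM) \/
    exists i : 'I_n, mU i ^+ j *m delta_mx ord0 0 = mon (mexpo j) *: delta_mx j (0 : 'I_1);
  mexpo_supp : forall j l, l \in Z -> mexpo j l = 0%N;
  mr_active : forall i, active i -> mr.+1 = m }.

Hypothesis m0 : (0 < m)%N.
Hypothesis ha : forall i, exists v, a i * v = 1.
Hypothesis hZ : forall l, l \in Z -> eta l = 0.
Hypothesis hreg : forall l, l \notin Z -> regular_elt (eta l).
Hypothesis hab : forall i j : 'I_n, (i < j)%N ->
  a i * a j = b i j ^+ m /\ (alpha i + alpha j = beta i j *+ m)%MM.
Hypothesis hcons : forall i0 i j : 'I_n, active i0 -> active i -> active j ->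
  (i0 < i)%N -> (i < j)%N -> m = 2 /\ b i0 i * b i0 j = a i0 * b i j.

Lemma mon_inactive (gam : 'X_{1..K}) i : ~~ active i -> (forall l, (0 < alpha i l)%N -> (0 < gam l)%N) ->
  mon gam = 0.
Proof.
rewrite negb_forall => /existsP[l]; rewrite negb_imply negbK => /andP[al lZ] h.
by apply: (mon_eq0 (h l al)); apply: hZ.
Qed.

Lemma beta_pos (i j : 'I_n) : (i < j)%N ->
  forall l, (0 < alpha i l)%N || (0 < alpha j l)%N -> (0 < beta i j l)%N.
Proof.
move=> ij l h; have [_ /mnmP/(_ l)] := hab ij; rewrite mnmDE mulmnE.
by case: (beta i j l) h => // /orP[]; rewrite mul0n; lia.
Qed.

Lemma scalar_cancel r (M : 'M[S]_r.+1) z t : regular_elt z -> z%:M * M = (z * t)%:M ->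
  M = t%:M.
Proof.
move=> rz e; apply/matrixP => k j; apply/eqP; rewrite -subr_eq0; apply/eqP/rz.
have /matrixP/(_ k j) := e; rewrite mulrBr -mulmxE mul_scalar_mx !mxE => ->.
by rewrite mulrnAr subrr.
Qed.

Lemma monomial_action_inactive : (forall i, ~~ active i) -> inhabited monomial_action.
Proof.
move=> hi; split.
have mon0 i : mon (alpha i) = 0 by apply: mon_inactive (hi i) _.
refine (@MonomialAction 0 (fun=> 0) (fun=> 0%MM) (fun=> 0%MM) _ _ _ _ _ _ _ _ _ _).
- by move=> i j; rewrite mulr0.
- by move=> i; rewrite mon0 mulr0 raddf0 -(prednK m0) exprS mul0r.
- move=> i j ij; rewrite mulr0 (mon_inactive (hi i)) ?mulr0 ?raddf0 // => l hl.
  by apply: beta_pos; rewrite ?hl.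
- by [].
- by move=> i; rewrite (negPf (hi i)).
- by move=> j l; rewrite mnm0E.
- by move=> j l _; rewrite mnm0E.
- by move=> j; left; rewrite ord1.
- by move=> j l _; rewrite mnm0E.
- by move=> i; rewrite (negPf (hi i)).
Qed.

(** The first active generator acts by [shift_up], every other one as its quotient b_0i eta^beta_0i
    / u_0. Powers and products of these quotients are checked after multiplication by a power of
    [U]; this suffices because [U ^+ r'.+1] is a regular scalar. The consistency hypothesis enters
    in the products of two quotients. *)
Lemma monomial_action_active i1 : active i1 -> inhabited monomial_action.
Proof.
move=> hi1; split.
have [i0 a0 imin] := @arg_minnP _ i1 active (fun i : 'I_n => i : nat) hi1.
pose r' := m.-1; have em : r'.+1 = m by apply: prednK.
have hab' (i j : 'I_n) : (i < j)%N -> a i * a j = b i j ^+ r'.+1 /\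
  (alpha i + alpha j = beta i j *+ r'.+1)%MM by rewrite em; apply: hab.
have hcons' := hcons; move: (r') em hab' => {}r' em hab'; rewrite -em in hcons'.
have /cid[y xy] := ha i0; set x := a i0 in xy.
pose V i := shift_down r' eta y (alpha i0) (b i0 i) (beta i0 i).
pose U := shift_up r' eta x (alpha i0).
pose c i := b i0 i * mon (beta i0 i).
have lt0 i : active i -> i != i0 -> (i0 < i)%N.
  by move=> ai ni; rewrite ltn_neqAle imin // andbT; apply: contra ni => /eqP/val_inj->.
have UV i : active i -> i != i0 -> U * V i = (c i)%:M.
  by move=> ai ni; have [_ e] := hab' _ _ (lt0 i ai ni); apply: (shift_up_down eta xy (b i0 i) e).
have VU i : active i -> i != i0 -> V i * U = (c i)%:M.
  by move=> ai ni; have [_ e] := hab' _ _ (lt0 i ai ni); apply: (shift_down_up eta xy (b i0 i) e).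
pose z := x * mon (alpha i0).
have rz : regular_elt z.
  move=> s; rewrite /z -mulrA => e; apply: (regular_mon (eta := eta) (gam := alpha i0)).
    by move=> l al; apply: hreg; move/forallP: a0 => /(_ l) /implyP; apply.
  by rewrite -[_ * s]mul1r -xy mulrAC e mul0r.
have Ur : U ^+ r'.+1 = z%:M by apply: shift_upXr.
have Vr i : active i -> i != i0 -> V i ^+ r'.+1 = (a i * mon (alpha i))%:M.
  move=> ai ni; apply: (scalar_cancel rz); rewrite -Ur -exprMn_comm; last first.
    by rewrite /GRing.comm UV // VU.
  rewrite UV // -rmorphXn /=; congr (_%:M).
  have [e1 e2] := hab' _ _ (lt0 i ai ni).
  by rewrite /c exprMn -e1 -monMn -e2 monD /z -/x; ring.
have VV i j : active i -> active j -> i != i0 -> j != i0 -> (i < j)%N ->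
    V i * V j = (b i j * mon (beta i j))%:M /\ V j * V i = (b i j * mon (beta i j))%:M.
  move=> ai aj ni nj ij.
  have [m2 e] := hcons' _ _ _ a0 ai aj (lt0 i ai ni) ij.
  have hc : c i * c j = z * (b i j * mon (beta i j)).
    rewrite /c /z mulrACA e [RHS]mulrACA; congr (_ * _); rewrite -!monD; congr mon.
    have [_ /mnmP e1] := hab' _ _ (lt0 i ai ni); have [_ /mnmP e2] := hab' _ _ (lt0 j aj nj).
    have [_ /mnmP e3] := hab' _ _ ij; apply/mnmP => l.
    move: (e1 l) (e2 l) (e3 l); rewrite !mulmnE !mnmDE m2; lia.
  have h k l : active k -> k != i0 -> active l -> l != i0 -> z%:M * (V k * V l) = (c k * c l)%:M.
    have Ur2 : U ^+ 2 = z%:M by rewrite -Ur; congr (U ^+ _).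
    move=> ak nk al nl; rewrite -Ur2 expr2 -[LHS]mulrA [U * (V k * _)]mulrA UV //.
    have -> : U * ((c k)%:M * V l) = (c k)%:M * (U * V l).
      by rewrite mulrA -[U * (c k)%:M]/(U *m (c k)%:M) scalar_mxC mulmxE -mulrA.
    by rewrite UV // (scalar_mxM _ (c k)) mulmxE.
  by split; apply: (scalar_cancel rz); rewrite -hc h // mulrC.
refine (@MonomialAction r'
  (fun i => if active i then if i == i0 then U else V i else 0)
  (fun j => rexp r' (alpha i0) j) (fun j => expo r' (alpha i0) j) _ _ _ _ _ _ _ _ _ _).
- move=> i j; case ai : (active i); case aj : (active j); rewrite ?mulr0 ?mul0r //.
  case: (eqVneq i i0) => [_|ni]; case: (eqVneq j i0) => [_|nj] //.
  + by rewrite UV // VU.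
  + by rewrite UV // VU.
  + have [ij|ji|/val_inj->//] := ltngtP i j.
      by have [-> ->] := VV i j ai aj ni nj ij.
    by have [-> ->] := VV j i aj ai nj ni ji.
- move=> i; rewrite -em; case: ifPn => [ai|nai]; last first.
    by rewrite (mon_inactive nai) // mulr0 raddf0 exprS mul0r.
  by case: (eqVneq i i0) => [->|ni]; [rewrite Ur | apply: Vr].
- move=> i j ij; case: (boolP (active i)) => [ai|nai]; last first.
    rewrite mul0r (mon_inactive nai) ?mulr0 ?raddf0 // => l hl.
    by apply: beta_pos; rewrite ?hl.
  case: (boolP (active j)) => [aj|naj]; last first.
    rewrite mulr0 (mon_inactive naj) ?mulr0 ?raddf0 // => l hl.
    by apply: beta_pos; rewrite ?hl ?orbT.
  case: (eqVneq i i0) => [ei|ni]; case: (eqVneq j i0) => [ej|nj].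
  + by move: ij; rewrite ei ej ltnn.
  + by rewrite UV // ei.
  + by move: (lt0 i ai ni); rewrite -ej ltnNge (ltnW ij).
  + by have [] := VV i j ai aj ni nj ij.
- by move=> i /negPf->.
- move=> i ai; rewrite ai; case: (eqVneq i i0) => [->|ni].
    exists (@ordS _), (fun j => cst r' x j), (fun j => step r' (alpha i0) j); split.
    + exact: can_inj (@ordSK _).
    + by move=> j; exists (cst_inv r' y j); apply: cst_mul.
    + by move=> k j; rewrite mxE.
    + by move=> j l; apply: rexp_up.
  have [_ e] := hab' _ _ (lt0 i ai ni); have [e1 _] := hab' _ _ (lt0 i ai ni).
  exists (@ord_pred _), (fun j => b i0 i * cst_inv r' y (ord_pred j)),
    (fun j => (beta i0 i - step r' (alpha i0) (ord_pred j))%MM); split.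
  + exact: can_inj (@ord_predK _).
  + have [v hv] := ha i; move=> j.
    (* Since b_0i^(r'+1) = a_0 a_i and [y], [v] invert a_0, a_i, the product b_0i^r' y v inverts
       b_0i. *)
    exists (b i0 i ^+ r' * y * v * cst r' x (ord_pred j)).
    transitivity ((b i0 i ^+ r'.+1 * y * v) * (cst r' x (ord_pred j) * cst_inv r' y (ord_pred j))).
      by rewrite exprS; ring.
    by rewrite cst_mul // -e1 -/x mulr1 [x * a i]mulrC -!mulrA [x * _]mulrA xy mul1r.
  + by move=> k j; rewrite mxE.
  + by move=> j l; apply: rexp_down.
- by move=> j l; rewrite rexpE ltn_mod.
- move=> j l lZ; rewrite rexpE; move/forallP: a0 => /(_ l); rewrite lZ implybF -eqn0Ngt.
  by move=> /eqP->; rewrite muln0 mod0n.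
- by move=> j; right; exists i0; rewrite a0 eqxx; apply: shift_upX_delta0.
- move=> j l lZ; rewrite expoE; move/forallP: a0 => /(_ l); rewrite lZ implybF -eqn0Ngt.
  by move=> /eqP->; rewrite muln0 div0n.
- by [].
Qed.

Theorem monomial_action_ex : inhabited monomial_action.
Proof.
case: (pickP active) => [i hi|hi]; first exact: monomial_action_active hi.
by apply: monomial_action_inactive => i; rewrite hi.
Qed.

End MonomialAction.

(** * From commuting matrices to a module over R *)

Section ModuleOfAction.

Definition is_action (R : nzRingType) (A : zmodType) (act : R -> A -> A) :=
  [/\ forall a b v, act a (act b v) = act (a * b) v, forall v, act 1 v = v,
      forall a u v, act a (u + v) = act a u + act a v &
      forall v a b, act (a + b) v = act a v + act b v].

(** A new name for [A], indexed by the proof that [act] is an action, so that scaling by R cannot be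
    confused with the scaling that column vectors already carry. *)
Definition module_of_action (R : nzRingType) (A : zmodType) (act : R -> A -> A)
  (H : is_action act) : Type := A.

Variables (R : nzRingType) (A : zmodType) (act : R -> A -> A) (H : is_action act).

HB.instance Definition _ := GRing.Zmodule.copy (module_of_action H) A.

Fact module_of_actionA (a b : R) (v : module_of_action H) : act a (act b v) = act (a * b) v.
Proof. by case: H. Qed.
Fact module_of_action1 : left_id 1 (act : R -> module_of_action H -> module_of_action H).
Proof. by case: H. Qed.
Fact module_of_actionDr :
  right_distributive (act : R -> module_of_action H -> module_of_action H) +%R.
Proof. by case: H. Qed.
Fact module_of_actionDl (v : module_of_action H) :
  {morph (act : R -> module_of_action H -> module_of_action H)^~ v : a b / a + b}.
Proof. by have [_ _ _ h] := H => a b; apply: h. Qed.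

HB.instance Definition _ := GRing.Zmodule_isLmodule.Build R (module_of_action H)
  module_of_actionA module_of_action1 module_of_actionDr module_of_actionDl.

Lemma module_of_actionE (a : R) (v : module_of_action H) : a *: v = act a v.
Proof. by []. Qed.

End ModuleOfAction.

Section MatrixFiltration.
Variables (W : comNzRingType) (w : W) (d r' : nat).
Local Notation r := r'.+1.
Local Notation S' := (mpseries d W).

Definition mxfil k (M : 'M[S']_r) := forall i j, fil w k (M i j).

Lemma mxfilM k l M N : mxfil k M -> mxfil l N -> mxfil (k + l) (M * N).
Proof. by move=> hM hN i j; rewrite mxE; apply: fil_sum => t _; apply: filM. Qed.
Lemma mxfilX k M : mxfil 1 M -> mxfil k (M ^+ k).
Proof.
move=> h; elim: k => [|k IH]; first by move=> i j; apply: fil_0.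
by rewrite exprS -add1n; apply: mxfilM.
Qed.
Lemma mxfilW k l M : (l <= k)%N -> mxfil k M -> mxfil l M.
Proof. by move=> lk h i j; apply: filW (h i j). Qed.
Lemma mxfil_0 M : mxfil 0 M.
Proof. by move=> i j; apply: fil_0. Qed.

Hypothesis wsep : forall x, (forall k, wdiv w k x) -> x = 0.
Hypothesis wcomp : forall x : nat -> W, (forall k, wdiv w k (x k.+1 - x k)) ->
  exists l, forall k, wdiv w k (l - x k).

Theorem matrix_evaluation (n m : nat) (S : comNzRingType) (theta : {rmorphism S -> S'})
    (U : 'I_n -> 'M[S']_r) : (0 < m)%N ->
  (forall i j, U i * U j = U j * U i) -> (forall i, mxfil 1 (U i ^+ m)) ->
  exists ev : mpseries n S -> 'M[S']_r,
    [/\ forall f g, ev (f + g) = ev f + ev g, forall f g, ev (f * g) = ev f * ev g,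
        forall s, ev (mpsC n s) = (theta s)%:M & forall i, ev (mpsX S i) = U i].
Proof.
move=> m0 Ucomm Ufil.
pose t : {rmorphism S -> 'M[S']_r} := @scalar_mx S' r \o theta.
have tU s i : GRing.comm (t s) (U i).
  by rewrite /GRing.comm /t /= -[LHS]/(_ *m _) -[RHS]/(_ *m _) scalar_mxC.
(* In a monomial of degree at least m (n + 1) k, the remainders of the exponents modulo m account
   for at most m n of the degree, so it contains at least k factors [U i ^+ m], each of filtration
   1. *)
apply: (@evaluation n S _ t U Ucomm tU mxfil (m * n.+1)%N).
- by move=> k x y hx hy i j; rewrite mxE; apply: filD.
- by move=> k x hx i j; rewrite mxE; apply: filN.
- by move=> k i j; rewrite mxE; apply: fil0.
- by move=> k x y hy; rewrite -[k]add0n; apply: mxfilM => //; apply: mxfil_0.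
- by move=> k x y hx; rewrite -[k]addn0; apply: mxfilM => //; apply: mxfil_0.
- by move=> x h; apply/matrixP => i j; rewrite mxE; apply: (fil_sep wsep) => k; apply: h.
- move=> x hx.
  have ex i j : exists l, forall k, fil w k (l - x k i j).
    by apply: (fil_complete wcomp) => k; have := hx k i j; rewrite !mxE.
  have [l hl] := choice (fun ij => ex ij.1 ij.2).
  by exists (\matrix_(i, j) l (i, j)) => k i j; rewrite !mxE; apply: (hl (i, j)).
- move=> a k hk.
  have hs (s : seq 'I_n) : mxfil (\sum_(i <- s) (a i %/ m))%N (\prod_(i <- s) U i ^+ a i).
    elim: s => [|i s IH]; first by rewrite !big_nil; apply: mxfil_0.
    rewrite !big_cons; apply: mxfilM => //.
    rewrite {2}(divn_eq (a i) m) exprD mulnC exprM -[X in mxfil X _]addn0.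
    by apply: mxfilM; [apply: mxfilX | apply: mxfil_0].
  apply: mxfilW (hs _); have e : (mdeg a <= m * \sum_i (a i %/ m) + m * n)%N.
    have -> : (m * n = \sum_(i < n) m)%N by rewrite sum_nat_const card_ord mulnC.
    rewrite mdegE big_distrr -big_split; apply: leq_sum => i _ /=.
    by rewrite {1}(divn_eq (a i) m) mulnC leq_add2l ltnW // ltn_mod.
  case: k hk => [//|k] hk; have := leq_trans hk e.
  rewrite -mulnDr -mulnA leq_pmul2l // mulnS => h.
  have : (n * 1 <= n * k.+1)%N by rewrite leq_mul2l orbT.
  by move: h; set T := (\sum_i _)%N; set q := (n * k.+1)%N; lia.
Qed.

End MatrixFiltration.

Section RingAction.
Variables (S : comUnitRingType) (W : comNzRingType) (w : W) (d K n m : nat).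
Local Notation S' := (mpseries d W).
Variables (theta : {rmorphism S -> S'}) (ybar : 'I_K -> S).
Variables (a : 'I_n -> S) (b : 'I_n -> 'I_n -> S).
Variables (alpha : 'I_n -> 'X_{1..K}) (beta : 'I_n -> 'I_n -> 'X_{1..K}).
Variable Z : {set 'I_K}.
Local Notation eta := (fun l => theta (ybar l)).
Variable X : monomial_action m eta (fun i => theta (a i)) (fun i j => theta (b i j))
  alpha beta Z.
Variables (R : comUnitRingType) (phi : {rmorphism mpseries n S -> R}).

Lemma theta_mon gam : theta (mmap1 ybar gam) = mmap1 eta gam.
Proof. by rewrite rmorph_prod; apply: eq_bigr => l _; rewrite rmorphXn. Qed.

Hypothesis m0 : (0 < m)%N.
Hypothesis wsep : forall x, (forall k, wdiv w k x) -> x = 0.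
Hypothesis wcomp : forall x : nat -> W, (forall k, wdiv w k (x k.+1 - x k)) ->
  exists l, forall k, wdiv w k (l - x k).
Hypothesis eta_fil : forall l, fil w 1 (eta l).
Hypothesis alpha_neq0 : forall i, alpha i != 0%MM.
Hypothesis phi_surj : forall r, exists f, phi f = r.
Hypothesis phi_ker : forall f, phi f = 0 ->
  ideal_gen ([set mpsX S i ^+ m - mpsC n (a i * mmap1 ybar (alpha i)) | i in [set: 'I_n]]
     `|` [set g | exists i j : 'I_n, (i < j)%N /\
        g = mpsX S i * mpsX S j - mpsC n (b i j * mmap1 ybar (beta i j))]) f.

(** Evaluation at the matrices kills the binomials generating the kernel of phi, so an element of R
    may act through any preimage. *)
Theorem ring_action_ex : exists act : R -> 'cV[S']_(mr X).+1 -> 'cV[S']_(mr X).+1,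
  [/\ is_action act, forall s q, act (phi (mpsC n s)) q = theta s *: q &
      forall i q, act (phi (mpsX S i)) q = mU X i *m q].
Proof.
have mon_fil gam : gam != 0%MM -> fil w 1 (mmap1 eta gam).
  move=> /mnm_pos[l hl].
  rewrite /mmap1 (bigD1 l) //= -(prednK hl) exprS -mulrA -[1%N]addn0.
  by apply: filM => //; apply: fil_0.
have [|ev [evD evM evC evX]] := matrix_evaluation wsep wcomp theta m0 (@mU_comm _ _ _ _ _ _ _ _ _ _ X).
  move=> i j k; rewrite (mU_pow X) mxE; case: eqP => _; last exact: fil0.
  rewrite mulr1n -[1%N]add0n; apply: filM; [exact: fil_0 | exact/mon_fil/alpha_neq0].
have ev0 : ev 0 = 0 by apply: (addrI (ev 0)); rewrite -evD !addr0.
have evN f : ev (- f) = - ev f by apply: (addrI (ev f)); rewrite -evD !subrr.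
have ev1 : ev 1 = 1 by rewrite -(mpsC1 n S) evC rmorph1.
have evXn f k : ev (f ^+ k) = ev f ^+ k.
  by elim: k => [|k IH]; rewrite ?expr0 // !exprS evM IH.
have ker f : phi f = 0 -> ev f = 0.
  move=> /phi_ker; apply: (span_min (M := (mpseries n S)^o) (N := [set f | ev f = 0])).
    split=> // c x y /= hx hy.
    by rewrite evD hy addr0 -[c *: x]/(c * x) evM hx mulr0.
  move=> _ [[i _ <-]|[i [j [ij ->]]]] /=.
    rewrite evD evN evXn evX evC rmorphM theta_mon.
    by rewrite (mU_pow X) subrr.
  by rewrite evD evN evM !evX evC rmorphM theta_mon (mU_mul X ij) subrr.
have [s hs] := choice phi_surj.
have sE f : ev (s (phi f)) = ev f.
  by apply/eqP; rewrite -subr_eq0 -evN -evD; apply/eqP/ker; rewrite rmorphB hs subrr.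
exists (fun x q => ev (s x) *m q); split; first split.
- move=> x y v; rewrite mulmxA mulmxE -evM; congr (_ *m _).
  by rewrite -[RHS]sE -sE rmorphM !hs.
- by move=> v; rewrite -[1](rmorph1 phi) sE -(mpsC1 n S) evC rmorph1 mul1mx.
- by move=> x u v; rewrite mulmxDr.
- move=> v x y; rewrite -mulmxDl -evD; congr (_ *m _).
  by rewrite -[RHS]sE -sE rmorphD !hs.
- by move=> c q; rewrite sE evC mul_scalar_mx.
- by move=> i q; rewrite sE evX.
Qed.

End RingAction.

Section RegularOnModule.
Variables (S S' : comUnitRingType) (n r' : nat) (theta : {rmorphism S -> S'}).
Variables (R : comUnitRingType) (phi : {rmorphism mpseries n S -> R}).
Local Notation r := r'.+1.
Variables (act : R -> 'cV[S']_r -> 'cV[S']_r) (H : is_action act).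
Hypothesis actC : forall s q, act (phi (mpsC n s)) q = theta s *: q.
Hypothesis theta_surj : forall y, exists s, theta s = y.
Local Notation Q := (module_of_action H).

Lemma module_fg : finitely_generated (setT : set Q).
Proof.
exists [seq (delta_mx j 0 : Q) | j <- enum 'I_r].
apply/seteqP; split => // q _.
have [s hs] := choice theta_surj.
have -> : q = \sum_j phi (mpsC n (s ((q : 'cV[S']_r) j 0))) *: (delta_mx j 0 : Q).
  rewrite (_ : \sum_j _ = \sum_j ((q : 'cV[S']_r) j 0 *: delta_mx j 0 : 'cV[S']_r)).
    by apply/colP => k; rewrite summxE (bigD1 k) //= big1 ?mxE ?eqxx ?mulr1 ?addr0 // => l lk;
      rewrite !mxE eq_sym (negPf lk) mulr0.
  by apply: eq_bigr => j _; rewrite module_of_actionE actC hs.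
apply: subm_sum; first exact: span_sub.
move=> j _; apply: (submZ _ (span_sub _)).
by apply: sub_span; apply/mapP; exists j; rewrite ?mem_enum.
Qed.

(** The product T^r inside Q. Dividing by a scalar from S only changes T, so regularity on Q over R
    reduces to regularity on S' over itself. *)
Definition cvset (T : set S'^o) : set Q := [set q | forall j, T ((q : 'cV[S']_r) j 0)].

Lemma cvset_addx (T : set S'^o) x :
  addx (cvset T) (phi (mpsC n x)) = cvset (addx T (theta x)).
Proof.
apply/seteqP; split=> q.
  move=> /addx_ex[q1 [q2 [h1 ->]]] j.
  exists ((q1 : 'cV[S']_r) j 0); first exact: h1.
  exists ((q2 : 'cV[S']_r) j 0) => //.
  have -> : (q1 + phi (mpsC n x) *: q2 : Q) = (q1 : 'cV[S']_r) + theta x *: (q2 : 'cV[S']_r).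
    by rewrite module_of_actionE actC.
  by rewrite mxE addrAC subrr add0r mxE.
move=> h; have ex j : exists t, T ((q : 'cV[S']_r) j 0 - theta x * t).
  have [t [u [Tt e]]] := addx_ex (h j); exists u; rewrite e.
  by rewrite -[theta x *: u]/(theta x * u) addrK.
have [t ht] := choice ex; exists (q - phi (mpsC n x) *: ((\col_j t j) : Q)).
  move=> j; have := ht j.
  have -> : (q - phi (mpsC n x) *: (\col_j t j : Q) : Q) =
      (q : 'cV[S']_r) - theta x *: (\col_j t j) by rewrite module_of_actionE actC.
  by rewrite !mxE.
by exists (\col_j t j : Q) => //; rewrite opprB addrC subrK.
Qed.

Lemma cvset_reg (T : set S'^o) x : reg T (theta x) -> reg (cvset T) (phi (mpsC n x)).
Proof.
move=> h q hq j; apply: h; have := hq j.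
by rewrite module_of_actionE actC mxE.
Qed.

Lemma cvset_regs (T : set S'^o) (xs : seq S) : regs T [seq theta x | x <- xs] ->
  regs (cvset T) [seq phi (mpsC n x) | x <- xs].
Proof.
elim: xs T => [//|x xs IH] T /= [rx rxs]; split; first exact: cvset_reg.
by rewrite cvset_addx; apply: IH.
Qed.

Lemma cvset_foldl (T : set S'^o) (xs : seq S) :
  foldl (@addx R Q) (cvset T) [seq phi (mpsC n x) | x <- xs] =
  cvset (foldl (@addx S' S'^o) T [seq theta x | x <- xs]).
Proof. by elim: xs T => [//|x xs IH] T /=; rewrite cvset_addx IH. Qed.

Lemma cvset0 : cvset [set 0] = [set 0].
Proof.
apply/seteqP; split=> q; last by move=> -> j; rewrite mxE.
by move=> h; apply/colP => j; rewrite mxE; apply: h.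
Qed.

Lemma module_regular (xs : seq S) : regs (M := S'^o) [set 0] [seq theta x | x <- xs] ->
  ~ foldl (@addx S' S'^o) [set 0] [seq theta x | x <- xs] 1 ->
  regular_seq Q [seq phi (mpsC n x) | x <- xs] /\
  [set` [seq phi (mpsC n x) | x <- xs]] `<=` nonunits R.
Proof.
move=> hr hp; have nT : smul (ideal_gen [set` [seq phi (mpsC n x) | x <- xs]]) (setT : set Q) != setT.
  rewrite smul_gen_foldl -cvset0 cvset_foldl; apply/eqP => e; apply: hp.
  have : (setT : set Q) (const_mx 1) by [].
  by rewrite -e => /(_ ord0); rewrite mxE.
split; first by apply/regular_seqE; rewrite -{1}cvset0; split=> //; apply: cvset_regs.
move=> x xx; apply/negP => ux; case/eqP: nT; apply/seteqP; split=> // q _.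
rewrite -[q]scale1r; apply: smul_mem => //; rewrite -(mulVr ux).
apply: (idealMl _ (span_sub (M := R^o) _)); exact: (sub_span (M := R^o)).
Qed.

End RegularOnModule.

(** * The variables as a regular sequence *)

Section VariablesRegular.
Variables (W : comUnitRingType) (d : nat).
Local Notation S' := (mpseries d W).

(** The series whose coefficients lie in [I0] after the first i variables are set to 0. With [I0] =
    0 or (w), these are the successive ideals of the regular sequence. *)
Definition varset (I0 : set W) (i : nat) : set S'^o :=
  [set f | forall c : 'X_{1..d}, (forall j : 'I_d, (j < i)%N -> c j = 0%N) ->
     I0 (pscoef (f : S') c)].

Lemma varset_addx (I0 : set W) (i : 'I_d) : ideal I0 ->
  addx (varset I0 i) (mpsX W i : S') = varset I0 i.+1.
Proof.
move=> iI; apply/seteqP; split=> f.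
  move=> /addx_ex[f1 [f2 [h1 ->]]] c hc.
  have e0 : pscoef (mpsX W i * (f2 : S')) c = 0 by rewrite pscoefXM hc ?ltnS.
  have -> : pscoef (f1 + (mpsX W i : S') *: f2 : S'^o) c = pscoef (f1 : S') c.
    by rewrite -[LHS]/(pscoef (f1 : S') c + pscoef (mpsX W i * (f2 : S')) c) e0 addr0.
  by apply: h1 => j ji; apply: hc; apply: ltnW.
move=> h; pose f2 : S' := MPSeries (fun c => pscoef (f : S') (c + U_(i))%MM).
exists ((f : S') - mpsX W i * f2); last by exists f2 => //; rewrite opprB addrC subrK.
move=> c hc; rewrite pscoefB pscoefXM; case: posnP => ci.
  rewrite subr0; apply: h => j; rewrite ltnS leq_eqVlt => /orP[/eqP/val_inj->//|].
  exact: hc.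
by rewrite /= submK ?subrr ?lep1mP -?lt0n //; apply: (ideal0 iI).
Qed.

Lemma varset_reg (I0 : set W) (i : 'I_d) : reg (varset I0 i) (mpsX W i : S').
Proof.
move=> f h c hc; have := h (c + U_(i))%MM.
rewrite -[X in pscoef X]/(mpsX W i * (f : S')) pscoefXM mnmDE mnm1E eqxx addn1 /= addmK.
apply=> j ji; rewrite mnmDE hc // mnm1E; case: eqP => // e.
by move: ji; rewrite e ltnn.
Qed.

Lemma varset_regs (I0 : set W) (s : nat) (l : seq 'I_d) : ideal I0 ->
  map val l = iota s (d - s) -> regs (varset I0 s) [seq (mpsX W i : S') | i <- l] /\
  foldl (@addx S' S'^o) (varset I0 s) [seq (mpsX W i : S') | i <- l] = varset I0 (s + size l).
Proof.
move=> iI; elim: l s => [|i l IH] s /=; first by rewrite addn0.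
case e : (d - s)%N => [|t] //= [es el].
have [|h1 h2] := IH s.+1; first by rewrite el subnS e.
by rewrite -es varset_addx // es addnS -addSn; split=> //; split=> //; rewrite -es; apply: varset_reg.
Qed.

Lemma varset_full (I0 : set W) : ideal I0 -> ~ I0 1 -> ~ varset I0 d 1.
Proof.
by move=> iI n1 /(_ 0%MM) h; apply: n1; move: h; rewrite pscoef1 eqxx; apply=> j _; rewrite mnm0E.
Qed.

Lemma variables_regular : regs (M := S'^o) [set 0] [seq (mpsX W i : S') | i <- enum 'I_d] /\
  ~ foldl (@addx S' S'^o) [set 0] [seq (mpsX W i : S') | i <- enum 'I_d] 1.
Proof.
have e0 : varset [set 0] 0 = [set 0].
  apply/seteqP; split=> f; last by move=> -> c _.
  by move=> h; apply: mpseriesP => c; apply: h.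
have i0 : ideal ([set 0] : set W) by apply: (subm_zero W^o).
have [|h1 h2] := varset_regs (s := 0) (l := enum 'I_d) i0.
  by rewrite val_enum_ord subn0.
rewrite -e0; split=> //; rewrite h2 size_enum_ord add0n; apply: varset_full => //.
by move=> /= /eqP; rewrite oner_eq0.
Qed.

Lemma uniformizer_variables_regular (w : W) : (forall x, w * x = 0 -> x = 0) ->
  w \isn't a GRing.unit ->
  regs (M := S'^o) [set 0] (mpsC d w :: [seq (mpsX W i : S') | i <- enum 'I_d]) /\
  ~ foldl (@addx S' S'^o) [set 0] (mpsC d w :: [seq (mpsX W i : S') | i <- enum 'I_d]) 1.
Proof.
move=> rw nw; pose I0 : set W := [set w * x | x in setT].
have iI : ideal I0 by exact: (@scl_sub W W^o w).
have e : addx ([set 0] : set S'^o) (mpsC d w : S') = varset I0 0.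
  apply/seteqP; split=> f.
    move=> /addx_ex[_ [f2 [-> ->]]] c _; rewrite add0r.
    by rewrite -[X in pscoef X]/(mpsC d w * (f2 : S')) pscoefCM; exists (pscoef (f2 : S') c).
  move=> h; have ex c : exists x, w * x = pscoef (f : S') c.
    by have [|x _ <-] := h c => //; exists x.
  have [g hg] := choice ex; exists 0 => //; exists (MPSeries g : S') => //.
  rewrite subr0; apply: mpseriesP => c.
  by rewrite -[X in pscoef X]/(mpsC d w * (MPSeries g : S')) pscoefCM hg.
have [|h1 h2] := varset_regs (s := 0) (l := enum 'I_d) iI.
  by rewrite val_enum_ord subn0.
rewrite /= e; split; last first.
  rewrite h2 size_enum_ord add0n; apply: varset_full => // -[x _ wx].
  by case/negP: nw; apply/unitrPr; exists x.
split=> // f; rewrite -[w in mpsC d w]/w => h; apply: mpseriesP => c; apply: rw.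
have := congr1 (fun f : S' => pscoef f c) h.
by rewrite -[X in pscoef X]/(mpsC d w * (f : S')) pscoefCM.
Qed.

End VariablesRegular.

Lemma mmap1_factor (A : comNzRingType) K (h : 'I_K -> A) (gam : 'X_{1..K}) l :
  (0 < gam l)%N -> exists t, mmap1 h gam = h l * t.
Proof.
move=> hl; exists (h l ^+ (gam l).-1 * \prod_(i | i != l) h i ^+ gam i).
by rewrite /mmap1 (bigD1 l) // mulrA -exprS prednK.
Qed.

(** * Binomial rings *)

Section BinomialRing.
Variables (V : idomainType) (d n m K : nat) (ybar : 'I_K -> mpseries d V).
Local Notation S := (mpseries d V).
Local Notation P := (mpseries n S).
Variables (a : 'I_n -> S) (b : 'I_n -> 'I_n -> S).
Variables (alpha : 'I_n -> 'X_{1..K}) (beta : 'I_n -> 'I_n -> 'X_{1..K}).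
Variables (R : comUnitRingType) (phi : {rmorphism P -> R}).
Local Notation y_ l := (phi (mpsC n (ybar l))).
Local Notation mon := (mmap1 ybar).

Hypothesis hn : noetherian R.
Hypothesis hl : local R.
Hypothesis m0 : (0 < m)%N.
Hypothesis au : forall i, a i \is a GRing.unit.
Hypothesis bu : forall i j : 'I_n, (i < j)%N -> [/\ b i j \is a GRing.unit,
   a i * a j = b i j ^+ m & (alpha i + alpha j)%MM = (beta i j *+ m)%MM].
Hypothesis phi_surj : forall r, exists f, phi f = r.
Hypothesis phi_ker : forall f, phi f = 0 <->
  ideal_gen ([set mpsX S i ^+ m - mpsC n (a i * mon (alpha i)) | i in [set: 'I_n]]
     `|` [set g | exists i j : 'I_n, (i < j)%N /\
        g = mpsX S i * mpsX S j - mpsC n (b i j * mon (beta i j))]) f.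
Hypothesis Vlocal : local V.
Hypothesis ybar_nonunit : forall l, nonunits V (pscoef (ybar l) 0%MM).
Hypothesis ybar_gen : forall (J : set S) (s : S), ideal J -> (forall l, J (ybar l)) ->
  nonunits V (pscoef s 0%MM) -> J s.

Lemma mpsC_phiM (s t : S) : phi (mpsC n (s * t)) = phi (mpsC n s) * phi (mpsC n t).
Proof. by rewrite mpsCM rmorphM. Qed.
Lemma mpsC_phiD (s t : S) : phi (mpsC n (s + t)) = phi (mpsC n s) + phi (mpsC n t).
Proof. by rewrite mpsCD rmorphD. Qed.
Lemma mpsC_phiB (s t : S) : phi (mpsC n (s - t)) = phi (mpsC n s) - phi (mpsC n t).
Proof. by rewrite mpsCD mpsCN rmorphB. Qed.
Lemma mpsC_phiX (s : S) k : phi (mpsC n (s ^+ k)) = phi (mpsC n s) ^+ k.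
Proof. by rewrite mpsCX rmorphXn. Qed.
Lemma mpsC_phi_mon gam : phi (mpsC n (mon gam)) = mmap1 (fun l => y_ l) gam.
Proof.
rewrite /mmap1; elim: (index_enum _) => [|i s IH].
  by rewrite !big_nil rmorph1.
by rewrite !big_cons mpsC_phiM IH mpsC_phiX.
Qed.

Lemma phi_pow i : phi (mpsX S i) ^+ m = phi (mpsC n (a i * mon (alpha i))).
Proof.
apply/eqP; rewrite -subr_eq0 -rmorphXn -rmorphB; apply/eqP/phi_ker.
by apply: (sub_span (M := P^o)); left; exists i.
Qed.

Lemma phi_mul (i j : 'I_n) : (i < j)%N ->
  phi (mpsX S i) * phi (mpsX S j) = phi (mpsC n (b i j * mon (beta i j))).
Proof.
move=> ij; apply/eqP; rewrite -subr_eq0 -rmorphM -rmorphB; apply/eqP/phi_ker.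
by apply: (sub_span (M := P^o)); right; exists i, j.
Qed.

Lemma constC_unit (f : P) : pscoef (pscoef f 0%MM) 0%MM \is a GRing.unit ->
  f \is a GRing.unit.
Proof.
move=> u1; have /unitrPr[g hg] : pscoef f 0%MM \is a GRing.unit.
  by apply: (@mps_unitP _ _ _ (pscoef (pscoef f 0%MM) 0%MM)^-1); rewrite mulVr.
by apply: (@mps_unitP _ _ _ g); rewrite mulrC.
Qed.

(** Otherwise u_i^m - a_i would be a unit in the kernel of phi, and R would be zero. *)
Lemma alpha_neq0 i : alpha i != 0%MM.
Proof.
apply/eqP => e; have := phi_pow i; rewrite e mmap11 mulr1.
have : mpsX S i ^+ m - mpsC n (a i) \is a GRing.unit.
  apply: (@mps_unitP _ _ _ (- (a i)^-1)).
  rewrite pscoefB -(prednK m0) exprS pscoefXM mnm0E /= eqxx sub0r mulrNN.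
  exact: mulVr.
move=> /(rmorph_unit phi); rewrite rmorphB rmorphXn => u1 u2.
by move: u1; rewrite u2 subrr unitr0.
Qed.

Lemma beta_neq0 (i j : 'I_n) : (i < j)%N -> beta i j != 0%MM.
Proof.
move=> ij; have [_ _ e] := bu ij; apply/eqP => b0; have := alpha_neq0 i.
case/eqP; apply/mnmP => l; have /mnmP/(_ l) := e.
by rewrite mnmDE mulmnE b0 !mnm0E; lia.
Qed.

Lemma mon_nonunit gam : gam != 0%MM -> nonunits V (pscoef (mon gam) 0%MM).
Proof.
move=> /mnm_pos[l /(mmap1_factor ybar)[t ->]]; rewrite pscoefM0.
exact: (idealMr _ Vlocal).
Qed.

(** No alpha or beta is 0, so the kernel of phi consists of series with nonunit constant
    coefficient; an inverse of phi f0 would put 1 among them. *)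
Lemma phi_nonunit (f0 : P) : nonunits V (pscoef (pscoef f0 0%MM) 0%MM) ->
  nonunits R (phi f0).
Proof.
move=> hf0.
pose J : set P := [set f | nonunits V (pscoef (pscoef f 0%MM) 0%MM)].
have iJ : ideal J.
  split; first exact: (ideal0 Vlocal).
  move=> c f g hf hg; rewrite /J /=.
  change (nonunits V (pscoef (pscoef (c * f) 0%MM) 0%MM + pscoef (pscoef g 0%MM) 0%MM)).
  rewrite !pscoefM0.
  by apply: (idealD Vlocal) => //; apply: (idealMl _ Vlocal).
have JE f : J f = nonunits V (pscoef (pscoef f 0%MM) 0%MM) by [].
have kerJ f : phi f = 0 -> J f.
  move=> /phi_ker; apply: (span_min (M := P^o)) => // _ [[i _ <-]|[i [j [ij ->]]]];
    rewrite JE pscoefB.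
    rewrite -(prednK m0) exprS pscoefXM mnm0E ltnn pscoef0 pscoefC eqxx sub0r -mulN1r.
    apply: (idealMl _ Vlocal); rewrite pscoefM0; apply: (idealMl _ Vlocal).
    exact/mon_nonunit/alpha_neq0.
  rewrite pscoefXM mnm0E ltnn pscoef0 pscoefC eqxx sub0r -mulN1r.
  apply: (idealMl _ Vlocal); rewrite pscoefM0; apply: (idealMl _ Vlocal).
  exact/mon_nonunit/beta_neq0.
apply/negP => /unitrPr[r]; have [f <-] := phi_surj r.
rewrite -rmorphM => /eqP; rewrite -(rmorph1 phi) -subr_eq0 -rmorphB => /eqP /kerJ h.
have J1 : J 1.
  have -> : 1 = f0 * f - (f0 * f - 1) by rewrite opprB addrC subrK.
  by apply: (idealB iJ) => //; apply: (idealMr _ iJ).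
have e1 : pscoef (pscoef (1 : P) 0%MM) 0%MM = 1 by rewrite pscoef1 eqxx pscoef1 eqxx.
by move: J1; rewrite JE e1 /nonunits /= unitr1.
Qed.

Lemma phi_ybar_nonunit l : nonunits R (y_ l).
Proof. by apply: phi_nonunit; rewrite pscoefC eqxx. Qed.

(** A prime containing all entries of ybar contains each u_i^m, hence each u_i, hence the image of
    every series with nonunit constant coefficient. *)
Lemma prime_max q : prime_ideal q -> (forall l, q (y_ l)) -> nonunits R `<=` q.
Proof.
move=> pq qy r nr; have iq := prime_sub pq.
have [f ef] := phi_surj r; rewrite -ef.
have nf : nonunits V (pscoef (pscoef f 0%MM) 0%MM).
  by apply/negP => /constC_unit /(rmorph_unit phi); rewrite ef; apply/negP.
pose J : set S := [set s | q (phi (mpsC n s))].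
have iJ : ideal J.
  split; first by rewrite /J /= mpsC0 rmorph0; apply: ideal0.
  move=> c s t hs ht; rewrite /J /= -[X in mpsC _ X]/(c * s + t) mpsC_phiD mpsC_phiM.
  by apply: (idealD iq) => //; apply: (idealMl _ iq).
have qX i : q (phi (mpsX S i)).
  apply: (primeX (n := m) pq); rewrite phi_pow; apply: (idealMl _ iJ).
  rewrite /J /= mpsC_phi_mon.
  have [l /(mmap1_factor (fun l => y_ l))[t ->]] := mnm_pos (alpha_neq0 i).
  exact: (idealMr _ iq).
have [g [-> _]] := mps_split f.
rewrite rmorphD rmorph_sum; apply: (idealD iq).
  exact: (ybar_gen iJ qy nf).
apply: (subm_sum (M := R^o)) => // i _.
by rewrite rmorphM; apply: (idealMr _ iq).
Qed.

Hypothesis three : forall i0 i j : 'I_n, (i0 < i)%N -> (i < j)%N -> m = 2.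
Hypothesis V2 : m = 2 -> (2%:R : V) != 0.

(* The obstruction to solving u_i u_j = b_ij y^(beta_ij) in the quotient: it
   satisfies defect (defect + 2 a_i0 b_ij) = 0. *)
Definition defect (i0 i j : 'I_n) := b i0 i * b i0 j - a i0 * b i j.

(** The products x = b_0i b_0j and z = a_0 b_ij have the same square. V is a domain with 2 nonzero
    and x is a unit, so x - z and x + z cannot both have constant coefficient 0; the one that does
    not is regular in S, and the other vanishes. *)
Lemma defect_eq (i0 i j : 'I_n) : (i0 < i)%N -> (i < j)%N ->
  defect i0 i j = 0 \/ defect i0 i j = - (2%:R * (a i0 * b i j)).
Proof.
move=> i0i ij; have i0j := ltn_trans i0i ij; have m2 := three i0i ij.
have [u1 e1 _] := bu i0i; have [u2 e2 _] := bu i0j; have [u3 e3 _] := bu ij.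
set x := b i0 i * b i0 j; set z := a i0 * b i j.
have exz : x ^+ 2 = z ^+ 2.
  rewrite /x /z !exprMn; rewrite m2 in e1 e2 e3.
  by rewrite -e1 -e2 -e3; ring.
have e0 : (x - z) * (x + z) = 0 by rewrite -subr_sqr exz subrr.
have ux : x \is a GRing.unit by rewrite unitrM u1 u2.
have x0 : pscoef x 0%MM != 0.
  apply/eqP => hx; move: ux => /unitrPr[g /(congr1 (fun h => pscoef h 0%MM))/eqP].
  by rewrite pscoefM0 hx mul0r pscoef1 eqxx eq_sym oner_eq0.
have reg (f : S) : pscoef f 0%MM != 0 -> forall v, pscoef f 0%MM * v = 0 -> v = 0.
  by move=> nf v /eqP; rewrite mulf_eq0 (negPf nf) => /eqP.
have [hp|hp] := eqVneq (pscoef (x + z) 0%MM) 0; last first.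
  by left; apply: (mps_reg (reg _ hp)); rewrite mulrC.
right; have : x + z = 0.
  apply: (mps_reg (reg _ _) e0); rewrite pscoefB.
  have -> : pscoef z 0%MM = - pscoef x 0%MM.
    by apply/eqP; rewrite -addr_eq0 addrC -pscoefD hp.
  by rewrite opprK -mulr2n -mulr_natl mulf_neq0 ?V2.
rewrite /defect -/x -/z => exz'.
have -> : x = - z by apply/eqP; rewrite -addr_eq0 exz'.
by ring.
Qed.

(** The situation in which 2 becomes 0 once Z is killed, so that the sign does no harm: never over a
    field, and p = 2 with p in Z over a p-ring. *)
Variable two : {set 'I_K} -> Prop.

Definition consistent (Z : {set 'I_K}) := forall i0 i j : 'I_n,
  active alpha Z i0 -> active alpha Z i -> active alpha Z j ->
  (i0 < i)%N -> (i < j)%N -> defect i0 i j = 0 \/ two Z.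

Definition vanishing (q : set R) : {set 'I_K} := [set l | `[< q (y_ l) >]].

Hypothesis two_vanishing : m = 2 -> forall q, prime_ideal q -> q (phi (mpsC n 2%:R)) ->
  two (vanishing q).

(** Comparing (u_0 u_i)(u_0 u_j) with u_0^2 (u_i u_j) gives [defect] times a monomial equal to 0 in
    R. For active indices the monomial is outside q, so q contains the defect; a nonzero defect is 2
    times a unit, so q then contains 2. *)
Lemma vanishing_consistent q : prime_ideal q -> consistent (vanishing q).
Proof.
move=> pq i0 i j a0 ai aj i0i ij; have i0j := ltn_trans i0i ij.
have m2 := three i0i ij; have iq := prime_sub pq.
have [u1 e1 f1] := bu i0i; have [u2 e2 f2] := bu i0j; have [u3 e3 f3] := bu ij.
have nmon (gam : 'X_{1..K}) : (forall l, (0 < gam l)%N -> l \notin vanishing q) -> ~ q (phi (mpsC n (mon gam))).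
  move=> h; rewrite mpsC_phi_mon /mmap1; elim/big_ind: _ => [|x y hx hy|l _].
  - exact: prime1.
  - exact: primeM.
  - case e : (gam l) => [|k]; first by rewrite expr0; apply: prime1.
    move=> /(primeX pq) ql; have := h l; rewrite e inE => /(_ isT) /negP; apply.
    exact/asboolP.
have supp k : active alpha (vanishing q) k -> forall l, (0 < alpha k l)%N -> l \notin vanishing q.
  by move=> /forallP h l al; have := h l; rewrite al.
have key : phi (mpsC n (defect i0 i j * mon (alpha i0 + beta i j)%MM)) = 0.
  have h1 : phi (mpsX S i0) * phi (mpsX S i) * (phi (mpsX S i0) * phi (mpsX S j)) =
    phi (mpsX S i0) ^+ 2 * (phi (mpsX S i) * phi (mpsX S j)) by ring.
  move: h1; rewrite -[X in _ = _ ^+ X * _ -> _]m2 phi_pow !phi_mul // -!mpsC_phiM.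
  move=> h1; rewrite /defect mulrBl mpsC_phiB; apply/eqP; rewrite subr_eq0; apply/eqP.
  have em (g1 g2 : 'X_{1..K}) : mon (g1 + g2)%MM = mon g1 * mon g2 by apply: monD.
  have -> : (alpha i0 + beta i j)%MM = (beta i0 i + beta i0 j)%MM.
    apply/mnmP => l; move/mnmP/(_ l): f1; move/mnmP/(_ l): f2; move/mnmP/(_ l): f3.
    by rewrite !mulmnE !mnmDE m2; lia.
  transitivity (phi (mpsC n (b i0 i * mon (beta i0 i) * (b i0 j * mon (beta i0 j))))).
    by rewrite em; congr (phi (mpsC n _)); ring.
  rewrite h1.
  have -> : (beta i0 i + beta i0 j)%MM = (alpha i0 + beta i j)%MM.
    apply/mnmP => l; move/mnmP/(_ l): f1; move/mnmP/(_ l): f2; move/mnmP/(_ l): f3.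
    by rewrite !mulmnE !mnmDE m2; lia.
  by rewrite em; congr (phi (mpsC n _)); ring.
have [->|e] := defect_eq i0i ij; first by left.
right; apply: two_vanishing => //; move: key.
rewrite mpsC_phiM => key; have : q (phi (mpsC n (defect i0 i j))).
  case: (pq) => _ _ /(_ (phi (mpsC n (defect i0 i j))) (phi (mpsC n (mon (alpha i0 + beta i j)%MM)))).
  rewrite key => h; have [//|] := h (ideal0 iq).
  move=> /nmon -[l]; rewrite mnmDE addn_gt0 => /orP[/(supp _ a0)//|bl].
  have : (0 < alpha i l)%N || (0 < alpha j l)%N.
    by move/mnmP/(_ l): f3; rewrite mnmDE mulmnE m2; move: bl; lia.
  by case/orP => [/(supp _ ai)|/(supp _ aj)].
rewrite e -mulrN mpsC_phiM => h.
have : q (phi (mpsC n 2%:R)) \/ q (phi (mpsC n (- (a i0 * b i j)))).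
  by case: (pq) => _ _; apply.
case=> // /(prime_le_nonunits pq); rewrite /nonunits /= => /negP; case.
have /unitrPr[g hg] : - (a i0 * b i j) \is a GRing.unit by rewrite unitrN unitrM au u3.
by apply/unitrPr; exists (phi (mpsC n g)); rewrite -mpsC_phiM hg mpsC1 rmorph1.
Qed.

Lemma consistent_setT : consistent [set: 'I_K]%SET.
Proof.
move=> i0 i j /forallP h; case/eqP: (alpha_neq0 i0); apply/mnmP => l.
by have := h l; rewrite mnm0E inE implybF -eqn0Ngt => /eqP.
Qed.

Lemma maximal_consistent : exists2 Z, consistent Z &
  forall Z', consistent Z' -> (#|~: Z'| <= #|~: Z|)%N.
Proof.
have c0 : `[< consistent [set: 'I_K]%SET >] by apply/asboolP/consistent_setT.
have [Z /asboolP cZ hZ] := @arg_maxnP _ [set: 'I_K]%SET (fun Z => `[< consistent Z >])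
  (fun Z : {set 'I_K} => #|~: Z|) c0.
by exists Z => // Z' cZ'; apply: hZ; apply/asboolP.
Qed.

Section Construction.
Variables (Z : {set 'I_K}) (d' : nat) (W : comUnitRingType) (w : W).
Local Notation S' := (mpseries d' W).
Variables (theta : {rmorphism S -> S'}) (xs : seq S).
Hypothesis cZ : consistent Z.
Hypothesis maxZ : forall Z', consistent Z' -> (#|~: Z'| <= #|~: Z|)%N.
Hypothesis wsep : forall x, (forall k, wdiv w k x) -> x = 0.
Hypothesis wcomp : forall x : nat -> W, (forall k, wdiv w k (x k.+1 - x k)) ->
  exists l, forall k, wdiv w k (l - x k).
Hypothesis theta_surj : forall y, exists s, theta s = y.
Hypothesis theta_fil : forall l, fil w 1 (theta (ybar l)).
Hypothesis theta0 : forall l, l \in Z -> theta (ybar l) = 0.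
Hypothesis theta_reg : forall l, l \notin Z -> regular_elt (theta (ybar l)).
Hypothesis two0 : two Z -> (2%:R : S') = 0.
Hypothesis xs_size : size xs = #|~: Z|.
Hypothesis xs_reg : regs (M := S'^o) [set 0] [seq theta x | x <- xs].
Hypothesis xs_proper : ~ foldl (@addx S' S'^o) [set 0] [seq theta x | x <- xs] 1.

Theorem MCM_construction : exists
    (X : monomial_action m (fun l => theta (ybar l)) (fun i => theta (a i))
           (fun i j => theta (b i j)) alpha beta Z)
    (act : R -> 'cV[S']_(mr X).+1 -> 'cV[S']_(mr X).+1) (H : is_action act),
  [/\ forall s q, act (phi (mpsC n s)) q = theta s *: q,
      forall i q, act (phi (mpsX S i)) q = mU X i *m q,
      krull_dim R #|~: Z| & MCM (module_of_action H)].
Proof.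
have hcons (i0 i j : 'I_n) : active alpha Z i0 -> active alpha Z i -> active alpha Z j ->
    (i0 < i)%N -> (i < j)%N ->
    m = 2 /\ theta (b i0 i) * theta (b i0 j) = theta (a i0) * theta (b i j).
  move=> a0 ai aj i0i ij; split; first exact: three i0i ij.
  apply/eqP; rewrite -subr_eq0 -!rmorphM -rmorphB -/(defect i0 i j); apply/eqP.
  have [->|/two0 e2] := cZ a0 ai aj i0i ij; first exact: rmorph0.
  have [->|->] := defect_eq i0i ij; first exact: rmorph0.
  by rewrite rmorphN rmorphM rmorph_nat e2 mul0r oppr0.
have ha i : exists v, theta (a i) * v = 1.
  by exists (theta (a i)^-1); rewrite -rmorphM mulrV // rmorph1.
have hab (i j : 'I_n) : (i < j)%N -> theta (a i) * theta (a j) = theta (b i j) ^+ m /\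
    (alpha i + alpha j = beta i j *+ m)%MM.
  by move=> ij; have [_ e1 e2] := bu ij; rewrite -rmorphM e1 rmorphXn.
have [X] := monomial_action_ex m0 ha theta0 theta_reg hab hcons.
have [act [H hC hX]] := ring_action_ex X m0 wsep wcomp theta_fil alpha_neq0 phi_surj
  (fun f => (phi_ker f).1).
exists X, act, H.
have [rq nu] := module_regular H hC xs_reg xs_proper.
have fg := module_fg H hC theta_surj.
have [|dim mcm] := MCM_criterion hn hl fg nu rq.
  move=> q pq; exists [seq y_ l | l <- enum (~: vanishing q)]; split.
  - by rewrite !size_map -cardE xs_size; apply/maxZ/vanishing_consistent.
  - by move=> _ /mapP[l _ ->]; apply: phi_ybar_nonunit.
  move=> q' pq' qq' hz; apply: prime_max => // l.
  have [lv|lv] := boolP (l \in vanishing q).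
    by apply: qq'; move: lv; rewrite inE => /asboolP.
  by apply: hz; apply/mapP; exists l; rewrite // mem_enum finset.in_setC.
by split=> //; move: dim; rewrite size_map xs_size.
Qed.

End Construction.
End BinomialRing.

(** * Coefficient rings and the mixed characteristic case *)

Section Coefficients.

Lemma wdiv_field (W : fieldType) k (x : W) : wdiv 0 k.+1 x -> x = 0.
Proof. by move=> [y ->]; rewrite exprS !mul0r. Qed.

Lemma wdiv_field_sep (W : fieldType) (x : W) : (forall k, wdiv 0 k x) -> x = 0.
Proof. by move=> /(_ 1%N) /wdiv_field. Qed.

Lemma wdiv_field_complete (W : fieldType) (x : nat -> W) :
  (forall k, wdiv 0 k (x k.+1 - x k)) -> exists l, forall k, wdiv 0 k (l - x k).
Proof.
move=> h; have e k : x k.+1 = x 1%N.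
  by elim: k => [//|k <-]; apply/eqP; rewrite -subr_eq0; apply/eqP/(wdiv_field (h k.+1)).
exists (x 1%N) => -[|k]; first exact: wdiv_0.
by rewrite e subrr; apply: wdiv0.
Qed.

Lemma pring_nonunit p (V : idomainType) : complete_pring p V ->
  forall v : V, nonunits V v <-> exists v', v = p%:R * v'.
Proof.
move=> [_ _ _ _ ->] v; split.
  apply: (span_min (M := V^o) (N := [set v | exists v', v = p%:R * v'])).
    split; first by exists 0; rewrite mulr0.
    move=> a _ _ [x ->] [y ->]; exists (a * x + y).
    by rewrite mulrDr mulrCA.
  by move=> _ ->; exists 1; rewrite mulr1.
move=> [v' ->]; rewrite mulrC; apply: (idealMl _ (span_sub (M := V^o) _)).
exact: (sub_span (M := V^o)).
Qed.

Lemma pring_wdiv p (V : idomainType) : complete_pring p V ->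
  forall k (v : V), ideal_exp (nonunits V) k v <-> wdiv p%:R k v.
Proof.
move=> hV k v; have hp := pring_nonunit hV; split; last first.
  move=> [y ->]; elim: k => [//|k IH]; rewrite exprS -mulrA.
  by apply: (smul_mem (M := V^o)) => //; apply/hp; exists 1; rewrite mulr1.
elim: k v => [v _|k IH v]; first exact: wdiv_0.
apply: (smul_min (M := V^o) (K := [set v | wdiv p%:R k.+1 v])).
  split; first exact: wdiv0.
  move=> a x y hx hy; apply: wdivD => //.
  by rewrite -[a *: x]/(a * x) -[k.+1]add0n; apply: wdivM => //; apply: wdiv_0.
move=> a x /hp[a' ->] /IH hx; rewrite -[X in _ X]/(p%:R * a' * x) -[k.+1]add1n.
by apply: wdivM => //; exists a'; rewrite expr1.
Qed.

Lemma pring_sep p (V : idomainType) : complete_pring p V ->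
  forall x : V, (forall k, wdiv p%:R k x) -> x = 0.
Proof.
move=> hV x h; have [_ _ [sep _] _ _] := hV; apply: sep => k.
exact/(pring_wdiv hV).
Qed.

Lemma pring_complete p (V : idomainType) : complete_pring p V ->
  forall x : nat -> V, (forall k, wdiv p%:R k (x k.+1 - x k)) ->
  exists l, forall k, wdiv p%:R k (l - x k).
Proof.
move=> hV x h; have [_ _ [_ comp] _ _] := hV.
have [k|l hl] := comp x; first exact/(pring_wdiv hV).
by exists l => k; apply/(pring_wdiv hV).
Qed.

Lemma pring_p_neq0 p (V : idomainType) : complete_pring p V -> (p%:R : V) != 0.
Proof.
move=> hV; have [_ [_ [x nx hx] _] _ _ _] := hV.
have /(pring_nonunit hV)[y e] := hx.
by apply: contra nx => /eqP p0; rewrite e p0 mul0r.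
Qed.

(** If 2 were 0, every integer would be 0 or 1 in V, and none would be a nonzero nonunit. *)
Lemma pring_two_neq0 p (V : idomainType) : complete_pring p V -> (2%:R : V) != 0.
Proof.
move=> [_ _ _ [q [nq q0]] _]; apply/eqP => e2.
have e : (q%:R : V) = (odd q)%:R.
  by rewrite -{1}(odd_double_half q) natrD -muln2 natrM e2 mulr0 addr0.
move: nq q0; rewrite e; case: (odd q); last by rewrite eqxx.
by rewrite /nonunits /= unitr1.
Qed.

Lemma pring_two_unit p (V : idomainType) : complete_pring p V -> p != 2 ->
  (2%:R : V) \is a GRing.unit.
Proof.
move=> hV np2; have [pp [hl _ _] _ _ _] := hV; apply: contrapT => /negP n2.
have op : odd p by case: (even_prime pp) np2 => [->|].
have hp : nonunits V p%:R by apply/(pring_nonunit hV); exists 1; rewrite mulr1.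
have : nonunits V 1.
  have -> : 1 = p%:R - 2%:R * (p./2)%:R :> V.
    rewrite -{1}(odd_double_half p) op natrD -muln2 natrM [2%:R * _]mulrC addrK.
    by [].
  by apply: (idealB hl) => //; apply: (idealMr _ hl).
by rewrite /nonunits /= unitr1.
Qed.

Lemma residue_kernel (R : comUnitRingType) (k : fieldType) (pi : {rmorphism R -> k}) :
  local R -> (forall y, exists x, pi x = y) -> forall r, nonunits R r -> pi r = 0.
Proof.
move=> hl hs r nr; apply/eqP; apply: contraT => nz.
have [s es] := hs (pi r)^-1.
have u : 1 - r * s \is a GRing.unit.
  apply: contrapT => /negP nu; have : nonunits R 1.
    by rewrite -(subrK (r * s) 1); apply: (idealD hl) => //; apply: (idealMr _ hl).
  by rewrite /nonunits /= unitr1.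
have := rmorph_unit pi u; rewrite rmorphB rmorph1 rmorphM es divff // subrr.
by rewrite unitr0.
Qed.

End Coefficients.

Section EnumComplement.
Variables (d : nat) (A : {set 'I_d}) (V W : comUnitRingType) (iota : {rmorphism V -> W}).
Local Notation g := (@enum_val _ (mem A)).

Lemma codom_enum_val l : (l \in codom g) = (l \in A).
Proof.
apply/codomP/idP => [[j ->]|lA]; first exact: enum_valP.
by exists (enum_rank_in lA l); rewrite enum_rankK_in.
Qed.

Lemma restrict_ex : exists theta : {rmorphism mpseries d V -> mpseries #|A| W},
  [/\ forall j, theta (mpsX V (g j)) = mpsX W j,
      forall l, l \notin A -> theta (mpsX V l) = 0,
      forall v, theta (mpsC d v) = mpsC #|A| (iota v) &
      (forall y, exists x, iota x = y) -> forall y, exists s, theta s = y].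
Proof.
have [t ht] := restrict_rmorphism iota (@enum_val_inj _ A).
exists t; split=> [j|l hl|v|hi y].
- by rewrite ht restrictX //; apply: enum_val_inj.
- by rewrite ht restrictX0 // codom_enum_val.
- by rewrite ht restrictC //; apply: enum_val_inj.
- by have [s <-] := restrict_surj (@enum_val_inj _ A) hi y; exists s.
Qed.

End EnumComplement.

Lemma mpsC_rmorphism n (A : comNzRingType) :
  exists c : {rmorphism A -> mpseries n A}, c =1 mpsC n (A := A).
Proof.
have cB : {morph mpsC n (A := A) : x y / x - y}.
  by move=> x y; rewrite mpsCD mpsCN.
have m1 : GRing.monoid_morphism (mpsC n (A := A)) by split=> //; apply: mpsCM.
pose t : {rmorphism A -> mpseries n A} :=
  HB.pack (mpsC n (A := A)) (GRing.isZmodMorphism.Build _ _ (mpsC n (A := A)) cB)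
    (GRing.isMonoidMorphism.Build _ _ (mpsC n (A := A)) m1).
by exists t.
Qed.

Lemma mpsX_regular (W : comNzRingType) d (i : 'I_d) : regular_elt (mpsX W i).
Proof.
move=> s e; apply: mpseriesP => c; have := congr1 (fun f => pscoef f (c + U_(i))%MM) e.
by rewrite pscoefXM mnmDE mnm1E eqxx addn1 /= addmK.
Qed.

Lemma three_indices (n m : nat) : ((2 <= n)%N /\ m = 2%N) \/ (n = 2%N /\ odd m) ->
  forall i0 i j : 'I_n, (i0 < i)%N -> (i < j)%N -> m = 2.
Proof.
case=> [[]//|[e _]] i0 i j h1 h2; have jn := ltn_ord j.
have : (j < 2)%N by rewrite -e.
by move: h1 h2; case: (i0 : nat) (i : nat) (j : nat) => [|?] [|[|?]] [|[|?]].
Qed.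

Lemma m_pos (n m : nat) : ((2 <= n)%N /\ m = 2%N) \/ (n = 2%N /\ odd m) -> (0 < m)%N.
Proof. by case=> [[_ ->]|[_]] //; case: m. Qed.

Theorem mixed_MCM (d n m : nat)
    (hnm : ((2 <= n)%N /\ m = 2%N) \/ (n = 2%N /\ odd m))
    (R : comUnitRingType) (hR : analytic R) (p : nat) (V : idomainType) :
  complete_pring p V -> T_family_pring p V d n m R -> exists Q : lmodType R, MCM Q.
Proof.
move=> hV [a [b [alpha [beta [au bu [phi [phi_surj phi_ker]]]]]]].
have [hn hl _ [kappa [pi [pi_surj _ _]]] _] := hR.
have m0 := m_pos hnm; have three := three_indices hnm.
pose ybar (i : 'I_d.+1) : mpseries d V :=
  if unlift ord0 i is Some j then mpsX V j else p%:R.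
have ybar0 : ybar ord0 = p%:R by rewrite /ybar unlift_none.
have ybarS j : ybar (lift ord0 j) = mpsX V j by rewrite /ybar liftK.
have natC q : (q%:R : mpseries d V) = mpsC d q%:R.
  by elim: q => [|q IH]; rewrite ?mpsC0 // -!natr1 mpsCD -IH.
have [pp [Vlocal _ _] _ _ _] := hV; have Vp := pring_nonunit hV.
have np : nonunits V p%:R by apply/Vp; exists 1; rewrite mulr1.
have ybar_nonunit l : nonunits V (pscoef (ybar l) 0%MM).
  have [j ->|->] := unliftP ord0 l; last by rewrite ybar0 natC pscoefC eqxx.
  by rewrite ybarS pscoefX (eq_sym 0%MM) mnm1_eq0; apply: (ideal0 Vlocal).
have ybar_gen (J : set (mpseries d V)) s : ideal J -> (forall l, J (ybar l)) ->
    nonunits V (pscoef s 0%MM) -> J s.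
  move=> iJ hJ /Vp[v e]; have [g [-> _]] := mps_split s; apply: (idealD iJ).
    by rewrite e mpsCM -natC -ybar0; apply: (idealMr _ iJ).
  apply: (subm_sum (M := (mpseries d V)^o)) => // i _.
  by rewrite -ybarS; apply: (idealMr _ iJ).
have V2 : m = 2 -> (2%:R : V) != 0 by move=> _; apply: pring_two_neq0 hV.
pose two (Z : {set 'I_d.+1}) := p = 2 /\ ord0 \in Z.
have two_vanishing : m = 2 -> forall q, prime_ideal q -> q (phi (mpsC n 2%:R)) ->
    two (vanishing ybar phi q).
  move=> _ q pq q2; have [p2|np2] := eqVneq p 2.
    by split=> //; rewrite inE; apply/asboolP; rewrite ybar0 p2.
  case/negP: (prime_le_nonunits pq q2); apply: rmorph_unit.
  apply: constC_unit; rewrite pscoefC eqxx natC pscoefC eqxx.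
  exact: pring_two_unit hV np2.
have [Z cZ maxZ] := maximal_consistent m0 au phi_ker two.
pose A : {set 'I_d} := [set l | lift ord0 l \notin Z]%SET.
have cardZ : #|~: Z| = ((ord0 \notin Z) + #|A|)%N.
  rewrite -!sum1_card big_mkcond big_ord_recl finset.in_setC; congr (_ + _)%N.
  by rewrite [RHS]big_mkcond; apply: eq_bigr => i _; rewrite !inE.
have inA j : j \in A -> exists i : 'I_#|A|, j = enum_val i.
  by move=> jA; exists (enum_rank_in jA j); rewrite enum_rankK_in.
pose xs := [seq mpsX V (enum_val i) | i <- enum 'I_#|A|].
have [Z0|nZ0] := boolP (ord0 \in Z).
  have [c1 hc1] := mpsC_rmorphism d V; have [c2 hc2] := mpsC_rmorphism n (mpseries d V).
  (* The residue field of R is also that of V: phi f differs from the image of the constant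
     coefficient of f by a nonunit, so the composite from V is onto. *)
  pose iota : {rmorphism V -> kappa} := pi \o phi \o c2 \o c1.
  have iotaE v : iota v = pi (phi (mpsC n (mpsC d v))) by rewrite /= hc2 hc1.
  have nonunit0 f : nonunits V (pscoef (pscoef f 0%MM) 0%MM) -> pi (phi f) = 0.
    move=> hf; apply: (residue_kernel hl pi_surj).
    exact: (phi_nonunit m0 au bu phi_surj phi_ker Vlocal ybar_nonunit hf).
  have iota_surj y : exists x, iota x = y.
    have [r <-] := pi_surj y; have [f <-] := phi_surj r.
    exists (pscoef (pscoef f 0%MM) 0%MM); rewrite iotaE; apply/eqP.
    rewrite -subr_eq0 -!rmorphB; apply/eqP/nonunit0.
    set v := pscoef (pscoef f 0%MM) 0%MM.
    change (nonunits V (pscoef (pscoef (mpsC n (mpsC d v)) 0%MM) 0%MM - v)).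
    by rewrite pscoefC eqxx pscoefC eqxx subrr; apply: (ideal0 Vlocal).
  have [theta [thX thX0 thC /(_ iota_surj) th_surj]] := restrict_ex A iota.
  have thp : theta p%:R = 0.
    rewrite natC thC iotaE nonunit0 ?mpsC0 //.
    by rewrite pscoefC eqxx pscoefC eqxx.
  have [|||||||X [act [H [_ _ _ hM]]]] := @MCM_construction V d n m d.+1 ybar a b alpha beta R phi
    hn hl m0 au bu phi_surj phi_ker Vlocal ybar_nonunit ybar_gen three V2 two two_vanishing
    Z #|A| kappa 0 theta xs cZ maxZ (@wdiv_field_sep kappa) (@wdiv_field_complete kappa) th_surj.
  - move=> l; have [j ->|->] := unliftP ord0 l; last by rewrite ybar0 thp; apply: fil0.
    rewrite ybarS; have [/inA[i ->]|jA] := boolP (j \in A); last by rewrite thX0 //; apply: fil0.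
    by rewrite thX; apply: filX.
  - move=> l; have [j ->|->] := unliftP ord0 l; last by rewrite ybar0 thp.
    by move=> jZ; rewrite ybarS thX0 // inE negbK.
  - move=> l; have [j ->|->] := unliftP ord0 l; last by rewrite Z0.
    move=> jZ; have /inA[i ->] : j \in A by rewrite inE.
    by rewrite ybarS thX; apply: mpsX_regular.
  - by move=> [p2 _]; have := thp; rewrite p2 rmorph_nat.
  - by rewrite size_map size_enum_ord cardZ Z0.
  - by rewrite -map_comp (eq_map (g := fun i => mpsX kappa i)) //; case: (variables_regular kappa #|A|).
  - by rewrite -map_comp (eq_map (g := fun i => mpsX kappa i)) //; case: (variables_regular kappa #|A|).
  by exists (module_of_action H).
(* Here p survives: the coefficients stay in V, the filtration uses w = p, and p becomes the first
   member of the regular sequence. *)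
have [theta [thX thX0 thC th_surj]] := restrict_ex A (idfun : {rmorphism V -> V}).
have {}th_surj := th_surj (fun y => ex_intro _ y erefl).
have thp : theta p%:R = mpsC #|A| p%:R by rewrite natC thC.
have preg (x : V) : p%:R * x = 0 -> x = 0.
  by move=> /eqP; rewrite mulf_eq0 (negPf (pring_p_neq0 hV)) => /eqP.
have [hreg hprop] := uniformizer_variables_regular #|A| preg np.
have mapE : [seq theta x | x <- p%:R :: xs] = mpsC #|A| p%:R :: [seq mpsX V i | i <- enum 'I_#|A|].
  by rewrite /= thp -map_comp; congr (_ :: _); apply: eq_map => i /=; rewrite thX.
have [|||||||X [act [H [_ _ _ hM]]]] := @MCM_construction V d n m d.+1 ybar a b alpha beta R phi
  hn hl m0 au bu phi_surj phi_ker Vlocal ybar_nonunit ybar_gen three V2 two two_vanishing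
  Z #|A| V p%:R theta (p%:R :: xs) cZ maxZ (pring_sep hV) (pring_complete hV) th_surj.
- move=> l; have [j ->|->] := unliftP ord0 l; last by rewrite ybar0 thp; apply: filC.
  rewrite ybarS; have [/inA[i ->]|jA] := boolP (j \in A); last by rewrite thX0 //; apply: fil0.
  by rewrite thX; apply: filX.
- move=> l; have [j ->|->] := unliftP ord0 l; last by move=> h; rewrite h in nZ0.
  by move=> jZ; rewrite ybarS thX0 // inE negbK.
- move=> l; have [j ->|->] := unliftP ord0 l.
    move=> jZ; have /inA[i ->] : j \in A by rewrite inE.
    by rewrite ybarS thX; apply: mpsX_regular.
  move=> _ s; rewrite ybar0 thp => e; apply: mpseriesP => c; apply: preg.
  by have := congr1 (fun f => pscoef f c) e; rewrite pscoefCM.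
- by move=> [_ h]; rewrite h in nZ0.
- by rewrite /= size_map size_enum_ord cardZ nZ0.
- by rewrite mapE.
- by rewrite mapE.
by exists (module_of_action H).
Qed.

(** * Multiplicity *)

Section MonomialAsymptotics.

Lemma nmonE k t : nmon k t.+1 = 'C(k + t, k).
Proof.
rewrite -card_partial_ord_partitions -size_mon_lt cardE.
pose f (u : k.-tuple 'I_t.+1) : 'X_{1..k} := [multinom (tnth u i : nat) | i < k].
have fdeg u : mdeg (f u) = (\sum_(i <- u) i)%N.
  by rewrite mdegE big_tuple; apply: eq_bigr => i _; rewrite mnmE.
rewrite -(size_map f); apply: perm_size; apply: uniq_perm; first exact: mon_lt_uniq.
  rewrite map_inj_uniq ?enum_uniq // => u v /mnmP e; apply: eq_from_tnth => i.
  by apply: val_inj; have := e i; rewrite !mnmE.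
move=> b; rewrite mem_mon_lt ltnS; apply/idP/mapP => [hb|[u]]; last first.
  by rewrite mem_enum inE -fdeg => h ->.
have eb : b = f [tuple inord (b i) | i < k].
  apply/mnmP => i; rewrite mnmE tnth_mktuple inordK // ltnS.
  apply: leq_trans hb; rewrite mdegE (bigD1 i) //=; exact: leq_addr.
by exists [tuple inord (b i) | i < k]; rewrite // mem_enum inE -fdeg -eb.
Qed.

Lemma ffact_bounds a k : (a.+1 ^ k <= (k + a) ^_ k <= (k + a) ^ k)%N.
Proof.
elim: k => [|k /andP[IH1 IH2]]; first by rewrite ffactn0.
rewrite addSn ffactSS !expnS; apply/andP; split; apply: leq_mul => //.
  by rewrite ltnS leq_addl.
by apply: (leq_trans IH2); case: (k) => // k'; rewrite leq_exp2r //.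
Qed.

Lemma nmon_ge k t : (0 < t)%N -> (t ^ k <= k`! * nmon k t)%N.
Proof.
by case: t => // t _; rewrite nmonE mulnC bin_ffact; case/andP: (ffact_bounds t k).
Qed.

Lemma nmon_le k t : (k`! * nmon k t <= (t + k) ^ k)%N.
Proof.
case: t => [|t]; first by rewrite nmon0 muln0.
rewrite nmonE mulnC bin_ffact; case/andP: (ffact_bounds t k) => _ h.
apply: (leq_trans h); case: k {h} => // k; rewrite leq_exp2r //; lia.
Qed.

(** The estimate (t + C)^d <= t^d (1 + B / t), cleared of denominators so that the asymptotics stay
    within the natural numbers. *)
Lemma pow_shift_up C d : exists B, forall t, ((t + C) ^ d * t <= t ^ d * (t + B))%N.
Proof.
elim: d => [|d [B IH]]; first by exists 0%N => t; rewrite !expn0 addn0.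
(* For t >= 1, (t + C)(t + B) <= t (t + B + C + B C). *)
exists (B + C + B * C)%N => -[|t]; first by rewrite muln0.
rewrite !expnS -mulnA; apply: (leq_trans (leq_mul (leqnn _) (IH _))).
rewrite mulnCA [(t.+1 * _)%N]mulnC -mulnA leq_mul //; nia.
Qed.

Lemma pow_shift_down C d : exists B, forall t, (t ^ d * (t - B) <= (t - C) ^ d * t)%N.
Proof.
elim: d => [|d [B IH]]; first by exists 0%N => t; rewrite !expn0 subn0.
exists (B + C)%N => t; rewrite !expnS -[((t - C) * _ * _)%N]mulnA.
apply: leq_trans (leq_mul (leqnn _) (IH t)).
rewrite mulnCA [(t * _ ^ _)%N]mulnC -mulnA leq_mul //.
case: (leqP (B + C) t) => h; last by rewrite (eqP (ltnW h : (t - (B + C) == 0)%N)) muln0.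
nia.
Qed.

Lemma leq_pow k a b : (a <= b)%N -> (a ^ k <= b ^ k)%N.
Proof. by case: k => // k ab; rewrite leq_exp2r. Qed.

Section SumCounts.
Variables (k : nat) (I : finType) (J : pred I) (rho : I -> nat).

(** The sum grows like #J t^k / k!; the shifts C and rho only change lower order terms, which B
    absorbs. *)
Lemma sum_nmon_le C : exists B, forall t,
  (k`! * (\sum_(j | J j) nmon k (t + C - rho j)) * t <= #|J| * (t ^ k * (t + B)))%N.
Proof.
have [B hB] := pow_shift_up (C + k) k; exists B => t.
rewrite big_distrr big_distrl -sum_nat_const /=.
apply: leq_sum => j _; apply: leq_trans (hB t); rewrite leq_mul //.
by apply: (leq_trans (nmon_le _ _)); apply: leq_pow; lia.
Qed.

Lemma sum_nmon_ge : exists B, forall t,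
  (#|J| * (t ^ k * (t - B)) <= k`! * (\sum_(j | J j) nmon k (t - rho j)) * t)%N.
Proof.
pose C := (\sum_j rho j)%N; have [B hB] := pow_shift_down C k; exists (B + C)%N => t.
have [tC|tC] := leqP t C.
  by rewrite (eqP (_ : t - (B + C) == 0)%N) ?muln0 //; lia.
rewrite big_distrr big_distrl -sum_nat_const /=; apply: leq_sum => j _.
have jC : (rho j <= C)%N by rewrite /C (bigD1 j) //= leq_addr.
apply: (@leq_trans (t ^ k * (t - B))); first by rewrite leq_mul //; lia.
apply: (leq_trans (hB t)); rewrite leq_mul //.
apply: leq_trans (@nmon_ge k (t - rho j) _); last by lia.
by apply: leq_pow; lia.
Qed.

End SumCounts.

Lemma leading_coef_le k e l B B' : (forall t, e * (t ^ k * (t - B)) <= l * (t ^ k * (t + B')))%N ->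
  (e <= l)%N.
Proof.
move=> h; rewrite leqNgt; apply/negP => le.
(* If e >= l + 1, cancelling t^k leaves t <= (l + 1) B + l B', which this t violates. *)
have := h (l.+1 * B + l * B').+1; set t := (_).+1; rewrite mulnCA [(l * _)%N]mulnCA.
rewrite leq_pmul2l ?expn_gt0 // => h'.
have : (l.+1 * (t - B) <= l * (t + B'))%N by apply: leq_trans h'; rewrite leq_mul.
rewrite /t; nia.
Qed.

(** The two bounds place a / t^k within e B / t of e, so N only has to exceed e B / eps. *)
Lemma leading_coef_limit k e B (eps : rat) : 0 < eps -> exists N, forall t, (N <= t)%N ->
  forall a, (e * (t ^ k * (t - B)) <= a * t)%N -> (a * t <= e * (t ^ k * (t + B)))%N ->
  `|a%:R / t%:R ^+ k - e%:R| < eps.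
Proof.
move=> eps0; have [N hN] : exists N : nat, (e * B)%:R / eps < N%:R.
  exists (Num.bound ((e * B)%:R / eps)); apply: archi_boundP.
  by rewrite divr_ge0 ?ler0n ?ltW.
exists N => t Nt a h1 h2.
have lt : (e * B)%:R < eps * t%:R :> rat.
  by rewrite mulrC -ltr_pdivrMr //; apply: (lt_le_trans hN); rewrite ler_nat.
have t0 : 0 < t%:R :> rat.
  by rewrite -(pmulr_rgt0 _ eps0); apply: le_lt_trans lt; rewrite ler0n.
have Y0 : 0 < t%:R ^+ k :> rat by rewrite exprn_gt0.
have h3 : (e * (t ^ k * t) <= a * t + e * B * t ^ k)%N.
  apply: leq_trans (leq_add h1 (leqnn _)).
  by rewrite -[(e * B * _)%N]mulnA -mulnDr [(B * _)%N]mulnC -mulnDr !leq_mul //; lia.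
have : (a%:R * t%:R : rat) <= e%:R * (t%:R ^+ k * (t%:R + B%:R)).
  by rewrite -natrX -natrD -!natrM ler_nat.
have : (e%:R * (t%:R ^+ k * t%:R) : rat) <= a%:R * t%:R + (e * B)%:R * t%:R ^+ k.
  by rewrite -natrX -!natrM -natrD ler_nat.
move: lt t0 Y0; rewrite natrM; set X := t%:R; set Y := X ^+ k; set A : rat := a%:R.
move: (e%:R : rat) (B%:R : rat) => E F lt X0 Y0 h5 h4.
have XY0 : 0 < X * Y by apply: mulr_gt0.
have -> : A / Y - E = (A * X - E * (Y * X)) / (X * Y).
  by field; rewrite !gt_eqF.
rewrite ltr_norml ltr_pdivrMr // ltr_pdivlMr //.
have : E * F * Y < eps * X * Y by rewrite ltr_pM2r.
by move=> h6; apply/andP; split; lra.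
Qed.

End MonomialAsymptotics.

Section MonomialCounts.
Variable k : nat.
Implicit Types (P : pred 'X_{1..k}) (e c : 'X_{1..k}).

(** Translation by e is the bijection; B and B' only provide finite boxes that contain all exponents
    counted. *)
Lemma count_shift e P B B' : (forall c, P c -> (mdeg c < B)%N) ->
  (forall c, P (c + e)%MM -> (mdeg c < B')%N) ->
  count (fun c => (e <= c)%MM && P c) (mon_lt k B) = count (fun c => P (c + e)%MM) (mon_lt k B').
Proof.
move=> hB hB'; rewrite -!size_filter -(size_map (fun c => (c + e)%MM) [seq _ <- mon_lt k B' | _]).
apply: perm_size; apply: uniq_perm.
- by rewrite filter_uniq ?mon_lt_uniq.
- by rewrite map_inj_uniq ?filter_uniq ?mon_lt_uniq //; apply: addIm.
move=> c; rewrite mem_filter mem_mon_lt; apply/idP/mapP => [/andP[/andP[ec Pc] _]|[c' + ->]].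
  exists (c - e)%MM; rewrite ?submK // mem_filter mem_mon_lt submK // Pc.
  by rewrite hB' // submK.
by rewrite mem_filter => /andP[Pc _]; rewrite Pc lem_addl hB.
Qed.

Lemma count_mdeg B t rho : (t <= B)%N ->
  count (fun c => (mdeg c + rho < t)%N) (mon_lt k B) = nmon k (t - rho).
Proof.
move=> tB; rewrite -size_mon_lt -size_filter; apply: perm_size; apply: uniq_perm.
- by rewrite filter_uniq ?mon_lt_uniq.
- exact: mon_lt_uniq.
move=> c; rewrite mem_filter !mem_mon_lt; apply/andP/idP; lia.
Qed.

End MonomialCounts.

Section MonomialSeries.
Variables (A : comNzRingType) (k : nat).
Local Notation S' := (mpseries k A).

Definition mX (c : 'X_{1..k}) : S' := MPSeries (fun a => if a == c then 1 else 0).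

Lemma pscoef_mX c a : pscoef (mX c) a = if a == c then 1 else 0.
Proof. by []. Qed.

Lemma pscoef_mXM c f a : pscoef (mX c * f) a = if (c <= a)%MM then pscoef f (a - c)%MM else 0.
Proof.
rewrite pscoefM; case: ifP => ca.
  rewrite (bigD1_seq c) ?lows_uniq ?mem_lows //= eqxx mul1r big1 ?addr0 // => b nb.
  by rewrite (negPf nb) mul0r.
rewrite big1_seq // => b; rewrite mem_lows pscoef_mX => /= ba.
case: eqP => [e|_]; last by rewrite mul0r.
by rewrite -e ba in ca.
Qed.

Lemma mX0 : mX 0%MM = 1.
Proof. by []. Qed.
Lemma mXU i : mX U_(i)%MM = mpsX A i.
Proof. by []. Qed.
Lemma mXD c c' : mX (c + c')%MM = mX c * mX c'.
Proof.
apply: mpseriesP => a; rewrite pscoef_mXM !pscoef_mX; case: (boolP (c <= a)%MM) => ca.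
  by rewrite -{1}(submK ca) addmC eqm_add2l.
by case: eqP => // e; rewrite e lem_addr in ca.
Qed.

Variables (K : nat) (eta : 'I_K -> S') (Z : {set 'I_K}) (g : 'I_k -> 'I_K).
Hypothesis eta_g : forall j, eta (g j) = mpsX A j.
Hypothesis gZ : forall l, l \notin Z -> exists j, l = g j.
Hypothesis ginj : injective g.

Lemma mmap1_mX (gam : 'X_{1..K}) : (forall l, l \in Z -> gam l = 0%N) ->
  mmap1 eta gam = mX [multinom gam (g j) | j < k].
Proof.
move e : (mdeg gam) => N; elim: N gam e => [|N IH] gam e hZ.
  have -> : gam = 0%MM by apply/eqP; rewrite -mdeg_eq0 e.
  rewrite mmap11 -mX0; congr mX; apply/mnmP => j; by rewrite mnmE !mnm0E.
have [l hl] : exists l, (0 < gam l)%N.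
  by apply: mnm_pos; rewrite -mdeg_eq0 e.
have eg : (gam - U_(l) + U_(l))%MM = gam by rewrite submK // lep1mP -lt0n.
have lZ : l \notin Z by apply: contraL hl => /hZ ->.
rewrite -eg monD mmap1U IH; last first.
- by move=> i /hZ; rewrite mnmBE => ->.
- by have := e; rewrite -{1}eg mdegD mdeg1 addn1 => -[].
have [j ej] := gZ lZ; rewrite ej eta_g -mXU -mXD; congr mX; apply/mnmP => i.
by rewrite mnmDE mnm1E mnmE [RHS]mnmE mnmDE mnm1E (inj_eq ginj).
Qed.

End MonomialSeries.

(** * Lengths of submodules spanned by monomials *)

Section MonomialModule.
Variables (V : fieldType) (k r' n : nat) (R : comUnitRingType).
Local Notation S' := (mpseries k V).
Local Notation r := r'.+1.
Variables (act : R -> 'cV[S']_r -> 'cV[S']_r) (H : is_action act).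
Local Notation Q := (module_of_action H).
Variables (cst : S' -> R) (x : 'I_n -> R) (active : pred 'I_n).
Variables (sg : 'I_n -> 'I_r -> 'I_r) (un : 'I_n -> 'I_r -> S')
  (ex : 'I_n -> 'I_r -> 'X_{1..k}) (al : 'I_n -> 'X_{1..k})
  (bd D : 'I_r -> 'X_{1..k}).
Hypothesis act_cst : forall s q, act (cst s) q = s *: q.
Hypothesis act_gen : forall y, exists s (g : 'I_n -> R),
  (forall q, act y q = s *: q + \sum_i act (x i) (act (g i) q)) /\
  (nonunits R y -> pscoef s 0%MM = 0).
Hypothesis cst_nonunit : forall s, pscoef s 0%MM = 0 -> nonunits R (cst s).
Hypothesis x_nonunit : forall i, nonunits R (x i).
Hypothesis act_inactive : forall i, ~~ active i -> forall q, act (x i) q = 0.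
Hypothesis sg_inj : forall i, active i -> injective (sg i).
Hypothesis un_unit : forall i, active i -> forall j, exists v, un i j * v = 1.
Hypothesis act_active : forall i, active i -> forall q j,
  act (x i) q (sg i j) 0 = un i j * (mX V (ex i j) * q j 0).
Hypothesis ex_bd : forall i, active i -> forall j,
  (ex i j *+ r + bd (sg i j) = bd j + al i)%MM.
Hypothesis bd_lt : forall j l, (bd j l < r)%N.
Hypothesis al_neq0 : forall i, active i -> al i != 0%MM.
Hypothesis act_e0 : forall j, exists y, act y (delta_mx ord0 0) = mX V (D j) *: delta_mx j 0.

(** The multidegree of y^c e_j, scaled by r to be integral: y^d adds r d to it, and u_i adds
    [al i]. *)
Definition wt (j : 'I_r) (c : 'X_{1..k}) : 'X_{1..k} := (c *+ r + bd j)%MM.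
Definition upclosed (X : 'I_r -> 'X_{1..k} -> bool) :=
  (forall j c d, X j c -> X j (c + d)%MM) /\
  (forall i j c, active i -> X j c -> X (sg i j) (c + ex i j)%MM).

Definition Sub (X : 'I_r -> 'X_{1..k} -> bool) : set Q :=
  [set q | forall j c, ~~ X j c -> pscoef ((q : 'cV[S']_r) j 0) c = 0].

Definition bpt (j : 'I_r) (c : 'X_{1..k}) : 'cV[S']_r := mX V c *: delta_mx j 0.

Lemma pscoef_bpt j c j' c' :
  pscoef (bpt j c j' 0) c' = if (j' == j) && (c' == c) then 1 else 0.
Proof.
rewrite /bpt !mxE eqxx andbT; case: (j' == j); last by rewrite mulr0.
by rewrite mulr1 pscoef_mX.
Qed.

Lemma wtD j c d : wt j (c + d)%MM = (wt j c + d *+ r)%MM.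
Proof. by apply/mnmP => l; rewrite /wt !mnmDE !mulmnE mnmDE; lia. Qed.

Lemma wt_act i j c : active i -> wt (sg i j) (c + ex i j)%MM = (wt j c + al i)%MM.
Proof.
move=> ai; have /mnmP e := ex_bd ai j; apply/mnmP => l; have := e l.
by rewrite /wt !mnmDE !mulmnE !mnmDE; lia.
Qed.

Lemma sg_onto i j : active i -> exists j', j = sg i j'.
Proof. by move=> ai; have /codomP := injF_onto (sg_inj ai) j. Qed.

Lemma scale_coef0 (s : S') (f : S') c :
  (forall c', (c' <= c)%MM -> pscoef f c' = 0) -> pscoef (s * f) c = 0.
Proof.
move=> h; rewrite pscoefM big1_seq // => c'; rewrite mem_lows => /= cc'.
by rewrite h ?mulr0 // lem_subr.
Qed.

Lemma act_x_coef0 i (q : Q) j c :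
  (forall j' c', active i -> j = sg i j' -> (c' + ex i j' <= c)%MM ->
     pscoef ((q : 'cV[S']_r) j' 0) c' = 0) ->
  pscoef (act (x i) q j 0) c = 0.
Proof.
move=> h; case: (boolP (active i)) => [ai|nai]; last by rewrite act_inactive // mxE.
have [j' ej] := sg_onto j ai; rewrite ej act_active //.
apply: scale_coef0 => c1 cc1; rewrite pscoef_mXM; case: ifP => // ec.
by apply: h => //; rewrite submK.
Qed.

(** An element of R unrolls as s plus a sum of terms u_i g_i. Each active u_i raises the weight
    strictly, as [al i] is not 0, so for a fixed coefficient the unrolling ends after finitely many
    rounds, counted by N. *)
Lemma Sub_act X y (q : Q) : upclosed X -> Sub X q -> Sub X (y *: q).
Proof.
move=> [Xd Xs] Xq.
suff h N y' (q' : Q) : Sub X q' -> forall j c, ~~ X j c -> (mdeg (wt j c) < N)%N ->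
    pscoef (act y' q' j 0) c = 0.
  by move=> j c nX; rewrite module_of_actionE; apply: (h (mdeg (wt j c)).+1).
elim: N y' q' => [//|N IH] y' q' Xq' j c nX hN.
have [s [g [-> _]]] := act_gen y'.
rewrite mxE pscoefD summxE pscoef_sum [X in X + _](_ : _ = 0).
  rewrite add0r big1 // => i _; apply: act_x_coef0 => j' c' ai ej ecc.
  have nX' : ~~ X j' c'.
    by apply: contra nX => /(Xs i _ _ ai) /(Xd _ _ (c - (c' + ex i j'))%MM); rewrite addmC submK // -ej.
  apply: IH => //; rewrite -ltnS; apply: leq_trans hN; rewrite ltnS.
  have := congr1 (@mdeg k) (wt_act j' c' ai); rewrite -ej.
  have := wtD j (c' + ex i j') (c - (c' + ex i j'))%MM; rewrite addmC submK // => -> /=.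
  rewrite !mdegD; have := al_neq0 ai; rewrite -mdeg_eq0 -lt0n; lia.
rewrite mxE; apply: scale_coef0 => c' cc'; apply: Xq'.
by apply: contra nX => /(Xd _ _ (c - c')%MM); rewrite addmC submK.
Qed.

Lemma Sub_submodule X : upclosed X -> submodule (Sub X).
Proof.
move=> uX; split; first by move=> j c _; rewrite mxE.
move=> y u v hu hv j c nX.
have := Sub_act y uX hu nX; rewrite mxE pscoefD hv // addr0.
exact.
Qed.

Definition addpt (X : 'I_r -> 'X_{1..k} -> bool) j0 c0 :=
  fun j c => X j c || ((j == j0) && (c == c0)).

Lemma Sub_bpt (X : 'I_r -> 'X_{1..k} -> bool) j c : X j c -> Sub X (bpt j c : Q).
Proof.
move=> Xj j' c' nX; rewrite pscoef_bpt; case: ifP => // /andP[/eqP ej /eqP ec].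
by rewrite ej ec Xj in nX.
Qed.

Lemma Sub_step X j0 c0 : upclosed X -> simple_step (Sub X) (Sub (addpt X j0 c0)).
Proof.
move=> uX; split.
  by move=> q hq j c; rewrite negb_or => /andP[/hq].
move=> L sL XL LX; case: (pselect (L `<=` Sub X)) => [|nL]; first by left.
right => q hq; have /existsNP[q0 /not_implyP[Lq0 nXq0]] := nL.
pose cf (q : Q) := pscoef ((q : 'cV[S']_r) j0 0) c0.
have nz : cf q0 != 0.
  apply/eqP => e; apply: nXq0 => j c nX.
  have [/andP[/eqP -> /eqP ->] //|npt] := boolP ((j == j0) && (c == c0)).
  by apply: (LX _ Lq0); rewrite /addpt negb_or nX npt.
pose s := mpsC k (cf q / cf q0).
rewrite -(subrK (cst s *: q0) q); apply: (submD sL); last exact: submZ.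
apply: XL => j c nX; rewrite module_of_actionE act_cst !mxE pscoefB pscoefCM.
have [/andP[/eqP -> /eqP ->]|npt] := boolP ((j == j0) && (c == c0)).
  by rewrite -/(cf q) -/(cf q0) divfK // subrr.
rewrite hq ?(LX _ Lq0) ?mulr0 ?subr0 //; by rewrite /addpt negb_or nX npt.
Qed.

(** The added monomial has the largest weight in the complement; its proper multiples are heavier
    and therefore already in X. *)
Lemma addpt_upclosed X j0 c0 : upclosed X ->
  (forall j c, ~~ X j c -> (mdeg (wt j c) <= mdeg (wt j0 c0))%N) ->
  upclosed (addpt X j0 c0).
Proof.
move=> [Xd Xs] hmax.
have grow j c : (mdeg (wt j0 c0) < mdeg (wt j c))%N -> X j c.
  by apply: contraLR => /hmax; rewrite -leqNgt.
split=> [j c d|i j c ai] /orP[h|/andP[/eqP -> /eqP ->]].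
- by rewrite /addpt Xd.
- have [->|nd] := eqVneq d 0%MM; first by rewrite addm0 /addpt !eqxx orbT.
  rewrite /addpt grow // wtD mdegD mdegMn -[X in (X < _)%N]addn0 ltn_add2l.
  by rewrite muln_gt0 lt0n mdeg_eq0 nd.
- by rewrite /addpt Xs.
- rewrite /addpt grow // wt_act // mdegD -[X in (X < _)%N]addn0 ltn_add2l.
  by rewrite lt0n mdeg_eq0 al_neq0.
Qed.

Definition compl_seq X (s : seq ('I_r * 'X_{1..k})) :=
  uniq s /\ forall j c, (~~ X j c) = ((j, c) \in s).

Lemma compl_max X s : compl_seq X s -> s != [::] ->
  exists2 p, p \in s & forall p', p' \in s -> (mdeg (wt p'.1 p'.2) <= mdeg (wt p.1 p.2))%N.
Proof.
move=> _; elim: s => [//|p s IH] _; have [->|ns] := eqVneq s [::].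
  by exists p; rewrite ?mem_head // => p'; rewrite inE => /eqP->.
have [p1 p1s hp1] := IH ns.
have [h|h] := leqP (mdeg (wt p.1 p.2)) (mdeg (wt p1.1 p1.2)).
  by exists p1; rewrite ?inE ?p1s ?orbT // => p'; rewrite inE => /orP[/eqP->|/hp1].
exists p; rewrite ?mem_head // => p'; rewrite inE => /orP[/eqP->//|/hp1 h'].
exact: leq_trans h' (ltnW h).
Qed.

Lemma compl_addpt X s p : compl_seq X s -> p \in s ->
  compl_seq (addpt X p.1 p.2) (rem p s).
Proof.
move=> [us hs] ps; split; first exact: rem_uniq.
move=> j c; rewrite (mem_rem_uniq p us) !inE -hs /addpt negb_or andbC; congr (_ && _).
Qed.

(** The complement is filled in from the heaviest monomial downwards: every stage is a submodule and
    every step is simple. *)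
Lemma length_Sub X s : upclosed X -> compl_seq X s -> quot_has_length (Sub X) (size s).
Proof.
move e : (size s) => N; elim: N X s e => [|N IH] X s e uX hs.
  have -> : Sub X = setT.
    apply/seteqP; split => // q _ j c; rewrite hs.2.
    by rewrite (size0nil e).
  exact: quot_has_length0.
have [|p ps pmax] := compl_max hs; first by case: (s) e.
have uX' : upclosed (addpt X p.1 p.2).
  by apply: addpt_upclosed => // j c; rewrite hs.2 => /pmax.
apply: (quot_has_lengthS (Sub_submodule uX) (Sub_step p.1 p.2 uX).1 _ (Sub_step p.1 p.2 uX)).
  move=> sub; have : Sub X (bpt p.1 p.2 : Q).
    by apply: sub; apply: Sub_bpt; apply/orP; right; rewrite !eqxx.
  have nX : ~~ X p.1 p.2 by rewrite hs.2 -surjective_pairing.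
  by move=> /(_ _ _ nX); rewrite pscoef_bpt !eqxx /= => /eqP; rewrite oner_eq0.
apply: (IH _ (rem p s)) => //; last exact: compl_addpt.
by rewrite size_rem // e.
Qed.

Definition pullback X : set R^o := [set y | Sub X ((y : R) *: (delta_mx ord0 0 : Q))].

Lemma pullback_ideal X : upclosed X -> ideal (pullback X).
Proof.
move=> uX; have sX := Sub_submodule uX; split.
  by rewrite /pullback /= scale0r; apply: submodule0.
move=> a u v hu hv; rewrite /pullback /= scalerDl.
by apply: (submD sX) => //; rewrite -scalerA; apply: (submZ _ sX hu).
Qed.

(** The monomials y^c e_j with [D j] <= c lie in R e_0, because y^(D j) e_j does. Filling in one of
    them enlarges the pullback strictly, and no other step shrinks it. *)
Lemma length_pullback X s : upclosed X -> compl_seq X s ->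
  length_ge (M := R^o) (count (fun p => (D p.1 <= p.2)%MM) s) (pullback X).
Proof.
move e : (size s) => N; elim: N X s e => [|N IH] X s e uX hs.
  by rewrite (size0nil e).
have [|p ps pmax] := compl_max hs; first by case: (s) e.
have uX' : upclosed (addpt X p.1 p.2).
  by apply: addpt_upclosed => // j c; rewrite hs.2 => /pmax.
have sub : pullback X `<=` pullback (addpt X p.1 p.2).
  by move=> y hy; apply: (Sub_step _ _ uX).1.
have h : length_ge (M := R^o) (count (fun p => (D p.1 <= p.2)%MM) (rem p s))
    (pullback (addpt X p.1 p.2)).
  by apply: IH => //; [rewrite size_rem // e | apply: compl_addpt].
rewrite (permP (perm_to_rem ps)) /=; case: (boolP (D p.1 <= p.2)%MM) => Dp; last first.
  exact: length_ge_mono h.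
exists (pullback (addpt X p.1 p.2)); split=> //; first exact: pullback_ideal.
have [y hy] := act_e0 p.1.
have e1 : (cst (mX V (p.2 - D p.1)%MM) * y) *: (delta_mx ord0 0 : Q) = (bpt p.1 p.2 : Q).
  rewrite -scalerA !module_of_actionE hy act_cst scalerA -mXD submK //.
move=> /(_ (cst (mX V (p.2 - D p.1)%MM) * y)); rewrite /pullback /= e1 => sub'.
have nX : ~~ X p.1 p.2 by rewrite hs.2 -surjective_pairing.
have : Sub X (bpt p.1 p.2 : Q).
  by apply: sub'; apply: Sub_bpt; apply/orP; right; rewrite !eqxx.
by move=> /(_ _ _ nX); rewrite pscoef_bpt !eqxx /= => /eqP; rewrite oner_eq0.
Qed.

(** * Powers of the maximal ideal acting on Q *)

Section Levels.
(** A surviving u_i with |al_i| < r has total weight below r, yet it counts as a full factor from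
    the maximal ideal. If such generators exist, [als] is the exponent of one of least degree and
    [gap] = r - |als| is the missing weight; otherwise [gap] = 0. *)
Variables (als : 'X_{1..k}) (gap : nat).
Hypothesis gap_le : (gap <= r)%N.
Hypothesis al_level : forall i, active i ->
  (r <= mdeg (al i))%N \/ ((als <= al i)%MM /\ (r <= mdeg (al i) + gap)%N).
Hypothesis gap_cases : gap = 0%N \/
  exists i, [/\ active i, al i = als & (mdeg als + gap = r)%N].
Local Notation m := (nonunits R).

(* The order function of the integral closures of the powers of the maximal
   ideal: s is the number of factors u_i of minimal degree that are split off
   the monomial. *)
Definition level t j c := `[< exists s, (als *+ s <= wt j c)%MM /\
  (r * t <= mdeg (wt j c) + s * gap)%N >].

Lemma level0 j c : level 0 j c.
Proof. by apply/asboolP; exists 0%N; split; [rewrite mulm0n lem0 | rewrite muln0]. Qed.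

Lemma level_grow t t' j c j' c' d : wt j' c' = (wt j c + d)%MM ->
  (r * t' <= r * t + mdeg d)%N -> level t j c -> level t' j' c'.
Proof.
move=> e h /asboolP[s [h1 h2]]; apply/asboolP; exists s; rewrite e mdegD; split; last by lia.
by apply: lepm_trans h1 _; apply: lem_addr.
Qed.

Lemma level_add t j c d : level t j c -> level t j (c + d)%MM.
Proof. by apply: (level_grow (wtD j c d)); apply: leq_addr. Qed.

Lemma level_var t j c l : level t j c -> level t.+1 j (c + U_(l))%MM.
Proof.
by apply: (level_grow (wtD j c U_(l))); rewrite mdegMn mdeg1 mul1n mulnS addnC.
Qed.

Lemma level_act t i j c : active i -> level t j c -> level t.+1 (sg i j) (c + ex i j)%MM.
Proof.
move=> ai; have [h|[h1 h2]] := al_level ai.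
  by apply: (level_grow (wt_act j c ai)); rewrite mulnS addnC leq_add2l.
move=> /asboolP[s [h3 h4]]; apply/asboolP; exists s.+1.
rewrite wt_act // mdegD; split; last by rewrite mulnS mulSn; lia.
apply/mnm_lepP => l; move: (mnm_lepP h3 l) (mnm_lepP h1 l).
by rewrite !mnmDE !mulmnE; lia.
Qed.

Lemma level_upclosed t : upclosed (level t).
Proof.
split=> [j c d|i j c ai h]; first exact: level_add.
apply: (level_grow (wt_act j c ai)) h; exact: leq_addr.
Qed.

Lemma Sub_var t l (q : Q) : Sub (level t) q -> Sub (level t.+1) (cst (mpsX V l) *: q).
Proof.
move=> hq j c nl; rewrite module_of_actionE act_cst mxE pscoefXM; case: ifP => // cl.
apply: hq; apply: contra nl => /(level_var l).
by rewrite submK // lep1mP -lt0n.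
Qed.

Lemma Sub_x t i (q : Q) : Sub (level t) q -> Sub (level t.+1) (x i *: q).
Proof.
move=> hq j c nl; rewrite module_of_actionE; apply: act_x_coef0 => j' c' ai ej ecc.
apply: hq; apply: contra nl => /(level_act ai) /(level_add (c - (c' + ex i j'))%MM).
by rewrite addmC submK // -ej.
Qed.

Lemma Sub_nonunit t y (q : Q) : m y -> Sub (level t) q -> Sub (level t.+1) (y *: q).
Proof.
move=> my hq; have [s [g [hy /(_ my) s0]]] := act_gen y.
have uX := level_upclosed; have sX := Sub_submodule (uX t.+1).
rewrite module_of_actionE hy; apply: (submD (M := Q) sX); last first.
  apply: (subm_sum (M := Q)) => // i _; apply: (Sub_x i (q := (g i *: q : Q))).
  exact: Sub_act.
have [h [es _]] := mps_split s; rewrite s0 mpsC0 add0r in es.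
rewrite es scaler_suml; apply: (subm_sum (M := Q)) => // i _.
rewrite -scalerA -[h i *: q]act_cst -act_cst.
by apply: (Sub_var i (q := (cst (h i) *: q : Q))); apply: Sub_act.
Qed.

Lemma Sub_exp N y : ideal_exp m N y -> forall t (q : Q), Sub (level t) q ->
  Sub (level (t + N)) (y *: q).
Proof.
elim: N y => [|N IH] y; first by move=> _ t q; rewrite addn0; apply/Sub_act/level_upclosed.
apply: (smul_min (M := R^o) (K := [set y | forall t (q : Q), Sub (level t) q ->
  Sub (level (t + N.+1)) ((y : R) *: q)])).
  have sX t := Sub_submodule (level_upclosed t).
  split; first by move=> t q _; rewrite scale0r; apply: (submodule0 (sX _)).
  move=> a u v hu hv t q hq; rewrite scalerDl.
  apply: (submD (sX _)); last exact: hv.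
  by rewrite -[a *: u]/(a * u) -scalerA; apply: (submZ _ (sX _)); apply: hu.
move=> a z ma hz t q hq; rewrite -[a *: z]/(a * z) -scalerA addnS.
exact/Sub_nonunit/IH.
Qed.

Local Notation powQ N := (smul (ideal_exp m N) (setT : set Q)).

Lemma powQ_Sub N : powQ N `<=` Sub (level N).
Proof.
apply: smul_min; first exact/Sub_submodule/level_upclosed.
move=> a q ha _; rewrite -[N]add0n; apply: Sub_exp => // j c.
by rewrite level0.
Qed.

Lemma powQ0 q : powQ 0 q.
Proof. by rewrite -[q]scale1r; apply: smul_mem. Qed.

Lemma powQ_step N y q : m y -> powQ N q -> powQ N.+1 (y *: q).
Proof.
move=> my; apply: (smul_min (K := [set q | powQ N.+1 (y *: q)])).
  split; first by rewrite /= scaler0; apply: (submodule0 (smul_sub _ _)).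
  move=> a u v hu hv; rewrite /= scalerDr; apply: (submD (smul_sub _ _)) => //.
  by rewrite scalerA mulrC -scalerA; apply: (submZ _ (smul_sub _ _)).
move=> a z ha _; rewrite /= scalerA; apply: smul_mem => //.
exact: (smul_mem (M := R^o)).
Qed.

Lemma powQ_high N (q : Q) : (forall j, ord_ge N ((q : 'cV[S']_r) j 0)) -> powQ N q.
Proof.
elim: N q => [|N IH] q hq; first exact: powQ0.
have [g hg] := choice (fun j => mps_split ((q : 'cV[S']_r) j 0)).
have eq : q = \sum_l (cst (mpsX V l) *: ((\col_j g j l) : Q)) :> Q.
  apply/colP => j; rewrite [LHS](hg j).1 (hq j 0%MM) ?mdeg0 // mpsC0 add0r.
  rewrite (_ : \sum_l _ = \sum_l (mpsX V l *: (\col_j g j l) : 'cV[S']_r)).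
    by rewrite summxE; apply: eq_bigr => l _; rewrite !mxE.
  by apply: eq_bigr => l _; rewrite module_of_actionE act_cst.
rewrite eq; apply: subm_sum; first exact: smul_sub.
move=> l _; apply: powQ_step.
  by apply: cst_nonunit; rewrite pscoefX eq_sym mnm1_eq0.
by apply: IH => j c hc; rewrite mxE; apply: ((hg j).2 N (hq j)).
Qed.

Lemma mdeg_bd j : (mdeg (bd j) <= k * r)%N.
Proof.
rewrite mdegE -[k in (k * r)%N]card_ord -sum_nat_const; apply: leq_sum => l _.
exact/ltnW/bd_lt.
Qed.

(** Each split-off factor u_i with exponent [als] accounts for one power of the maximal ideal. Once
    none is left, the weight r (N + k) forces |c| >= N, because |bd j| <= k r; this is the origin of
    the shift by k. *)
Lemma powQ_bpt s N j c : (als *+ s <= wt j c)%MM ->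
  (r * (N + k) <= mdeg (wt j c) + s * gap)%N -> powQ N (bpt j c : Q).
Proof.
have high N' j' c' : (r * (N' + k) <= mdeg (wt j' c'))%N -> powQ N' (bpt j' c' : Q).
  move=> h; apply: powQ_high => j1 c1 hc1; rewrite pscoef_bpt; case: ifP => // /andP[_ /eqP e].
  move: h; rewrite /wt mdegD mdegMn -e; have := mdeg_bd j'.
  by move: hc1; nia.
elim: s N j c => [|s IH] N j c; first by rewrite mul0n addn0 => _; apply: high.
case: gap_cases => [g0|[i [ai ei er]]]; first by rewrite g0 muln0 addn0 => _; apply: high.
case: N => [|N] hs hN; first exact: powQ0.
have [j' ej] := sg_onto j ai.
have /mnmP eb := ex_bd ai j'.
(* In each variable, r ex + bd j = bd j' + als < r + als <= r + r c + bd j, so ex < c + 1. *)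
have ec : (ex i j' <= c)%MM.
  apply/mnm_lepP => l; have := eb l; move/mnm_lepP/(_ l): hs.
  rewrite /wt ej ei !mnmDE !mulmnE; have := bd_lt j' l; nia.
pose c' := (c - ex i j')%MM; have cc' : (c' + ex i j')%MM = c by rewrite submK.
have ew : wt j c = (wt j' c' + als)%MM by rewrite ej -cc' wt_act // ei.
have := powQ_step (x_nonunit i) (IH N j' c' _ _).
have [v hv] := un_unit ai j'.
have -> : x i *: (bpt j' c' : Q) = un i j' *: bpt j c :> Q.
  rewrite module_of_actionE; apply/colP => j1; have [j1' ej1] := sg_onto j1 ai.
  rewrite ej1 act_active // [RHS]mxE /bpt !mxE ej (inj_eq (sg_inj ai)) eqxx andbT.
  case: eqP => [->|_]; last by rewrite !mulr0.
  by rewrite !mulr1 -mXD addmC cc'.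
move=> h; have -> : (bpt j c : Q) = cst v *: ((un i j' *: bpt j c) : Q).
  by rewrite module_of_actionE act_cst scalerA mulrC hv scale1r.
apply: (submZ _ (smul_sub _ _)); apply: h.
  apply/mnm_lepP => l; move/mnm_lepP/(_ l): hs; rewrite ew mnmDE !mulmnE; lia.
by move: hN; rewrite ew mdegD mulSn; nia.
Qed.

(** The part of q in degrees below N is a finite combination of monomials, treated one by one with
    [powQ_bpt]; the remainder has order at least N in every coordinate. *)
Lemma Sub_powQ N : Sub (level (N + k)) `<=` powQ N.
Proof.
move=> q hq.
pose lo : 'cV[S']_r := \sum_j \sum_(c <- mon_lt k N) mpsC k (pscoef ((q : 'cV[S']_r) j 0) c) *: bpt j c.
rewrite -(subrK (lo : Q) q); apply: (submD (smul_sub _ _)); last first.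
  apply: (subm_sum (M := Q)) => [|j _]; first exact: smul_sub.
  apply: (subm_sum (M := Q)) => [|c _]; first exact: smul_sub.
  rewrite -act_cst; case: (boolP (level (N + k) j c)) => [/asboolP[s [h1 h2]]|nl].
    exact: (submZ (M := Q) _ (smul_sub _ _) (powQ_bpt h1 h2)).
  by rewrite hq // mpsC0 act_cst scale0r; apply: (submodule0 (smul_sub _ _)).
apply: powQ_high => j c hc; rewrite mxE pscoefD mxE pscoefN summxE pscoef_sum.
rewrite (bigD1 j) //= [X in _ - (_ + X)]big1 ?addr0; last first.
  move=> j' nj; rewrite summxE pscoef_sum big1_seq // => c' _.
  by rewrite mxE pscoefCM pscoef_bpt eq_sym (negPf nj) mulr0.
rewrite summxE pscoef_sum (bigD1_seq c) ?mon_lt_uniq ?mem_mon_lt //= big1 ?addr0.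
  by rewrite mxE pscoefCM pscoef_bpt !eqxx mulr1 subrr.
move=> c' nc; rewrite mxE pscoefCM pscoef_bpt eqxx [c == c']eq_sym (negPf nc).
by rewrite mulr0.
Qed.

Lemma nlevel_wt t j c : ~~ level t j c -> (mdeg (wt j c) < r * t)%N.
Proof.
apply: contraR; rewrite -leqNgt => h; apply/asboolP; exists 0%N.
by rewrite mulm0n lem0 mul0n addn0.
Qed.

Lemma mdeg_wt j c : mdeg (wt j c) = (r * mdeg c + mdeg (bd j))%N.
Proof. by rewrite /wt mdegD mdegMn mulnC. Qed.

Lemma nlevel_deg t j c : ~~ level t j c -> (mdeg c < t)%N.
Proof. by move/nlevel_wt; rewrite mdeg_wt; nia. Qed.

Definition compl t := [seq p <- [seq (j, c) | j <- enum 'I_r, c <- mon_lt k t] | ~~ level t p.1 p.2].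

Lemma compl_level t : compl_seq (level t) (compl t).
Proof.
split.
  apply/filter_uniq/allpairs_uniq; [exact: enum_uniq | exact: mon_lt_uniq |].
  by move=> [? ?] [? ?].
move=> j c; rewrite mem_filter /=; case: (boolP (level t j c)) => //= nl.
apply/esym/allpairsP; exists (j, c); rewrite mem_enum mem_mon_lt; split=> //.
exact: nlevel_deg nl.
Qed.

Lemma size_compl t :
  size (compl t) = (\sum_j count (fun c => ~~ level t j c) (mon_lt k t))%N.
Proof.
rewrite size_filter count_flatten -map_comp sumnE big_map big_enum /=.
by apply: eq_bigr => j _; rewrite count_map.
Qed.

Lemma wt_divn j c a t : (mdeg (wt j c) + a < r * t)%N =
  (mdeg c + (mdeg (bd j) + a) %/ r < t)%N.
Proof.
rewrite mdeg_wt -addnA mulnC [(r * t)%N]mulnC.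
rewrite -(ltn_divLR _ _ (ltn0Sn _)) divnMDl //.
Qed.

(* The recurrence compares the complements of consecutive levels through the
   injection (j, c) |-> (sg i j, c + ex i j) for i of minimal degree. *)
Lemma size_compl_sum : exists (J : pred 'I_r) (rho : 'I_r -> nat),
  forall t, size (compl t) = (\sum_(j | J j) nmon k (t - rho j))%N.
Proof.
pose rho j := (mdeg (bd j) %/ r)%N.
have cW t j : count (fun c => (mdeg (wt j c) < r * t)%N) (mon_lt k t) = nmon k (t - rho j).
  rewrite -(@count_mdeg _ t) //; apply: eq_count => c; rewrite -[mdeg (wt j c)]addn0 wt_divn.
  by rewrite addn0.
case: gap_cases => [g0|[i [ai ei er]]].
  exists predT, rho => t; rewrite size_compl; apply: eq_bigr => j _.
  rewrite -cW; apply: eq_count => c; apply/idP/idP => [/nlevel_wt //|h].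
  by apply/asboolP => -[s [_]]; rewrite g0 muln0 addn0 leqNgt h.
(* The analogue of [rho] after multiplication by the minimal u_i; since |als| <= r, it grows by at
   most 1. *)
pose rho' j := ((mdeg (bd j) + mdeg als) %/ r)%N.
have rho'E j : rho' j = rho j \/ rho' j = (rho j).+1.
  have : (rho' j <= (rho j).+1)%N.
    rewrite /rho' -ltnS ltn_divLR // /rho.
    have := divn_eq (mdeg (bd j)) r; have := ltn_pmod (mdeg (bd j)) (ltn0Sn r'); nia.
  have : (rho j <= rho' j)%N by apply: leq_div2r; apply: leq_addr.
  lia.
(* In the recurrence over t the indices with [rho' j = rho j] cancel, and the others telescope to
   [nmon k (t - rho j)]. *)
exists (fun j => rho' j == (rho j).+1), rho.
have shift j c : (ex i j <= c)%MM = (als <= wt (sg i j) c)%MM.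
  have /mnmP eb := ex_bd ai j; apply/mnm_lepP/mnm_lepP => h l; have := eb l; have := h l;
    by rewrite /wt !mnmDE !mulmnE ei; have := bd_lt j l; nia.
have im t j c : (~~ level t.+1 (sg i j) (c + ex i j)%MM) = ~~ level t j c.
  apply/idP/idP; first by apply: contra; apply: level_act.
  move=> nl; apply/asboolP => -[[|s]]; rewrite wt_act // ei.
    move=> [_]; rewrite mul0n addn0 mdegD leqNgt => /negP; apply.
    have := nlevel_wt nl; rewrite mulnS; lia.
  move=> [h1 h2]; move/asboolP: nl; apply; exists s; split.
    by apply/mnm_lepP => l; have := mnm_lepP h1 l; rewrite mnmDE !mulmnE; lia.
  by move: h2; rewrite mdegD mulnS mulSn; lia.
(* On exponents divisible by [ex i j], translation matches the complements at levels t + 1 and t. On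
   the others [als] does not divide the weight, so s = 0 is forced and the level reduces to the
   plain weight bound, which [nmon] counts. *)
have rec1 t j : (count (fun c => ~~ level t.+1 (sg i j) c) (mon_lt k t.+1) + nmon k (t.+1 - rho' j)
    = count (fun c => ~~ level t j c) (mon_lt k t) + nmon k (t.+1 - rho (sg i j)))%N.
  have split (P : pred 'X_{1..k}) u : count P u =
      (count (fun c => (ex i j <= c)%MM && P c) u + count (fun c => ~~ (ex i j <= c)%MM && P c) u)%N.
    by elim: u => //= c u ->; case: (_ <= _)%MM; case: (P c); lia.
  rewrite -cW split [in RHS](split (fun c => mdeg (wt (sg i j) c) < _)%N).
  rewrite (@count_shift _ _ _ _ t) => [|c|c]; last 2 first.
  - exact: nlevel_deg.
  - by rewrite im; apply: nlevel_deg.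
  rewrite (@count_shift _ _ _ _ t.+1) => [|c|c]; last 2 first.
  - by rewrite mdeg_wt; nia.
  - by rewrite wt_act // mdegD mdeg_wt; nia.
  rewrite (eq_count (im t j)) -(@count_mdeg k t.+1) //.
  rewrite (@eq_count _ (fun c => ~~ (ex i j <= c)%MM && ~~ level t.+1 (sg i j) c)
    (fun c => ~~ (ex i j <= c)%MM && (mdeg (wt (sg i j) c) < r * t.+1)%N)); last first.
    move=> c; case: (boolP (ex i j <= c)%MM) => //= nle.
    apply/idP/idP => [/nlevel_wt //|h]; apply/asboolP => -[[|s] [h1]].
      by rewrite mul0n addn0 leqNgt h.
    move=> _; move/negP: nle; apply; rewrite shift; apply: lepm_trans h1.
    by rewrite mulmS lem_addr.
  rewrite [in RHS](@eq_count _ (fun c => mdeg (wt (sg i j) (c + ex i j)) < _)%N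
    (fun c => mdeg c + rho' j < t.+1)%N); first by lia.
  by move=> c; rewrite wt_act // ei mdegD wt_divn.
have rec t : (size (compl t.+1) + \sum_j nmon k (t.+1 - rho' j)
    = size (compl t) + \sum_j nmon k (t.+1 - rho j))%N.
  rewrite !size_compl (reindex (sg i)) /=; last exact/onW_bij/injF_bij/sg_inj.
  rewrite [in RHS](reindex (sg i) (F := fun j => nmon k (t.+1 - rho j))) /=; last exact/onW_bij/injF_bij/sg_inj.
  by rewrite -!big_split; apply: eq_bigr => j _; apply: rec1.
elim=> [|t IH].
  by rewrite size_compl !big1 // => j _; [rewrite sub0n nmon0 | apply/eqP; rewrite -leqn0 (leq_trans (count_size _ _)) // size_mon_lt nmon0].
have := rec t; rewrite IH (bigID (fun j => rho' j == (rho j).+1)) /=.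
rewrite [X in (_ = _ + X)%N](bigID (fun j => rho' j == (rho j).+1)) /=.
rewrite (eq_bigr (fun j => nmon k (t - rho j))) => [|j /eqP ->]; last by rewrite subSS.
rewrite (eq_bigr (fun j => nmon k (t.+1 - rho j)) (P := fun j => rho' j != _)) => [|j /eqP nj]; last by have [->|/nj] := rho'E j.
lia.
Qed.

(** Removing y^gam lowers the total weight by r |gam| and costs at most r |gam| factors [als], each
    worth [gap] <= r: altogether r (r + 1) |gam|, that is (r + 1) |gam| levels. *)
Lemma level_shift (gam : 'X_{1..k}) t j c :
  level (t + mdeg gam * r.+1) j (c + gam)%MM -> level t j c.
Proof.
move=> /asboolP[s [h1 h2]]; apply/asboolP; exists (s - r * mdeg gam)%N; split.
  apply/mnm_lepP => l; have := mnm_lepP h1 l; rewrite wtD !mnmDE !mulmnE.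
  have : (gam l <= mdeg gam)%N by rewrite mdegE (bigD1 l) //= leq_addr.
  case: (als l) => [|a]; first by rewrite !mul0n.
  nia.
move: h2; rewrite wtD mdegD mdegMn => h2.
have : (s * gap <= (s - r * mdeg gam) * gap + r * mdeg gam * r)%N by nia.
nia.
Qed.

(** Translation by the sum of all [D j] moves every monomial into R e_0, and by [level_shift] it
    raises the level by a bounded amount only. *)
Lemma size_compl_le : exists c1, forall t,
  (size (compl t) <= count (fun p => (D p.1 <= p.2)%MM) (compl (t + c1)))%N.
Proof.
pose gam := (\sum_j D j)%MM; exists (mdeg gam * r.+1)%N => t.
rewrite -size_filter -(size_map (fun p => (p.1, (p.2 + gam)%MM))).
have [ut ht] := compl_level t; have [ut' ht'] := compl_level (t + mdeg gam * r.+1).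
apply: uniq_leq_size.
  by rewrite map_inj_uniq // => -[j1 m1] [j2 m2] /= [-> /eqP]; rewrite -[_ == _]/((m1 + gam)%MM == (m2 + gam)%MM) eqm_add2r => /eqP ->.
move=> p /mapP[[j c] + ->]; rewrite -ht mem_filter -ht' => nl.
rewrite (contra (@level_shift _ _ _ _) nl) andbT /=.
apply: lepm_trans (lem_addl _ _); rewrite /gam (bigD1 j) //=; exact: lem_addr.
Qed.

Lemma very_small_bound : noetherian R -> local R -> krull_dim R k ->
  exists e c, [/\ multiplicity Q e, parameter_degree R c & e <= c%:R].
Proof.
move=> nR lR dimk; have [J [rho hT]] := size_compl_sum.
have [c hc] := parameter_degree_ex nR lR dimk; exists (#|J|%:R), c; split=> //; last first.
  have [[xs sx qx] _] := hc; have [dx xm _] := sx.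
  have ek : size xs = k.
    by apply/anti_leq; rewrite (dimk.2 _ dx.1) (dx.2 _ dimk.1).
  have [c1 hc1] := size_compl_le.
  have [B1 h1] := sum_nmon_ge k J rho.
  have [B2 h2] := pow_shift_up (c1 + k) k.
  rewrite ler_nat; apply: (@leading_coef_le k _ _ B1 B2) => t.
  (* The complement injects into monomials counted by the pullback, the pullback contains the power
     t + c1 of the parameter ideal I, and R/I^(t + c1) is bounded by [length_le_exp]. *)
  have ht : (size (compl t) <= c * nmon k (t + c1))%N.
    apply: (leq_trans (hc1 t)); apply: (length_le_exp ek qx).
    apply: length_ge_mono (length_pullback (level_upclosed _) (compl_level _)).
    have Jm : ideal_gen [set` xs] `<=` m by exact: (span_min (M := R^o) lR xm).
    have expm N : ideal_exp (ideal_gen [set` xs]) N `<=` ideal_exp m N.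
      elim: N => // N IH; apply: (smul_min (M := R^o)); first exact: smul_sub.
      by move=> a z /Jm ma /IH hz; apply: (smul_mem (M := R^o)).
    move=> y /expm /Sub_exp h; have := h 0%N (delta_mx ord0 0); rewrite add0n; apply.
    by move=> j c'; rewrite level0.
  apply: (leq_trans (h1 t)); rewrite -hT.
  apply: (@leq_trans (c * (k`! * nmon k (t + c1)) * t)).
    by rewrite leq_mul // mulnCA leq_mul.
  rewrite -mulnA leq_mul //; apply: leq_trans (h2 t); rewrite leq_mul // addnA.
  exact: nmon_le.
exists k => // eps eps0.
have [B1 h1] := sum_nmon_ge k J rho; have [B2 h2] := sum_nmon_le k J rho k.
have [N hN] := leading_coef_limit k #|J| (B1 + B2) eps0; exists N => t Nt.
have lT := length_Sub (level_upclosed (t + k)) (compl_level (t + k)).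
have [l hl] : exists l, quot_has_length (powQ t) l.
  apply: (@quot_has_length_ex _ _ _ (size (compl (t + k)))); first exact: smul_sub.
  exact: length_le_mono (@Sub_powQ t) (quot_has_length_le lT).
exists l => //; rewrite -natrM; apply: hN => //.
  have : (size (compl t) <= l)%N.
    apply: (quot_has_length_le hl); apply: length_ge_mono (@powQ_Sub t) _.
    exact: quot_has_length_ge (length_Sub (level_upclosed t) (compl_level t)).
  rewrite hT => lt; apply: (@leq_trans (#|J| * (t ^ k * (t - B1)))); first by rewrite !leq_mul //; lia.
  by apply: (leq_trans (h1 t)); rewrite !leq_mul.
have : (l <= size (compl (t + k)))%N.
  apply: (quot_has_length_le lT); apply: length_ge_mono (@Sub_powQ t) _.
  exact: quot_has_length_ge hl.
rewrite hT => lt; apply: (@leq_trans (#|J| * (t ^ k * (t + B2)))); last by rewrite !leq_mul //; lia.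
by apply: leq_trans (h2 t); rewrite !leq_mul.
Qed.

End Levels.

End MonomialModule.

(** The degrees add up to a positive multiple of r below 2 r, so |be| = 1: both exponents live on
    one variable, where comparing degrees means comparing exponents. *)
Lemma degree_one_divisor k (al al' be : 'X_{1..k}) r : al != 0%MM ->
  (al + al' = be *+ r)%MM -> (mdeg al <= mdeg al')%N -> (mdeg al' < r)%N -> (al <= al')%MM.
Proof.
move=> al0 e le lt.
have /mdeg1P[l /eqP be1] : mdeg be == 1%N.
  have := congr1 (@mdeg k) e; rewrite mdegD mdegMn.
  by move: al0; rewrite -mdeg_eq0; move: (mdeg al) (mdeg al') (mdeg be) le lt => a b c; nia.
have supp l' : l' != l -> al l' = 0%N /\ al' l' = 0%N.
  move=> nl; have /mnmP/(_ l') := e; rewrite be1 mnmDE mulmnE mnm1E eq_sym (negPf nl) mul0n; lia.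
apply/mnm_lepP => l'; have [->|/supp[-> //]] := eqVneq l' l.
have mdegl (c : 'X_{1..k}) : (forall j, j != l -> c j = 0%N) -> mdeg c = c l.
  by move=> h; rewrite mdegE (bigD1 l) //= big1 ?addn0.
by rewrite -!mdegl // => j /supp[].
Qed.

(** Among the active exponents of degree below r, one of least degree divides all the others by
    [degree_one_divisor]. *)
Lemma minimal_degree_gap k n r (active : pred 'I_n) (al : 'I_n -> 'X_{1..k}) :
  (forall i, active i -> al i != 0%MM) ->
  (forall i j : 'I_n, active i -> i != j -> exists be, (al i + al j = be *+ r)%MM) ->
  exists als gap, [/\ (gap <= r)%N,
    forall i, active i -> (r <= mdeg (al i))%N \/ ((als <= al i)%MM /\ (r <= mdeg (al i) + gap)%N) &
    gap = 0%N \/ exists i, [/\ active i, al i = als & (mdeg als + gap = r)%N]].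
Proof.
move=> al0 hal; case: (pickP (fun i => active i && (mdeg (al i) < r)%N)) => [i1 hi1|hn]; last first.
  exists 0%MM, 0%N; split=> // [i ai|]; last by left.
  by left; rewrite leqNgt; have := hn i; rewrite ai /= => ->.
have [i0 /andP[a0 lt0] imin] := @arg_minnP _ i1
  (fun i => active i && (mdeg (al i) < r)%N) (fun i => mdeg (al i)) hi1.
exists (al i0), (r - mdeg (al i0))%N; split; first exact: leq_subr.
  move=> i ai; have [|lt] := leqP r (mdeg (al i)); [by left | right].
  have le : (mdeg (al i0) <= mdeg (al i))%N by apply: imin; rewrite ai lt.
  split; last by lia.
  have [->|ne] := eqVneq i i0; first exact: lepm_refl.
  have [be e] := hal i0 i a0 (negbT (introF eqP (fun e => elimN eqP ne (esym e)))).
  exact: degree_one_divisor (al0 _ a0) e le lt.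
by right; exists i0; split=> //; lia.
Qed.

Theorem field_very_small_MCM (d n m : nat)
    (hnm : ((2 <= n)%N /\ m = 2%N) \/ (n = 2%N /\ odd m))
    (R : comUnitRingType) (hR : analytic R) (V : fieldType) :
  T_family_field V d n m R -> (forall p : nat, p \in [pchar V] -> ~~ (p %| m)%N) ->
  exists Q : lmodType R, very_small_MCM Q.
Proof.
move=> [a [b [alpha [beta [au bu [phi [phi_surj phi_ker]]]]]]] hchar.
have [hn hl _ _ _] := hR.
have m0 := m_pos hnm; have three := three_indices hnm.
pose ybar (i : 'I_d) : mpseries d V := mpsX V i.
have nu (v : V) : nonunits V v <-> v = 0.
  by rewrite /nonunits /= unitfE negbK; split => [/eqP|->].
have Vlocal : local V.
  by split=> [|c v w /nu -> /nu ->]; apply/nu => //; rewrite addr0 scaler0.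
have X0 N (A : comNzRingType) (i : 'I_N) : pscoef (mpsX A i) 0%MM = 0.
  by rewrite pscoefX (eq_sym 0%MM) mnm1_eq0.
have ybar_nonunit l : nonunits V (pscoef (ybar l) 0%MM) by apply/nu; rewrite X0.
have ybar_gen (J : set (mpseries d V)) s : ideal J -> (forall l, J (ybar l)) ->
    nonunits V (pscoef s 0%MM) -> J s.
  move=> iJ hJ /nu v0; have [g [-> _]] := mps_split s.
  rewrite v0 mpsC0 add0r; apply: (subm_sum (M := (mpseries d V)^o)) => // i _.
  exact: (idealMr _ iJ).
(* For m = 2 the assumption on the characteristic says that 2 is nonzero; then 2 is a unit in R and
   lies in no prime, so [two] is taken to be false. *)
have V2 : m = 2 -> (2%:R : V) != 0.
  move=> m2; apply/negP => e; have := hchar 2; rewrite m2 dvdnn => /(_ _) h.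
  by move: h; rewrite inE /= e => /(_ isT).
have two_vanishing : m = 2 -> forall q, prime_ideal q -> q (phi (mpsC n 2%:R)) ->
    (fun=> False) (vanishing ybar phi q).
  move=> /V2 n2 q pq q2; case/negP: (prime_le_nonunits pq q2); apply: rmorph_unit.
  apply: constC_unit; rewrite pscoefC eqxx.
  by rewrite -[2%:R]/(1 + 1) pscoefD pscoef1 eqxx unitfE.
have [Z cZ maxZ] := maximal_consistent m0 au phi_ker (fun=> False).
pose A : {set 'I_d} := (~: Z)%SET.
have inA j : j \in A -> exists i : 'I_#|A|, j = enum_val i.
  by move=> jA; exists (enum_rank_in jA j); rewrite enum_rankK_in.
pose xs := [seq mpsX V (enum_val i) | i <- enum 'I_#|A|].
have [theta [thX thX0 thC /(_ (fun y => ex_intro _ y erefl)) th_surj]] :=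
  restrict_ex A (idfun : {rmorphism V -> V}).
have [|||||||X [act [H [hC hX dimk hM]]]] := @MCM_construction V d n m d ybar a b alpha beta R phi
  hn hl m0 au bu phi_surj phi_ker Vlocal ybar_nonunit ybar_gen three V2 (fun=> False) two_vanishing
  Z #|A| V 0 theta xs cZ maxZ (@wdiv_field_sep V) (@wdiv_field_complete V) th_surj.
- move=> l; have [/inA[i ->]|jA] := boolP (l \in A); last by rewrite thX0 //; apply: fil0.
  by rewrite thX; apply: filX.
- by move=> l lZ; rewrite thX0 // finset.in_setC negbK.
- move=> l lZ; have /inA[i ->] : l \in A by rewrite finset.in_setC.
  by rewrite thX; apply: mpsX_regular.
- by [].
- by rewrite size_map size_enum_ord.
- by rewrite -map_comp (eq_map (g := fun i => mpsX V i)) //; case: (variables_regular V #|A|).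
- by rewrite -map_comp (eq_map (g := fun i => mpsX V i)) //; case: (variables_regular V #|A|).
exists (module_of_action H); split; first by split=> //; exact: module_fg H hC th_surj.
pose k := #|A|; pose g : 'I_k -> 'I_d := enum_val.
pose res (c : 'X_{1..d}) : 'X_{1..k} := [multinom c (g j) | j < k].
have gZ j : g j \notin Z by rewrite -finset.in_setC; apply: enum_valP.
have mon_res (c : 'X_{1..d}) : (forall l, l \in Z -> c l = 0%N) ->
    mmap1 (fun l => theta (ybar l)) c = mX V (res c).
  apply: mmap1_mX => [j|l lZ|]; first exact: thX.
    by apply: inA; rewrite finset.in_setC.
  exact: enum_val_inj.
have al_supp i : active alpha Z i -> forall l, l \in Z -> alpha i l = 0%N.
  move=> /forallP h l lZ; have := h l; rewrite lZ implybF -eqn0Ngt.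
  by move/eqP.
have th0 s : pscoef (theta s) 0%MM = pscoef s 0%MM.
  have [h [es _]] := mps_split s; rewrite [in LHS]es rmorphD thC rmorph_sum pscoefD pscoefC eqxx.
  rewrite pscoef_sum big1 ?addr0 // => l _; rewrite rmorphM pscoefM0.
  have [/inA[i ->]|lA] := boolP (l \in A); first by rewrite thX X0 mul0r.
  by rewrite thX0 // pscoef0 mul0r.
have phi_nu := phi_nonunit m0 au bu phi_surj phi_ker Vlocal ybar_nonunit.
have [lift hlift] := choice th_surj.
have hse i : exists se : ('I_(mr X).+1 -> 'I_(mr X).+1) * ('I_(mr X).+1 -> mpseries k V) *
    ('I_(mr X).+1 -> 'X_{1..d}), active alpha Z i -> let: (s, u, e) := se in
    [/\ injective s, forall j, exists v, u j * v = 1,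
        forall k j, mU X i k j = if k == s j then u j * mmap1 (fun l => theta (ybar l)) (e j) else 0 &
        forall j l, ((mr X).+1 * e j l + mbasis (s j) l = mbasis j l + alpha i l)%N].
  have [ai|nai] := boolP (active alpha Z i); last by exists (id, fun=> 0, fun=> 0%MM).
  by have [s [u [e h]]] := mU_active X ai; exists (s, u, e).
have {hse} [se hse] := choice hse.
pose al i := res (alpha i).
have al0 i : active alpha Z i -> al i != 0%MM.
  move=> ai; have [l hl0] := mnm_pos (alpha_neq0 m0 au phi_ker i).
  have [|j ej] := inA l.
    by rewrite finset.in_setC; apply: contraL hl0 => /(al_supp _ ai) ->.
  apply: contraL hl0 => /eqP/mnmP/(_ j); rewrite mnm0E (_ : al i j = alpha i l) ?mnmE ?ej // => ->.
  by [].
have [als [gap [gap_le al_level gap_cases]]] : exists als gap, [/\ (gap <= (mr X).+1)%N,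
    forall i, active alpha Z i -> ((mr X).+1 <= mdeg (al i))%N \/
      ((als <= al i)%MM /\ ((mr X).+1 <= mdeg (al i) + gap)%N) &
    gap = 0%N \/ exists i, [/\ active alpha Z i, al i = als & (mdeg als + gap = (mr X).+1)%N]].
  apply: minimal_degree_gap => // i j ai ij; rewrite (mr_active X ai).
  have [lt|lt|/val_inj e] := ltngtP i j; last by rewrite e eqxx in ij.
    have [_ _ /mnmP e] := bu _ _ lt; exists (res (beta i j)); apply/mnmP => l.
    by have := e (g l); rewrite !mnmDE !mulmnE !mnmE.
  have [_ _ /mnmP e] := bu _ _ lt; exists (res (beta j i)); apply/mnmP => l.
  by have := e (g l); rewrite !mnmDE !mulmnE !mnmE addnC.
have [actA act1 actDr actDl] := H.
apply: (@very_small_bound V k (mr X) n R act H (fun s => phi (mpsC n (lift s)))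
  (fun i => phi (mpsX (mpseries d V) i)) (active alpha Z) (fun i => (se i).1.1)
  (fun i => (se i).1.2) (fun i j => res ((se i).2 j)) al (fun j : 'I_(mr X).+1 => res (mbasis j))
  (fun j : 'I_(mr X).+1 => res (mexpo j)) _ _ _ _ _ _ _ _ _ _ _ _ als gap) => //.
- by move=> s q; rewrite hC hlift.
- move=> y; have [f ef] := phi_surj y; have [h [es _]] := mps_split f.
  exists (theta (pscoef f 0%MM)), (fun i => phi (h i)); split=> [q|ny].
    rewrite -ef [in LHS]es rmorphD rmorph_sum actDl hC; congr (_ + _).
    have q0 : act 0 q = 0 by apply: (addrI (act 0 q)); rewrite -actDl !addr0.
    rewrite (big_morph (act ^~ q) (actDl q) q0); apply: eq_bigr => i _.
    by rewrite rmorphM -actA.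
  rewrite th0; apply/nu; apply/negP => /constC_unit /(rmorph_unit phi).
  by rewrite ef; apply/negP.
- by move=> s s0; apply: phi_nu; rewrite pscoefC eqxx; apply/nu; rewrite -th0 hlift.
- by move=> i; apply: phi_nu; rewrite X0; apply/nu.
- by move=> i nai q; rewrite hX mU_inactive // mul0mx.
- by move=> i /hse; case: (se i) => [[s u] e] [].
- by move=> i /hse; case: (se i) => [[s u] e] [].
- move=> i ai q j; rewrite hX; have := hse i ai; case: (se i) => [[s u] e] /= [si _ hU he].
  rewrite mxE (bigD1 j) //= big1 ?addr0 => [|j' nj]; last first.
    by rewrite hU (inj_eq si) eq_sym (negPf nj) mul0r.
  rewrite hU eqxx mulrA mon_res // => l lZ; have := he j l.
  by rewrite !(mbasis_supp _ lZ) (al_supp i ai l lZ); lia.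
- move=> i ai j; have := hse i ai; case: (se i) => [[s u] e] /= [_ _ _ he].
  by apply/mnmP => l; have := he j (g l); rewrite !mnmDE !mulmnE !mnmE mulnC.
- by move=> j l; rewrite mnmE mbasis_lt.
- move=> j; rewrite -mon_res; last by move=> l; apply: mexpo_supp.
  have [[-> ->]|[i e]] := mexpo_ex j; first by exists 1; rewrite act1 mmap11 scale1r.
  exists (phi (mpsX (mpseries d V) i) ^+ j); rewrite -e.
  elim: (nat_of_ord j) => [|t IH]; first by rewrite !expr0 act1 mul1mx.
  by rewrite !exprS -actA IH hX mulmxA.
Qed.

Theorem theorem1p5 (d n m : nat)
    (hnm : ((2 <= n)%N /\ m = 2%N) \/ (n = 2%N /\ odd m))
    (R : comUnitRingType) (hR : analytic R) :
  (* (EQUI) *)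
  (forall V : fieldType,
     T_family_field V d n m R ->
     GRing.closed_field_axiom V -> uncountable V ->
     (forall p : nat, p \in [pchar V] -> ~~ (p %| m)%N) ->
     exists Q : lmodType R, very_small_MCM Q) /\
  (* (MIX) *)
  (forall (p : nat) (V : idomainType),
     complete_pring p V ->
     T_family_pring p V d n m R ->
     exists Q : lmodType R, MCM Q).

Proof.
split=> [V hT _ _|p V]; first exact: field_very_small_MCM hT.
exact: mixed_MCM.
Qed.
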